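(* Let $\alpha\in\{0,1\}$. For each $n$ let $G_n=([n],E_n)$ be a simple graph and let $W=(w_{ij})_{1\le i,j\le n}$ be a symmetric matrix with $(w_{ij})_{i\le j}$ i.i.d. real random variables, independent of $G_n$, $w_{ji}=w_{ij}$. Let $T(G_n)$ be the diagonal matrix with $T(G_n)_{ii}=\sum_j w_{ij}A(G_n)_{ij}$, and $\bar\Delta_n=W\circ A(G_n)-\alpha T(G_n)$ (where $\circ$ is the entrywise product), with empirical spectral measure $\mu_{\bar\Delta_n}$. Assume (B): with $o$ a uniformly chosen vertex, the random variables $\sum_{k=1}^n A(G_n)_{ok}|w_{ok}|$, $n\in\mathbb N$, are uniformly integrable. (i) If the $G_n$ are deterministic and $U(G_n)\Rightarrow\rho$ for some probability measure $\rho$ on $\mathcal G^*$, then there is a probability measure $\nu$ on $\mathbb R$ such that almost surely $\mu_{\bar\Delta_n}\to\nu$ weakly. (ii) If the $G_n$ are random and $\mathbb E[U_2(G_n)]\Rightarrow\rho\otimes\rho$ for some probability measure $\rho$ on $\mathcal G^*$, then there is a probability measure $\nu$ on $\mathbb R$ such that $\lim_{n\to\infty}\mathbb E\,L(\mu_{\bar\Delta_n},\nu)=0$.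
   Context: $A(G)$ is the adjacency matrix. The empirical spectral measure of an $n\times n$ symmetric matrix $M$ is $n^{-1}\sum_i\delta_{\lambda_i(M)}$. $L$ is the Lévy distance, $L(\mu,\nu)=\inf\{h\ge0:\forall x,\ \mu((-\infty,x-h])-h\le\nu((-\infty,x])\le\mu((-\infty,x-h])+h\}$. $\mathcal G^*$ is the space of rooted-isomorphism classes of rooted connected locally finite graphs with the local metric (distance $1/(r+1)$, $r$ the supremum of radii for which the balls around the roots are rooted-isomorphic). $U(G)$ is the law of $[G,o]$ (component of $o$ rooted at $o$) for a uniform vertex $o$; $U_2(G)$ the law of $([G,o_1],[G,o_2])$ for a uniform pair $(o_1,o_2)$; $\mathbb E[U_2(G_n)](B)=\mathbb E[U_2(G_n)(B)]$; $\Rightarrow$ is weak convergence.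
   Formalization: The Lévy distance is taken in its standard form μ((-∞,x-h])-h ≤ ν((-∞,x]) ≤ μ((-∞,x+h])+h, correcting the upper bound printed with x-h, under which (ii) fails (e.g. graphs with a single edge and all weights 1). *)

(* Defs.v *)
From HB Require Import structures.
From mathcomp Require Import all_boot all_order all_algebra.
From mathcomp Require Import all_classical all_reals all_analysis.
Set Implicit Arguments. Unset Strict Implicit. Unset Printing Implicit Defensive.
Import Order.TTheory GRing.Theory Num.Theory.
Import numFieldNormedType.Exports.
Local Open Scope classical_set_scope.
Local Open Scope ring_scope.

(* Rooted graphs: representatives of points of G*                      *)
(* A rooted graph is given by a simple, locally finite adjacency       *)
(* relation on nat; the root is 0 and the rooted graph it stands for   *)
(* is the connected component of 0 (vertices outside that component    *)
(* play no role: balls around the root never see them).               *)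
Record rooted_graph := RGraph {
  radj : nat -> nat -> bool;
  radj_sym : forall a b, radj a b = radj b a;
  radj_irr : forall a, radj a a = false;
  radj_lf : forall a, exists N, forall b, radj a b -> (b < N)%N }.

HB.instance Definition _ := gen_eqMixin rooted_graph.
HB.instance Definition _ := gen_choiceMixin rooted_graph.

Definition rg_empty : rooted_graph.
Proof. by exists (fun _ _ => false) => // a; exists 0%N. Defined.
HB.instance Definition _ := isPointed.Build rooted_graph rg_empty.

Fixpoint inball (G : rooted_graph) (r : nat) (v : nat) : Prop :=
  match r with
  | 0%N => v = 0%N
  | r'.+1 => inball G r' v \/ exists u, inball G r' u /\ radj G u v
  end.

Definition ball_iso (G H : rooted_graph) (r : nat) : Prop :=
  exists (f g : nat -> nat),
    [/\ f 0%N = 0%N,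
        (forall v, inball G r v -> inball H r (f v) /\ g (f v) = v),
        (forall v, inball H r v -> inball G r (g v) /\ f (g v) = v)
      & (forall u v, inball G r u -> inball G r v -> radj G u v = radj H (f u) (f v))].

(* local (pseudo)distance  1/(1+sup{r : ball_iso r}), written as
   inf {1/(r+1) : ball_iso r}  (equal, since r |-> 1/(r+1) is decreasing,
   and 0 when the sup is infinite) *)
Definition local_dist {R : realType} (G H : rooted_graph) : R :=
  inf [set (r.+1%:R)^-1 | r in ball_iso G H].

Definition local_open {R : realType} : set (set rooted_graph) :=
  [set A | forall G, A G -> exists2 d : R, 0 < d &
     forall H, local_dist G H < d -> A H].

Definition Gstar (R : realType) := g_sigma_algebraType (@local_open R).

Definition rg_bcont {R : realType} (f : rooted_graph -> R) : Prop :=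
  (exists C : R, forall G, `|f G| <= C) /\
  forall G (e : R), 0 < e -> exists2 d : R, 0 < d &
     forall H, local_dist G H < d -> `|f G - f H| < e.

Definition rg2_bcont {R : realType} (f : rooted_graph * rooted_graph -> R) : Prop :=
  (exists C : R, forall x, `|f x| <= C) /\
  forall G1 G2 (e : R), 0 < e -> exists2 d : R, 0 < d &
     forall H1 H2, local_dist G1 H1 < d -> local_dist G2 H2 < d ->
       `|f (G1, G2) - f (H1, H2)| < e.

Definition simple_graph n (A : rel 'I_n) : Prop :=
  (forall i j, A i j = A j i) /\ (forall i, A i i = false).

(* relabel 'I_n by swapping o and 0; then read G on nat.  For a simple
   graph G the adjacency below is exactly G (relabelled); the component
   of 0 is the component of o, rooted at o. *)
Definition swap0 n (o : 'I_n) (a : nat) : nat :=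
  if a == nat_of_ord o then 0%N else if a == 0%N then nat_of_ord o else a.

Definition rooted_adj n (G : rel 'I_n) (o : 'I_n) (a b : nat) : bool :=
  match insub (swap0 o a), insub (swap0 o b) with
  | Some i, Some j => (a != b) && (G i j || G j i)
  | _, _ => false
  end.

Lemma rooted_adj_sym n (G : rel 'I_n) o a b :
  rooted_adj G o a b = rooted_adj G o b a.
Proof.
rewrite /rooted_adj; case: insubP => [i _ _|_]; case: insubP => [j _ _|_] //.
by rewrite eq_sym orbC.
Qed.

Lemma rooted_adj_irr n (G : rel 'I_n) o a : rooted_adj G o a a = false.
Proof. by rewrite /rooted_adj; case: insubP => [i _ _|_] //; rewrite eqxx. Qed.



Lemma rooted_adj_lf n (G : rel 'I_n) o a :
  exists N, forall b, rooted_adj G o a b -> (b < N)%N.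
Proof.
exists n.+1 => b; rewrite /rooted_adj; case: insubP => [i _ _|_] //.
case: insubP => [j Hj _|_] // _; move: Hj; rewrite /swap0.
case: ifP => [/eqP Hb _|_].
  rewrite Hb; exact: (ltnW (ltn_ord o)).
case: ifP => [/eqP -> //|_]; exact: ltnW.
Qed.

Definition rooted_of n (G : rel 'I_n) (o : 'I_n) : rooted_graph :=
  RGraph (@rooted_adj_sym n G o) (@rooted_adj_irr n G o) (@rooted_adj_lf n G o).

Definition U_int {R : realType} n (G : rel 'I_n) (f : rooted_graph -> R) : R :=
  n%:R^-1 * \sum_(o < n) f (rooted_of G o).

Definition U2_int {R : realType} n (G : rel 'I_n) (f : rooted_graph * rooted_graph -> R) : R :=
  (n%:R ^+ 2)^-1 * \sum_(o1 < n) \sum_(o2 < n) f (rooted_of G o1, rooted_of G o2).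

(* eigenvalues with multiplicity: a list s of size n with
   char_poly M = prod_(x <- s) ('X - x) (exists and is unique up to
   permutation for real symmetric M). *)
Definition eigvals {R : realType} n (M : 'M[R]_n) : seq R :=
  xget [::] [set s : seq R | size s = n /\
     char_poly M = \prod_(x <- s) ('X - x%:P)].

Definition esm_int {R : realType} n (M : 'M[R]_n) (f : R -> R) : R :=
  n%:R^-1 * \sum_(l <- eigvals M) f l.

Definition esm_cdf {R : realType} n (M : 'M[R]_n) (x : R) : R :=
  n%:R^-1 * (count (fun l => l <= x) (eigvals M))%:R.

Definition esm_weak_cvg {R : realType} (M : forall n, 'M[R]_n)
    (nu : probability R R) : Prop :=
  forall f : R -> R, continuous f -> (exists C : R, forall x, `|f x| <= C) ->
    (esm_int (M n) f)%:E @[n --> \oo] --> (\int[nu]_x (f x)%:E)%E.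

Definition levy {R : realType} n (M : 'M[R]_n) (nu : probability R R) : R :=
  inf [set h : R | 0 <= h /\ forall x : R,
     esm_cdf M (x - h) - h <= fine (nu `]-oo, x]%classic) <= esm_cdf M (x + h) + h].

Definition Wsym {R : realType} (T : Type) (w : nat -> nat -> T -> R) (om : T) (i j : nat) : R :=
  w (minn i j) (maxn i j) om.

Definition Delta {R : realType} (alpha : bool) (T : Type)
    (w : nat -> nat -> T -> R) (om : T) n (G : rel 'I_n) : 'M[R]_n :=
  \matrix_(i < n, j < n)
    (Wsym w om i j * (G i j)%:R
     - (i == j)%:R * alpha%:R * \sum_(k < n) Wsym w om i k * (G i k)%:R).

Definition upper (p : nat * nat) : bool := (p.1 <= p.2)%N.

Definition iid_weights {d} {T : measurableType d} {R : realType}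
    (P : probability T R) (w : nat -> nat -> T -> R) : Prop :=
  (forall i j, measurable_fun setT (w i j)) /\
  (forall (F : seq (nat * nat)) (B : nat * nat -> set R),
     uniq F -> all upper F -> (forall p, measurable (B p)) ->
     P (\bigcap_(p in [set p | p \in F]) (w p.1 p.2 @^-1` B p)) =
     (\prod_(p <- F) P (w p.1 p.2 @^-1` B p))%E) /\
  (forall i j k l (B : set R), (i <= j)%N -> (k <= l)%N -> measurable B ->
     P (w i j @^-1` B) = P (w k l @^-1` B)).

Definition indep_of_graph {d} {T : measurableType d} {R : realType}
    (P : probability T R) (w : nat -> nat -> T -> R) n (G : T -> rel 'I_n) : Prop :=
  forall (S : set (rel 'I_n)) (F : seq (nat * nat)) (B : nat * nat -> set R),
    uniq F -> all upper F -> (forall p, measurable (B p)) ->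
    let E := \bigcap_(p in [set p | p \in F]) (w p.1 p.2 @^-1` B p) in
    P ([set om | S (G om)] `&` E) = (P [set om | S (G om)] * P E)%E.

Definition wdeg {R : realType} (T : Type) (w : nat -> nat -> T -> R) (om : T)
    n (G : rel 'I_n) (o : 'I_n) : R :=
  \sum_(k < n) (G o k)%:R * `|Wsym w om o k|.

(* Assumption (B): with o uniform on [n] (independent of everything),
   the random variables X_n = wdeg (G n) o are uniformly integrable:
   for all eps > 0 there is M with sup_n E[X_n 1{X_n > M}] <= eps. *)
Definition UI_wdeg {d} {T : measurableType d} {R : realType}
    (P : probability T R) (w : nat -> nat -> T -> R)
    (G : forall n, T -> rel 'I_n) : Prop :=
  forall e : R, 0 < e -> exists M : R, forall n,
    (n%:R^-1%:E * \sum_(o < n)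
       \int[P]_om ((wdeg w om (G n om) o) * (M < wdeg w om (G n om) o)%R%:R)%R%:E
     <= e%:E)%E.

(* Main.v *)
Require Import Defs.
From HB Require Import structures.
From mathcomp Require Import all_boot all_order all_algebra.
From mathcomp Require Import all_classical all_reals all_analysis.
From mathcomp Require Import measurable_realfun lra.
Import Order.TTheory GRing.Theory Num.Theory.
Import numFieldNormedType.Exports.
Local Open Scope classical_set_scope.
Local Open Scope ring_scope.

Set Implicit Arguments. Unset Strict Implicit. Unset Printing Implicit Defensive.

(** Changing a symmetric matrix on a proportion [z] of its rows moves its spectral
    distribution function by at most [z], and a perturbation with row sums at most
    [e] shifts it by at most [e].  Hence one may delete the edges at vertices of
    degree above [D] (few vertices see such a deletion, since the local limit is
    locally finite), discard the weights above [K], and round the others to finitely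
    many values, changing the spectral distribution little in Levy distance.  The
    remaining matrix is bounded, so its spectral distribution is controlled by
    finitely many normalised traces of powers.  The expectation of such a trace over
    the weights is the [U(G_n)]-mean of a function of a ball around the root, hence
    converges, and a bounded-differences inequality on the finite product space of
    rounded weights shows that the trace is within [eta n] of its expectation outside
    an event of exponentially small probability.  So at every scale [h] two
    realisations outside the exceptional events have [h]-close spectral distributions
    and the Levy limit [nu] exists by completeness.  For deterministic graphs
    Borel-Cantelli concludes; for random graphs, convergence of [E U_2] to a product
    gives [L2]-convergence of the local means. *)

(** * Real symmetric matrices *)

Section RealSpectral.
Variable R : realType.

(** Traces of high powers of [Delta] need not be integrable, so the moment method is applied only
    after truncation. Rounding to a finite alphabet makes every expectation over the weights a
    finite sum and every event about them a finite union of measurable cylinders; it also lets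
    graphs of different sizes be compared by matching coordinates. Sparsity is what makes the
    concentration exponential in [n]: after the degree cut only O(n) weights matter, and each moves
    a trace by O(1). Closeness is stated between two realisations, possibly on different graphs of
    different sizes, so [nu] comes from a Cauchy argument and is never identified with the spectral
    measure of an operator on the limit graph; no question of self-adjointness arises. The
    exceptional weight events are attached to each fixed graph, so one certificate
    ([spectral_level]) serves both claims: it is evaluated along the sequence when the graphs are
    deterministic, and averaged over the graph by independence when they are random. *)

Definition dotp n (u v : 'rV[R]_n) : R := (u *m v^T) 0 0.

Lemma dotpE n (u v : 'rV[R]_n) : dotp u v = \sum_i u 0 i * v 0 i.
Proof. by rewrite /dotp mxE; apply: eq_bigr => i _; rewrite mxE. Qed.

Lemma dotpC n (u v : 'rV[R]_n) : dotp u v = dotp v u.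
Proof. by rewrite !dotpE; apply: eq_bigr => i _; rewrite mulrC. Qed.

Lemma dotp_mx n (u v : 'rV[R]_n) : u *m v^T = (dotp u v)%:M.
Proof. by apply/matrixP => i j; rewrite !ord1 [RHS]mxE eqxx. Qed.

Lemma dotpDl n (u v w : 'rV[R]_n) : dotp (u + v) w = dotp u w + dotp v w.
Proof. by rewrite /dotp mulmxDl mxE. Qed.

Lemma dotpZl n a (u v : 'rV[R]_n) : dotp (a *: u) v = a * dotp u v.
Proof. by rewrite /dotp -scalemxAl mxE. Qed.

Lemma dotp_sq n (u : 'rV[R]_n) : dotp u u = \sum_i u 0 i ^+ 2.
Proof. by rewrite dotpE; apply: eq_bigr => i _; rewrite expr2. Qed.

Lemma dotp_ge0 n (u : 'rV[R]_n) : 0 <= dotp u u.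
Proof. by rewrite dotp_sq; apply: sumr_ge0 => i _; rewrite sqr_ge0. Qed.

Lemma dotp_eq0 n (u : 'rV[R]_n) : (dotp u u == 0) = (u == 0).
Proof.
apply/idP/eqP => [|->]; last by rewrite /dotp mul0mx mxE.
rewrite dotp_sq psumr_eq0; last by move=> i _; rewrite sqr_ge0.
move=> /allP u0; apply/rowP => i; rewrite mxE; apply/eqP.
by rewrite -sqrf_eq0; apply: u0; rewrite mem_index_enum.
Qed.

Lemma dotp_gt0 n (u : 'rV[R]_n) : u != 0 -> 0 < dotp u u.
Proof. by move=> u0; rewrite lt_def dotp_ge0 dotp_eq0 u0. Qed.

Lemma dotp_symmetric n (M : 'M[R]_n) (u v : 'rV[R]_n) : M^T = M ->
  dotp (u *m M) v = dotp (v *m M) u.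
Proof. by move=> MT; rewrite [RHS]dotpC /dotp trmx_mul MT mulmxA. Qed.

Lemma continuous_sumr (T : topologicalType) I (r : seq I) (F : I -> T -> R) :
  (forall i, continuous (F i)) -> continuous (fun x => \sum_(i <- r) F i x).
Proof.
move=> cF.
exact: (@continuous_big R^o _ +%R 0 xpredT (@add_continuous R^o) _ r F).
Qed.

Lemma continuous_mulr (T : topologicalType) (f g : T -> R) :
  continuous f -> continuous g -> continuous (fun x => f x * g x).
Proof. by move=> cf cg x; apply: cvgM; [exact: cf|exact: cg]. Qed.

Lemma continuous_dotp_mx n (M : 'M[R]_n) : continuous (fun v : 'rV[R]_n => dotp (v *m M) v).
Proof.
have -> : (fun v : 'rV[R]_n => dotp (v *m M) v) =
    (fun v => \sum_i (\sum_j v 0 j * M j i) * v 0 i).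
  by apply/funext => v; rewrite dotpE; apply: eq_bigr => i _; rewrite mxE.
have coord i : continuous (fun v : 'rV[R]_n => v 0 i) by exact: coord_continuous.
have cs i : continuous (fun v : 'rV[R]_n => \sum_j v 0 j * M j i).
  apply: continuous_sumr => j; apply: continuous_mulr => //; exact: cst_continuous.
by apply: continuous_sumr => i; apply: continuous_mulr.
Qed.

(** The quadratic form of [M] attains its maximum on the compact unit sphere, and a maximiser is an
    eigenvector for the maximal value. *)
Lemma symmetric_eigenvector n (M : 'M[R]_n.+1) : M^T = M ->
  exists u : 'rV[R]_n.+1, exists l : R, dotp u u = 1 /\ u *m M = l *: u.
Proof.
move=> MT; pose S := [set u : 'rV[R]_n.+1 | dotp u u = 1].
have S0 : S !=set0.
  exists (delta_mx 0 0); rewrite /S /= dotp_sq (bigD1 ord0) //= big1 => [|i i0].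
    by rewrite mxE !eqxx expr1n addr0.
  by rewrite mxE (negbTE i0) andbF expr0n.
have cS : compact S.
  apply: (@subclosed_compact _ S
    [set v : 'rV[R]_n.+1 | forall i, v ord0 i \in `[(-1), 1]]).
  - have -> : S = (fun v => dotp (v *m 1%:M) v) @^-1` [set x | x = 1].
      by apply/seteqP; split => v; rewrite /S /= mulmx1.
    by apply: (continuous_closedP _).1; [exact: continuous_dotp_mx|exact: closed_eq].
  - exact: (@rV_compact R n.+1 (fun=> `[(-1), 1]%classic) (fun=> @segment_compact R (-1) 1)).
  - move=> v + i; rewrite /S /= dotp_sq (bigD1 i) //= => v1.
    have : v ord0 i ^+ 2 <= 1.
      by rewrite -v1 lerDl; apply: sumr_ge0 => j _; rewrite sqr_ge0.
    by rewrite in_itv /= -ler_norml => h; rewrite -(@ler_pXn2r _ 2) ?nnegrE // expr1n real_normK ?num_real.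
have [|u uS umax] := @EVT_max_rV R n.+1 (fun v => dotp (v *m M) v) S S0 cS.
  by apply: continuous_subspaceT; exact: continuous_dotp_mx.
have {uS}u1 : dotp u u = 1 by rewrite inE in uS.
set l := dotp (u *m M) u in umax.
exists u, l; split=> //.
have le v : dotp (v *m M) v <= l * dotp v v.
  have [->|v0] := eqVneq v 0; first by rewrite /dotp !mul0mx mxE mulr0.
  have c0 := dotp_gt0 v0; set c := dotp v v in c0 *.
  pose k := (Num.sqrt c)^-1.
  have kc : k ^+ 2 * c = 1.
    by rewrite /k exprVn sqr_sqrtr ?ltW // mulVf // gt_eqF.
  have := umax (k *: v); rewrite inE /S /= dotpZl dotpC dotpZl -/c mulrA -expr2.
  move=> /(_ kc); rewrite -scalemxAl dotpZl dotpC dotpZl mulrA -expr2 dotpC => kl.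
  rewrite -(ler_pM2l (_ : 0 < k ^+ 2)); last first.
    by rewrite exprn_gt0 // invr_gt0 sqrtr_gt0.
  by rewrite mulrCA kc mulr1.
(* [l - M] is positive semidefinite and vanishes at [u], so its form has a
   critical point there. *)
pose N := l%:M - M.
have NT : N^T = N by rewrite /N linearB /= tr_scalar_mx MT.
have qN v : 0 <= dotp (v *m N) v.
  by rewrite /N mulmxBr dotpDl mul_mx_scalar dotpZl -scaleN1r dotpZl mulN1r subr_ge0.
have uN0 : dotp (u *m N) u = 0.
  by rewrite /N mulmxBr dotpDl mul_mx_scalar dotpZl -scaleN1r dotpZl mulN1r u1 mulr1 subrr.
suff /eqP : u *m N == 0.
  by rewrite /N mulmxBr mul_mx_scalar => /eqP; rewrite subr_eq0 => /eqP ->.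
pose w := u *m N; rewrite -/w -dotp_eq0; apply/eqP.
have q t : 0 <= t * 2 * dotp w w + t ^+ 2 * dotp (w *m N) w.
  have := qN (u + t *: w); rewrite mulmxDl -scalemxAl dotpDl dotpZl.
  rewrite dotpC dotpDl dotpZl [dotp (w *m N) _]dotpC dotpDl dotpZl.
  rewrite [dotp u (u *m N)]dotpC uN0 [dotp u (w *m N)]dotpC [dotp (w *m N) u]dotp_symmetric //.
  by rewrite -/w [dotp w (w *m N)]dotpC; set a := dotp w w; set b := dotp _ w; lra.
have w0 := dotp_ge0 w; set a := dotp w w in q w0 *; set b := dotp (w *m N) w in q.
have b0 : 0 <= b := qN w.
apply/eqP; rewrite eq_le w0 andbT leNgt; apply/negP => a0.
(* Nearly the minimiser -a/b of 2ta + t^2 b; the [+ 1] keeps the denominator positive when b = 0.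
   The value is -(a/(b+1))^2 (b+2). *)
have := q (- a / (b + 1)).
have -> : - a / (b + 1) * 2 * a + (- a / (b + 1)) ^+ 2 * b =
   - (a / (b + 1)) ^+ 2 * (b + 2).
  have bn : b + 1 != 0 by rewrite gt_eqF //; lra.
  have -> : a = (a / (b + 1)) * (b + 1) by rewrite divfK.
  by rewrite !mulNr mulfK //; set k := a / (b + 1); lra.
rewrite mulNr oppr_ge0 leNgt => /negP; apply.
by rewrite mulr_gt0 ?exprn_gt0 ?divr_gt0 //; lra.
Qed.

(** The reflection exchanging [u] with the first basis vector is orthogonal and has first row [u].
    If the two coincide there is no mirror, and the identity serves. *)
Lemma householder n (u : 'rV[R]_n.+1) : dotp u u = 1 ->
  exists2 Q : 'M[R]_n.+1, Q *m Q^T = 1%:M & row 0 Q = u.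
Proof.
move=> u1; pose e : 'rV[R]_n.+1 := delta_mx 0 0.
have row0 (Q : 'M[R]_n.+1) : row 0 Q = e *m Q by rewrite rowE.
have [ue|ne] := eqVneq u e.
  by exists 1%:M; rewrite ?trmx1 ?mulmx1 // row0 mulmx1.
pose w := u - e; have w0 : w != 0 by rewrite subr_eq0.
have c0 := dotp_gt0 w0; set c := dotp w w in c0.
have e1 : dotp e e = 1.
  by rewrite /dotp mxE (bigD1 0) //= big1 ?mxE ?eqxx ?mulr1 ?addr0 // => i i0; rewrite !mxE (negbTE i0) mul0r.
have cE : c = 2 - 2 * dotp e u.
  rewrite /c /w dotpDl dotpC dotpDl -scaleN1r [dotp (_ *: _) _]dotpZl [dotp (-1 *: e) _]dotpZl.
  by rewrite [dotp e (u + _)]dotpC dotpDl dotpZl u1 e1 [dotp u e]dotpC; set k := dotp e u; lra.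
pose Q := 1%:M - (2 / c) *: (w^T *m w).
have QT : Q^T = Q by rewrite /Q linearB /= trmx1 linearZ /= trmx_mul trmxK.
have cn : c != 0 by rewrite gt_eqF.
exists Q.
  rewrite QT /Q mulmxBr mulmx1 mulmxBl mul1mx -scalemxAr -scalemxAl.
  rewrite mulmxA -(mulmxA w^T) dotp_mx -/c mul_mx_scalar -scalemxAl !scalerA.
  have -> : 2 / c * (2 / c) * c = 2 / c + 2 / c by rewrite -mulrA divfK //; lra.
  by rewrite scalerDl opprD addrA opprK addrA subrK subrK.
rewrite row0 /Q mulmxBr mulmx1 -scalemxAr mulmxA dotp_mx mul_scalar_mx scalerA.
have -> : dotp e w = - (c / 2).
  rewrite /w dotpC dotpDl -scaleN1r dotpZl e1 dotpC cE; set k := dotp e u; lra.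
have -> : 2 / c * - (c / 2) = -1 by rewrite mulrN mulrA divfK // divff.
by rewrite scaleN1r opprK /w addrC subrK.
Qed.

(** Deflation: after conjugation by an orthogonal matrix whose first row is an eigenvector, row 0
    vanishes off the corner, symmetry clears column 0, and induction handles the remaining block. *)
Lemma symmetric_diagonalization n (M : 'M[R]_n) : M^T = M ->
  exists P : 'M[R]_n, exists d : 'rV[R]_n,
    P *m P^T = 1%:M /\ M = P^T *m diag_mx d *m P.
Proof.
elim: n M => [|n IH] M MT.
  by exists 1%:M, 0; split; apply/matrixP => -[].
have [u [l [u1 ul]]] := symmetric_eigenvector MT.
have [Q QQ Qu] := householder u1.
have QQ' : Q^T *m Q = 1%:M := mulmx1C QQ.
pose B : 'M[R]_(1 + n) := Q *m M *m Q^T.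
have BT : B^T = B by rewrite /B !trmx_mul trmxK MT mulmxA.
have B0 j : B 0 j = l * (0 == j)%:R.
  have -> : B 0 j = row 0 B 0 j by rewrite [RHS]mxE.
  rewrite /B row_mul row_mul Qu ul -scalemxAl -Qu -row_mul QQ.
  by rewrite !mxE.
have BQ : Q^T *m B *m Q = M.
  by rewrite /B !mulmxA QQ' mul1mx -mulmxA QQ' mulmx1.
move: B BT B0 BQ => B BT B0 BQ.
have BE : B = block_mx l%:M 0 0 (drsubmx B).
  rewrite -[LHS]submxK; congr block_mx; apply/matrixP => i j.
  - rewrite !mxE !ord1; have -> : lshift n 0 = 0 :> 'I_(1 + n) by apply/val_inj.
    by rewrite B0 eqxx mulr1.
  - rewrite !mxE !ord1; have -> : lshift n 0 = 0 :> 'I_(1 + n) by apply/val_inj.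
    by rewrite B0 mulr0.
  - rewrite -BT !mxE !ord1; have -> : lshift n 0 = 0 :> 'I_(1 + n) by apply/val_inj.
    by rewrite B0 mulr0.
have [|P [d [PP dE]]] := IH (drsubmx B).
  by rewrite -[in RHS]BT -trmx_drsub.
pose P1 : 'M[R]_(1 + n) := block_mx 1%:M 0 0 P.
have P1T : P1^T = block_mx 1%:M 0 0 P^T by rewrite /P1 tr_block_mx trmx1 !trmx0.
have PP1 : P1 *m P1^T = 1%:M.
  rewrite P1T /P1 mulmx_block !mulmx0 !mul0mx.
  by rewrite !addr0 !add0r PP mulmx1 -scalar_mx_block.
have P1B : P1^T *m diag_mx (row_mx (l%:M : 'M[R]_1) d) *m P1 = B.
  rewrite BE dE P1T /P1 diag_mx_row !mulmx_block !mulmx0 !mul0mx !mulmx1 !mul1mx.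
  rewrite !addr0 !add0r; congr block_mx; rewrite ?mulmx0 ?mul0mx //.
  by apply/matrixP => i j; rewrite !ord1 !mxE.
exists (P1 *m Q), (row_mx (l%:M : 'M[R]_1) d); split.
  by rewrite trmx_mul mulmxA -(mulmxA P1) QQ mulmx1.
by rewrite trmx_mul !mulmxA -(mulmxA _ P1^T) -(mulmxA _ _ P1) P1B.
Qed.

End RealSpectral.

(** * Eigenvalue counts under perturbation *)

Section SymmetricPerturbation.
Variable R : realType.

Lemma under_determined_solution n m (K : 'M[R]_(n, m)) : (m < n)%N ->
  exists2 v : 'rV[R]_n, v != 0 & v *m K = 0.
Proof.
move=> mn; have : kermx K != 0.
  rewrite -mxrank_eq0 mxrank_ker subn_eq0 -ltnNge.
  by apply: leq_ltn_trans (rank_leq_col _) mn.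
by case/rowV0Pn => v /sub_kermxP vK v0; exists v.
Qed.

Section Diagonalized.
Variables (n : nat) (M P : 'M[R]_n) (d : 'rV[R]_n).
Hypotheses (PP : P *m P^T = 1%:M) (ME : M = P^T *m diag_mx d *m P).

Lemma qform_diagonalized (v : 'rV[R]_n) :
  dotp (v *m M) v = \sum_i d 0 i * (v *m P^T) 0 i ^+ 2.
Proof.
rewrite ME /dotp !mulmxA -(mulmxA _ P).
have -> : P *m v^T = (v *m P^T)^T by rewrite trmx_mul trmxK.
rewrite mxE; apply: eq_bigr => i _; rewrite mul_mx_diag !mxE; lra.
Qed.

Lemma dotp_diagonalized (v : 'rV[R]_n) :
  \sum_i (v *m P^T) 0 i ^+ 2 = \sum_i v 0 i ^+ 2.
Proof.
rewrite -!dotp_sq /dotp trmx_mul trmxK mulmxA -(mulmxA v).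
by rewrite (mulmx1C PP) mulmx1.
Qed.

Lemma char_poly_diagonalized : char_poly M = \prod_i ('X - (d 0 i)%:P).
Proof.
rewrite /char_poly ME.
have -> : char_poly_mx (P^T *m diag_mx d *m P) =
    map_mx polyC P^T *m char_poly_mx (diag_mx d) *m map_mx polyC P.
  rewrite /char_poly_mx mulmxBr mulmxBl !map_mxM; congr (_ - _).
  by rewrite scalar_mxC -mulmxA -map_mxM (mulmx1C PP) map_mx1 mulmx1.
rewrite !det_mulmx mulrAC -det_mulmx -map_mxM (mulmx1C PP) map_mx1 det1 mul1r.
have := char_poly_trig (diag_mx_is_trig d); rewrite /char_poly => ->.
by apply: eq_bigr => i _; rewrite mxE eqxx mulr1n.
Qed.

Lemma mxtrace_expr_diagonalized j : \tr (M ^+ j) = \sum_i d 0 i ^+ j.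
Proof.
have -> : M ^+ j = P^T *m diag_mx (\row_i d 0 i ^+ j) *m P.
  elim: j => [|j IH].
    rewrite expr0 (_ : diag_mx _ = 1%:M) ?mulmx1 ?(mulmx1C PP) //.
    by apply/matrixP => a b; rewrite !mxE expr0.
  rewrite exprS IH {1}ME -!mulmxE !mulmxA -(mulmxA _ P) PP mulmx1; congr (_ *m _).
  rewrite -mulmxA; congr (_ *m _).
  by rewrite mul_diag_mx; apply/matrixP => a b; rewrite !mxE mulrnAr exprS.
rewrite mxtrace_mulC mulmxA PP mul1mx mxtrace_diag.
by apply: eq_bigr => i _; rewrite mxE.
Qed.

(** [eigvals] is a chosen list; unique factorisation of the characteristic polynomial identifies it
    with the diagonal up to order, so counts and power sums can be read off [d]. *)
Lemma eigvals_diagonalized :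
  size (eigvals M) = n /\ perm_eq (eigvals M) [seq d 0 i | i <- enum 'I_n].
Proof.
have cp : char_poly M = \prod_(l <- [seq d 0 i | i <- enum 'I_n]) ('X - l%:P).
  by rewrite char_poly_diagonalized big_map big_enum.
have [sz ce] : size (eigvals M) = n /\ char_poly M = \prod_(x <- eigvals M) ('X - x%:P).
  rewrite /eigvals; case: xgetP => [s _ //|/(_ [seq d 0 i | i <- enum 'I_n])] []; split=> //.
  by rewrite size_map size_enum_ord.
by split => //; apply: prod_XsubC_eq; rewrite -ce cp.
Qed.

Lemma count_eigvals_diagonalized (x : R) :
  count (fun l => l <= x) (eigvals M) = #|[set i | (d 0 i <= x)%R]%SET|.
Proof.
rewrite (permP eigvals_diagonalized.2) count_map cardE size_filter enumT.
by apply: eq_count => i; rewrite /= inE.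
Qed.

End Diagonalized.

Lemma size_eigvals n (M : 'M[R]_n) : M^T = M -> size (eigvals M) = n.
Proof.
by move/symmetric_diagonalization => [P [d [PP ME]]]; have [] := eigvals_diagonalized PP ME.
Qed.

Lemma mxtrace_expr_eigvals n (M : 'M[R]_n) j : M^T = M ->
  \tr (M ^+ j) = \sum_(l <- eigvals M) l ^+ j.
Proof.
move/symmetric_diagonalization => [P [d [PP ME]]].
have [_ pe] := eigvals_diagonalized PP ME.
by rewrite (mxtrace_expr_diagonalized PP ME) (perm_big _ pe) /= big_map big_enum.
Qed.

(** Schur test: |v_i v_j| is at most (v_i^2 + v_j^2)/2, and symmetry of [E] regroups the sum by
    rows; rows in [Z] drop out because [v] vanishes there. *)
Lemma qform_le_row_sum n (E : 'M[R]_n) (Z : {set 'I_n}) (v : 'rV[R]_n) (e : R) :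
  E^T = E -> (forall i, i \in Z -> v 0 i = 0) ->
  (forall i, i \notin Z -> \sum_j `|E i j| <= e) ->
  dotp (v *m E) v <= e * \sum_i v 0 i ^+ 2.
Proof.
move=> ET vZ Ee.
have symE i j : E i j = E j i by rewrite -{1}ET mxE.
have -> : dotp (v *m E) v = \sum_i \sum_j v 0 j * E i j * v 0 i.
  rewrite dotpE; apply: eq_bigr => i _; rewrite !mxE mulr_suml.
  by apply: eq_bigr => j _; rewrite symE.
apply: (@le_trans _ _ (\sum_i \sum_j `|E i j| * (v 0 i ^+ 2 / 2 + v 0 j ^+ 2 / 2))).
  apply: ler_sum => i _; apply: ler_sum => j _.
  rewrite mulrAC mulrC; apply: le_trans (ler_norm _) _; rewrite normrM ler_wpM2l //.
  rewrite normrM -!(real_normK (num_real (v 0 _))).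
  set a := `|v 0 i|; set b := `|v 0 j|; have := sqr_ge0 (a - b); rewrite !expr2; lra.
have -> : \sum_i \sum_j `|E i j| * (v 0 i ^+ 2 / 2 + v 0 j ^+ 2 / 2) =
    \sum_i (\sum_j `|E i j|) * v 0 i ^+ 2.
  under eq_bigr do under eq_bigr do rewrite mulrDr.
  under eq_bigr do rewrite big_split /=.
  rewrite big_split /= [X in _ + X]exchange_big /= -big_split /=.
  apply: eq_bigr => i _; rewrite -big_split /= mulr_suml; apply: eq_bigr => j _.
  by rewrite (symE j i); lra.
rewrite mulr_sumr; apply: ler_sum => i _.
have [/vZ ->|/Ee iZ] := boolP (i \in Z); first by rewrite expr0n /= !mulr0.
by rewrite ler_wpM2r ?sqr_ge0.
Qed.

(* Weyl's inequality and the rank inequality in one statement: [Z] collects the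
   rows in which [M] and [N] are unrelated. *)
Lemma eigvals_count_perturb n (M N : 'M[R]_n) (Z : {set 'I_n}) (x e : R) :
  M^T = M -> N^T = N ->
  (forall i, i \notin Z -> \sum_j `|N i j - M i j| <= e) ->
  (count (fun l => l <= x)%R (eigvals M) <=
   count (fun l => l <= x + e)%R (eigvals N) + #|Z|)%N.
Proof.
move=> MT NT H.
have [P [d [PP ME]]] := symmetric_diagonalization MT.
have [Q [c [QQ NE]]] := symmetric_diagonalization NT.
rewrite (count_eigvals_diagonalized PP ME) (count_eigvals_diagonalized QQ NE).
set SA := [set i | _]%SET; set SB := [set i | _]%SET.
rewrite leqNgt; apply/negP => lt.
pose csub (S : {set 'I_n}) (T : 'M[R]_n) : 'M[R]_(n, #|S|) :=
  \matrix_(i, k) T i (enum_val k).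
(* Fewer than [n] linear conditions on [v]: no component on eigenvectors of [M] above x, none on
   those of [N] at or below x + e, zero entries on [Z]. A nonzero solution has form at most x|v|^2
   for [M] and above (x + e)|v|^2 for [N], against the row-sum bound on [N - M]. *)
pose K := row_mx (csub (~: SA) P^T)%SET (row_mx (csub SB Q^T) (csub Z 1%:M)).
have [|v v0 vK] := @under_determined_solution _ _ K.
  have cn : (#|SA| + #|~: SA|%SET)%N = n by rewrite cardsC card_ord.
  by rewrite -[X in (_ < X)%N]cn addnC ltn_add2r.
move: vK; rewrite !mul_mx_row -row_mx0 => /eq_row_mx[vA].
rewrite -row_mx0 => /eq_row_mx[vB vZ].
have csub_eq0 (T : 'M[R]_n) (S : {set 'I_n}) : v *m csub S T = 0 ->
    forall i, i \in S -> (v *m T) 0 i = 0.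
  move=> vQ i iS; move/rowP: vQ => /(_ (enum_rank_in iS i)).
  rewrite [X in X = _]mxE [X in _ = X -> _]mxE => Q0; rewrite mxE -[RHS]Q0.
  by apply: eq_bigr => k _; rewrite [in RHS]mxE enum_rankK_in.
have {}vA i : d 0 i <= x \/ (v *m P^T) 0 i = 0.
  have [|ni] := boolP (i \in SA); first by rewrite inE; left.
  by right; apply: (csub_eq0 _ _ vA); rewrite inE.
have {}vB i : x + e < c 0 i \/ (v *m Q^T) 0 i = 0.
  have [iS|] := boolP (i \in SB); last by rewrite inE -ltNge; left.
  by right; apply: (csub_eq0 _ _ vB).
have {}vZ i : i \in Z -> v 0 i = 0.
  by move=> iZ; have := csub_eq0 _ _ vZ i iZ; rewrite mulmx1.
have qA : dotp (v *m M) v <= x * \sum_i v 0 i ^+ 2.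
  rewrite (qform_diagonalized ME) -(dotp_diagonalized PP) mulr_sumr.
  apply: ler_sum => i _.
  by case: (vA i) => [dx|->]; rewrite ?expr0n /= ?mulr0 // ler_wpM2r ?sqr_ge0.
have v2 : 0 < \sum_i v 0 i ^+ 2 by rewrite -dotp_sq dotp_gt0.
have qB : (x + e) * \sum_i v 0 i ^+ 2 < dotp (v *m N) v.
  rewrite (qform_diagonalized NE) -(dotp_diagonalized QQ) mulr_sumr.
  have [i bi] : exists i, (v *m Q^T) 0 i != 0.
    apply/existsP; apply: contraTT v2 => /existsPn b0.
    rewrite -(dotp_diagonalized QQ) big1 ?ltxx // => i _.
    by have := b0 i; rewrite negbK => /eqP ->; rewrite expr0n.
  rewrite (bigD1 i) //= [ltRHS](bigD1 i) //= ltr_leD //.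
    case: (vB i) => [dx|b0]; last by rewrite b0 eqxx in bi.
    by rewrite ltr_pM2r // lt_def sqr_ge0 sqrf_eq0 bi.
  apply: ler_sum => k _; case: (vB k) => [/ltW dx|->]; last by rewrite expr0n /= !mulr0.
  by rewrite ler_wpM2r ?sqr_ge0.
have NMT : (N - M)^T = N - M by rewrite linearB /= MT NT.
have : dotp (v *m (N - M)) v <= e * \sum_i v 0 i ^+ 2.
  apply: (qform_le_row_sum NMT vZ) => i /H.
  by under [X in _ -> X <= _]eq_bigr do rewrite !mxE.
rewrite mulmxBr dotpDl -scaleN1r dotpZl; move: qA qB v2.
set a := dotp _ v; set b := dotp _ v; set s := \sum_i _ => h1 h2 h3 h4.
by clear -h1 h2 h3 h4; lra.
Qed.

Lemma eigvals_zero n : all (pred1 (0 : R)) (eigvals (0 : 'M[R]_n)).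
Proof.
have := @mxtrace_expr_eigvals n 0 2 (trmx0 _ _ _).
rewrite expr2 mulr0 linear0 => /esym/eqP.
rewrite psumr_eq0; last by move=> i _; rewrite sqr_ge0.
by apply: sub_all => i; rewrite /= sqrf_eq0.
Qed.

(** The counting inequality is applied to [M] and the zero matrix with empty exceptional set: an
    eigenvalue outside [-e, e] would upset one of the two counts. *)
Lemma eigvals_bounded n (M : 'M[R]_n) (e l : R) : M^T = M ->
  (forall i, \sum_j `|M i j| <= e) -> l \in eigvals M -> `|l| <= e.
Proof.
move=> MT H lM; have e0 := eigvals_zero n.
have sz0 := @size_eigvals n 0 (trmx0 _ _ _).
rewrite ler_norml; apply/andP; split; rewrite leNgt; apply/negP => le.
  have := @eigvals_count_perturb n M 0 finset.set0 l e MT (trmx0 _ _ _).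
  rewrite cards0 addn0 [X in _ -> (_ <= X)%N](_ : _ = 0%N); last first.
    apply/eqP; rewrite -leqn0 leqNgt -has_count -all_predC.
    by apply: sub_all e0 => i /= /eqP ->; rewrite -ltNge; lra.
  have c0 : (0 < count (fun k => k <= l)%R (eigvals M))%N.
    by rewrite -has_count; apply/hasP; exists l.
  move=> c1; suff : (count (fun k => k <= l)%R (eigvals M) <= 0)%N by rewrite leqNgt c0.
  apply: c1 => i _.
  by under eq_bigr do rewrite mxE add0r normrN.
have := @eigvals_count_perturb n 0 M finset.set0 0 e (trmx0 _ _ _) MT.
rewrite cards0 addn0 add0r [X in _ -> (X <= _)%N](_ : _ = n); last first.
  by rewrite -[RHS]sz0; apply/eqP; rewrite -all_count; apply: sub_all e0 => i /= /eqP ->.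
have : ~~ (all (fun k => k <= e) (eigvals M)).
  by apply/allPn; exists l => //; rewrite -ltNge.
rewrite all_count eqn_leq count_size (size_eigvals MT) /= => /negP c0 c1; apply: c0.
by apply: c1 => i _; under eq_bigr do rewrite mxE oppr0 addr0.
Qed.

End SymmetricPerturbation.

(** * Moments and distribution functions *)

Section MomentsToCdf.
Variable R : realType.
Implicit Types (s t : seq R) (p : {poly R}).

Definition avg s (f : R -> R) : R := (size s)%:R^-1 * \sum_(l <- s) f l.

Definition scdf s (x : R) : R := avg s (fun l => (l <= x)%R%:R).

Lemma avg_le s f g : (forall l, l \in s -> f l <= g l) -> avg s f <= avg s g.
Proof.
move=> fg; rewrite ler_wpM2l ?invr_ge0 // big_seq [leRHS]big_seq.
by apply: ler_sum => l /fg.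
Qed.

Lemma avgD s f g : avg s (fun l => f l + g l) = avg s f + avg s g.
Proof. by rewrite /avg big_split mulrDr. Qed.

Lemma avgZ s a f : avg s (fun l => a * f l) = a * avg s f.
Proof. by rewrite /avg -mulr_sumr mulrCA. Qed.

Lemma avg_cst s c : (0 < size s)%N -> avg s (fun=> c) = c.
Proof.
move=> s0; rewrite /avg big_const_seq count_predT iter_addr_0.
by rewrite -[c *+ _]mulr_natl mulrA mulVf ?mul1r // pnatr_eq0 -lt0n.
Qed.

Lemma avg_horner s p :
  avg s (horner p) = \sum_(j < size p) p`_j * avg s (fun l => l ^+ j).
Proof.
rewrite /avg; under eq_bigr do rewrite horner_coef.
rewrite exchange_big /= mulr_sumr; apply: eq_bigr => j _.
by rewrite -mulr_sumr mulrCA.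
Qed.

Lemma scdf_le s : {homo scdf s : x y / x <= y}.
Proof.
move=> x y xy; apply: avg_le => l _; rewrite ler_nat.
by case: (leP l x) => // /le_trans -> //.
Qed.

Lemma scdf_ge0 s x : 0 <= scdf s x.
Proof. by rewrite /scdf /avg mulr_ge0 ?invr_ge0 // sumr_ge0. Qed.

Lemma scdf_le1 s x : scdf s x <= 1.
Proof.
case: s => [|a s]; first by rewrite /scdf /avg big_nil mulr0.
by rewrite -[leRHS](@avg_cst (a :: s)) //; apply: avg_le => l _; rewrite lern1 leq_b1.
Qed.

Lemma scdf_count s x : scdf s x = (size s)%:R^-1 * (count (fun l => l <= x) s)%:R.
Proof.
rewrite /scdf /avg -natr_sum -sum1_count [in RHS]big_mkcond; congr (_ * _%:R).
Qed.

Lemma scdf_eq1 s x : (0 < size s)%N -> (forall l, l \in s -> l <= x) -> scdf s x = 1.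
Proof.
move=> s0 sx; rewrite -(@avg_cst s 1) // /scdf /avg; congr (_ * _).
by rewrite big_seq [RHS]big_seq; apply: eq_bigr => l /sx ->.
Qed.

Lemma scdf_eq0 s x : (forall l, l \in s -> x < l) -> scdf s x = 0.
Proof.
move=> sx; rewrite /scdf /avg big_seq big1 ?mulr0 // => l /sx.
by rewrite ltNge => /negbTE ->.
Qed.

(* Newton-type iteration for the square root of [t ^+ 2]. *)
Fixpoint abs_poly (k : nat) : {poly R} :=
  if k is k'.+1 then abs_poly k' + 2^-1 *: ('X^2 - abs_poly k' ^+ 2) else 0.

(** The last clause is the error bound 2|t|/(2 + k|t|) multiplied out, so that the induction stays
    polynomial. It yields 2/k uniformly on [-1, 1], including near the kink at 0. *)
Lemma abs_poly_bound k (t : R) : `|t| <= 1 ->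
  [/\ 0 <= (abs_poly k).[t], (abs_poly k).[t] <= `|t| &
   (`|t| - (abs_poly k).[t]) * (1 + k%:R * (`|t| / 2)) <= `|t| ].
Proof.
move=> t1; have t0 := normr_ge0 t; elim: k => [|k [p0 pt pe]].
  by rewrite /= horner0 subr0 mul0r addr0 mulr1; split.
have -> : (abs_poly k.+1).[t] =
    (abs_poly k).[t] + (`|t| ^+ 2 - (abs_poly k).[t] ^+ 2) / 2.
  rewrite /= hornerD hornerZ hornerD hornerN hornerXn horner_exp.
  by rewrite real_normK ?num_real // mulrC.
move: p0 pt pe; set p := (abs_poly k).[t]; set a := `|t| in t0 t1 *; set b := k%:R : R.
have b0 : 0 <= b by rewrite ler0n.
have -> : k.+1%:R = b + 1 :> R by rewrite -addn1 natrD.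
move: b0 t0 t1; move: p a b => p a b b0 a0 a1 p0 pa pe.
have ap0 : 0 <= a - p by lra.
split; first by nra.
  by nra.
have -> : a - (p + (a ^+ 2 - p ^+ 2) / 2) = (a - p) * (1 - (a + p) / 2) by lra.
apply: le_trans pe; rewrite -mulrA ler_wpM2l //.
have : 0 <= b * a * a by rewrite !mulr_ge0.
have : 0 <= b * a * p by rewrite !mulr_ge0.
have : 0 <= a * p by rewrite mulr_ge0.
have : 0 <= a * a by rewrite mulr_ge0.
by lra.
Qed.

Lemma poly_approx_norm (L e : R) : 0 < L -> 0 < e ->
  exists p, forall t : R, `|t| <= L -> `| `|t| - p.[t] | <= e.
Proof.
move=> L0 e0; pose k := (Num.truncn (2 * L / e)).+1.
have ke : 2 * L / e < k%:R by rewrite truncnS_gt.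
exists (L *: (abs_poly k \Po (L^-1 *: 'X))) => t tL.
rewrite hornerZ horner_comp hornerZ hornerX; set u := L^-1 * t.
have uE : `|t| = L * `|u|.
  by rewrite /u normrM gtr0_norm ?invr_gt0 // mulVKf // gt_eqF.
have u1 : `|u| <= 1 by rewrite -(ler_pM2l L0) -uE mulr1.
have [p0 pu pe] := abs_poly_bound k u1; rewrite uE -mulrBr normrM gtr0_norm //.
have d0 : 0 <= `|u| - (abs_poly k).[u] by rewrite subr_ge0.
rewrite ger0_norm //; set a := `|u| in uE u1 p0 pu pe d0 *.
set q := (abs_poly k).[u] in p0 pu pe d0 *.
have [a0|a0] := leP a 0; first by nra.
have k0 : 0 < k%:R :> R by rewrite ltr0n.
have : (a - q) * k%:R <= 2.
  rewrite -(ler_pM2r a0); have : 0 <= a - q by []; lra.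
have ke' : 2 * L < e * k%:R by rewrite -ltr_pdivrMl // mulrC.
move=> h; rewrite -(ler_pM2r k0); nra.
Qed.

(* Piecewise linear interpolation of the indicator of [t <= x], written with
   absolute values so that approximating [`|t|] by polynomials suffices. *)
Definition ramp (x h t : R) : R := (`|t - (x + h)| - `|t - x| + h) / (2 * h).

Lemma ramp_bounds (x h t : R) : 0 < h -> (t <= x)%R%:R <= ramp x h t <= (t <= x + h)%R%:R.
Proof.
move=> h0; have h2 : 0 < 2 * h by lra.
rewrite /ramp ler_pdivlMr // ler_pdivrMr //.
case: (leP t x) => tx; case: (leP t (x + h)) => txh; rewrite ?mul1r ?mul0r;
 case: (ger0P (t - (x + h))) => ?; case: (ger0P (t - x)) => ?; apply/andP; split; lra.
Qed.

Lemma poly_approx_ramp (C h e x : R) : 0 < C -> 0 < h -> 0 < e -> `|x| <= C ->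
  exists p, forall t : R, `|t| <= C -> `| ramp x h t - p.[t] | <= e.
Proof.
move=> C0 h0 e0 xC.
(* Both t - x and t - (x + h) stay within 2C + h, and two errors e h divided by the 2h in [ramp]
   give e. *)
have [||p pE] := @poly_approx_norm (2 * C + h) (e * h); first by lra.
  by rewrite mulr_gt0.
exists ((2 * h)^-1 *: ((p \Po ('X - (x + h)%:P)) - (p \Po ('X - x%:P)) + h%:P)) => t tC.
rewrite !(hornerZ, hornerD, hornerN, horner_comp, hornerX, hornerC) /ramp mulrC.
rewrite -mulrBr normrM gtr0_norm ?invr_gt0; last by lra.
rewrite mulrC ler_pdivrMr; last by lra.
have := pE (t - (x + h)); have := pE (t - x).
move: xC tC; rewrite !ler_norml => /andP[? ?] /andP[? ?].
move=> /(_ _)/andP h1 /(_ _)/andP h2.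
have [|h1a h1b] := h1; first by apply/andP; split; lra.
have [|h2a h2b] := h2; first by apply/andP; split; lra.
by apply/andP; split; lra.
Qed.

Lemma moments_avg_close p s t (eta : R) :
  (forall j, (j < size p)%N ->
     `|avg s (fun l => l ^+ j) - avg t (fun l => l ^+ j)| <= eta) ->
  `|avg s (horner p) - avg t (horner p)| <= eta * \sum_(j < size p) `|p`_j|.
Proof.
move=> H; rewrite !avg_horner -sumrB mulr_sumr; apply: le_trans (ler_norm_sum _ _ _) _.
apply: ler_sum => j _; rewrite -mulrBr normrM mulrC.
by rewrite ler_wpM2r // H.
Qed.

(** The ramp between the indicators of t <= x and t <= x + h is replaced by a polynomial. The defect
    h splits in thirds: one approximation error for each list and one for the difference of
    moments. *)
Lemma moments_scdf_close_at (C h x : R) : 0 < C -> 0 < h -> `|x| <= C ->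
  exists J, exists2 eta, 0 < eta & forall s t, (0 < size s)%N -> (0 < size t)%N ->
    (forall l, l \in s -> `|l| <= C) -> (forall l, l \in t -> `|l| <= C) ->
    (forall j, (j < J)%N ->
       `|avg s (fun l => l ^+ j) - avg t (fun l => l ^+ j)| <= eta) ->
    scdf s x <= scdf t (x + h) + h.
Proof.
move=> C0 h0 xC; have h3 : 0 < h / 3 by lra.
have [p pE] := poly_approx_ramp C0 h0 h3 xC.
set S := \sum_(j < size p) `|p`_j|; have S0 : 0 <= S by rewrite sumr_ge0.
have e0 : 0 < h / 3 / (S + 1) by rewrite divr_gt0 //; lra.
exists (size p), (h / 3 / (S + 1)) => // s t s0 t0 sC tC /moments_avg_close.
rewrite -/S => st.
have st' : avg s (horner p) <= avg t (horner p) + h / 3.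
  move: st; rewrite ler_norml => /andP[_ st].
  have : h / 3 / (S + 1) * S <= h / 3.
    have q : (S + 1)^-1 * S <= 1 by rewrite mulrC ler_pdivrMr ?mul1r; lra.
    by rewrite -[leLHS]mulrA; apply: ler_piMr => //; exact: ltW.
  by move: st; set k := _ * S; lra.
have l1 : scdf s x <= avg s (horner p) + h / 3.
  rewrite -[X in _ + X](@avg_cst s) // -avgD; apply: avg_le => l /sC /pE.
  by rewrite ler_norml => /andP[_ ?]; have /andP[? _] := ramp_bounds x l h0; lra.
have l2 : avg t (horner p) <= scdf t (x + h) + h / 3.
  rewrite -[X in _ + X](@avg_cst t) // -avgD; apply: avg_le => l /tC /pE.
  by rewrite ler_norml => /andP[? _]; have /andP[_ ?] := ramp_bounds x l h0; lra.
by lra.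
Qed.

(** Uniformity in x comes from a finite grid of mesh h/2: rounding x up to a node costs h/2 and the
    comparison at the node another h/2. Outside [-C, C[ the inequality is trivial. *)
Lemma moments_scdf_close (C h : R) : 0 < C -> 0 < h ->
  exists J, exists2 eta, 0 < eta & forall s t, (0 < size s)%N -> (0 < size t)%N ->
    (forall l, l \in s -> `|l| <= C) -> (forall l, l \in t -> `|l| <= C) ->
    (forall j, (j < J)%N ->
       `|avg s (fun l => l ^+ j) - avg t (fun l => l ^+ j)| <= eta) ->
    forall x, scdf s x <= scdf t (x + h) + h.
Proof.
move=> C0 h0; pose k := h / 2; have k0 : 0 < k by rewrite /k; lra.
(* The node used for x has index trunc((x + C)/k) + 1, which must stay below [m] for every x < C;
   hence two successors. *)
pose m := (Num.truncn (2 * C / k)).+2.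
pose node (i : nat) := - C + i%:R * k.
have C'0 : 0 < C + m%:R * k by rewrite ltr_wpDr // mulr_ge0 // ltW.
have P (i : 'I_m) : exists Je : nat * R, 0 < Je.2 /\ forall s t, (0 < size s)%N -> (0 < size t)%N ->
    (forall l, l \in s -> `|l| <= C) -> (forall l, l \in t -> `|l| <= C) ->
    (forall j, (j < Je.1)%N ->
       `|avg s (fun l => l ^+ j) - avg t (fun l => l ^+ j)| <= Je.2) ->
    scdf s (node i) <= scdf t (node i + k) + k.
  have ik : i%:R * k <= m%:R * k by rewrite ler_wpM2r ?ltW // ltr_nat.
  have ik0 : 0 <= i%:R * k by rewrite mulr_ge0 // ltW.
  have [|J [eta eta0 H]] := @moments_scdf_close_at (C + m%:R * k) k (node i) C'0 k0.
    by rewrite /node ler_norml; apply/andP; split; lra.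
  exists (J, eta); split => // s t s0 t0 sC tC.
  apply: H => // l; [move=> /sC|move=> /tC]; move=> lC; lra.
have [Je JeP] := choice P.
pose J := (\max_(i < m) (Je i).1)%N.
pose eta := \big[Num.min/1]_(i < m) (Je i).2.
exists J, eta.
  by rewrite /eta; elim/big_ind: _ => // [a b ? ?|i _]; [rewrite lt_min; apply/andP|case: (JeP i)].
move=> s t s0 t0 sC tC H x.
have [xC|xC] := ltP x (- C).
  rewrite (@scdf_eq0 s) ?addr_ge0 ?scdf_ge0 ?ltW // => l /sC.
  by rewrite ler_norml => /andP[? _]; lra.
have [xC'|xC'] := leP C x.
  rewrite (@scdf_eq1 t) // => [|l /tC].
    by have := scdf_le1 s x; lra.
  by rewrite ler_norml => /andP[_ ?]; lra.
pose i := (Num.truncn ((x + C) / k)).+1.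
have q0 : 0 <= (x + C) / k by apply: divr_ge0; lra.
have im : (i < m)%N.
  rewrite /i /m !ltnS; apply: le_truncn; rewrite ler_pM2r ?invr_gt0 //; lra.
have xi : x <= node i.
  have : (x + C) / k < i%:R by rewrite truncnS_gt.
  by rewrite ltr_pdivrMr // /node => ?; lra.
have ix : node i <= x + k.
  have : (Num.truncn ((x + C) / k))%:R <= (x + C) / k by rewrite truncn_le.
  by rewrite ler_pdivlMr // /node /i -addn1 natrD mulrDl => ?; lra.
have [_ /(_ s t s0 t0 sC tC)] := JeP (Ordinal im).
have le1 := scdf_le s xi.
have le2 : scdf t (node i + k) <= scdf t (x + h) by apply: scdf_le; rewrite /k in ix *; lra.
move=> /(_ _) le3; apply: le_trans le1 _; apply: le_trans (le3 _) _ => [j jJ|/=].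
  apply: le_trans (H j _) _; last exact: bigmin_le_cond.
  by apply: leq_trans jJ _; apply: (leq_bigmax (Ordinal im)).
by apply: lerD => //; rewrite /k; lra.
Qed.

End MomentsToCdf.

(** * Completeness for the Levy distance *)

Section LevyLimit.
Variable R : realType.

Lemma scdf_locally_constant_right (s : seq R) (x : R) :
  exists2 d, 0 < d & forall y, x <= y < x + d -> scdf s y = scdf s x.
Proof.
suff [d d0 H] : exists2 d, 0 < d &
    forall y, x <= y < x + d -> {in s, forall l, (l <= y) = (l <= x)}.
  exists d => // y /H sy; rewrite /scdf /avg; congr (_ * _).
  by rewrite big_seq [RHS]big_seq; apply: eq_bigr => l /sy ->.
elim: s => [|l s [d d0 IH]]; first by exists 1.
have [lx|xl] := leP l x.
  exists d => // y /andP[xy yd] l'; rewrite inE => /predU1P[->|].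
    by rewrite lx (le_trans lx).
  by apply: IH; rewrite xy.
exists (Num.min d (l - x)); first by rewrite lt_min d0 subr_gt0.
move=> y /andP[xy]; rewrite -ltrBlDl lt_min => /andP[yd yl] l'.
rewrite inE => /predU1P[->|].
  by rewrite [RHS]leNgt xl leNgt; apply/negbTE; rewrite negbK; lra.
by apply: IH; rewrite xy -ltrBlDl.
Qed.

Definition harm (k : nat) : R := k.+1%:R^-1.

Lemma harm_gt0 k : 0 < harm k. Proof. by rewrite invr_gt0. Qed.

Lemma harm_small (e : R) : 0 < e -> exists k, harm k < e.
Proof.
move=> e0; exists (Num.truncn e^-1); rewrite /harm.
by rewrite invf_plt ?posrE // truncnS_gt.
Qed.

Lemma scdf_tails (s : seq R) : (0 < size s)%N ->
  exists C, forall x, (x < - C -> scdf s x = 0) /\ (C <= x -> scdf s x = 1).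
Proof.
move=> s0; exists (\sum_(l <- s) `|l|) => x.
have sC l : l \in s -> `|l| <= \sum_(l <- s) `|l|.
  by move=> ls; rewrite (big_rem _ ls) /= lerDl sumr_ge0.
split=> xC; [apply: scdf_eq0 => l|apply: scdf_eq1 => // l] => /sC;
  by rewrite ler_norml => /andP[? ?]; lra.
Qed.

Section Limit.
Variables (K : nat -> seq R -> Prop) (s_ : nat -> seq R).
Hypothesis Kclose : forall k s t, K k s -> K k t ->
  forall x, scdf s x <= scdf t (x + harm k) + harm k.
Hypothesis Ks : forall j k, (j <= k)%N -> K j (s_ k).
Hypothesis s_neq0 : forall k, (0 < size (s_ k))%N.

Let A x := [set scdf (s_ k) (x + harm k) + harm k | k in [set: nat]].

(* An infimum of nondecreasing right-continuous functions is right-continuous, so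
   no regularisation of the limit is needed. *)
Definition limit_cdf (x : R) : R := inf (A x).

Let hasA x : has_inf (A x).
Proof.
split; first by exists (scdf (s_ 0) (x + harm 0) + harm 0), 0%N.
by exists 0 => _ [k _ <-]; rewrite addr_ge0 ?scdf_ge0 // ltW // harm_gt0.
Qed.

Lemma limit_cdf_le k x : limit_cdf x <= scdf (s_ k) (x + harm k) + harm k.
Proof. by apply: ge_inf; [exact: (hasA x).2|exists k]. Qed.

Lemma limit_cdf_ge a x :
  (forall k, a <= scdf (s_ k) (x + harm k) + harm k) -> a <= limit_cdf x.
Proof. by move=> H; apply: lb_le_inf; [exact: (hasA x).1|move=> _ [k _ <-]]. Qed.

Lemma limit_cdf_nd : nondecreasing limit_cdf.
Proof.
move=> x y xy; apply: limit_cdf_ge => k; apply: le_trans (limit_cdf_le k x) _.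
by rewrite lerD2r; apply: scdf_le; rewrite lerD2r.
Qed.

Lemma limit_cdf_rc : right_continuous limit_cdf.
Proof.
move=> x; apply/cvgrPdist_lt => e e0.
have [_ [k _ <-]] := inf_adherent e0 (hasA x); rewrite -/(limit_cdf x) => ke.
have [d d0 H] := scdf_locally_constant_right (s_ k) (x + harm k).
near=> y; have xy : x < y by near: y; exact: nbhs_right_gt.
have yd : y < x + d by near: y; apply: nbhs_right_lt; lra.
have le1 := limit_cdf_nd (ltW xy).
have := limit_cdf_le k y; rewrite H; last by apply/andP; split; lra.
by rewrite ler0_norm ?opprB; lra.
Unshelve. all: by end_near. Qed.

(** The second bound uses only the k-th term of the infimum. For the first, every term j is compared
    with [s]: inside [K k] when k <= j, and otherwise by way of [s_ k], which shares the class [K j]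
    with [s_ j]. *)
Lemma limit_cdf_close k s : K k s -> forall x,
  scdf s x <= limit_cdf (x + harm k) + harm k /\
  limit_cdf x <= scdf s (x + 2 * harm k) + 2 * harm k.
Proof.
move=> Kks x; have hk := harm_gt0 k; split; last first.
  apply: le_trans (limit_cdf_le k x) _.
  have := Kclose (Ks (leqnn k)) Kks (x + harm k).
  by rewrite -addrA (_ : harm k + harm k = 2 * harm k); lra.
rewrite -lerBlDr; apply: limit_cdf_ge => j; have hj := harm_gt0 j.
have [kj|jk] := leqP k j.
  have := Kclose Kks (Ks kj) x.
  have : scdf (s_ j) (x + harm k) <= scdf (s_ j) (x + harm k + harm j).
    by apply: scdf_le; lra.
  by lra.
have := Kclose Kks (Ks (leqnn k)) x.
have := Kclose (Ks (ltnW jk)) (Ks (leqnn j)) (x + harm k).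
by lra.
Qed.

Lemma limit_cdf_ge0 x : 0 <= limit_cdf x.
Proof. by apply: limit_cdf_ge => k; rewrite addr_ge0 ?scdf_ge0 // ltW // harm_gt0. Qed.

Lemma limit_cdf_le1 x : limit_cdf x <= 1.
Proof.
apply/ler_addgt0Pr => e /harm_small[k ke]; apply: le_trans (limit_cdf_le k x) _.
by have := scdf_le1 (s_ k) (x + harm k); lra.
Qed.

Lemma limit_cdfNy : limit_cdf @ -oo --> (0 : R).
Proof.
apply/cvgrPdist_lt => e /harm_small[k ke].
have [C H] := scdf_tails (s_neq0 k).
near=> x; have := limit_cdf_le k x; have -> : scdf (s_ k) (x + harm k) = 0.
  apply: (H _).1; rewrite -ltrBrDr; near: x.
  by apply: nbhs_ninfty_lt; rewrite num_real.
by have := limit_cdf_ge0 x; rewrite sub0r normrN => ? ?; rewrite ger0_norm //; lra.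
Unshelve. all: by end_near. Qed.

Lemma limit_cdfy : limit_cdf @ +oo --> (1 : R).
Proof.
apply/cvgrPdist_lt => e /harm_small[k ke].
have [C H] := scdf_tails (s_neq0 k).
near=> x; have [+ _] := limit_cdf_close (Ks (leqnn k)) (x - harm k).
have -> : scdf (s_ k) (x - harm k) = 1.
  apply: (H _).2; rewrite lerBrDr; near: x.
  by apply: nbhs_pinfty_ge; rewrite num_real.
rewrite subrK => ?; have := limit_cdf_le1 x => ?.
by rewrite ger0_norm ?subr_ge0 //; lra.
Unshelve. all: by end_near. Qed.

HB.instance Definition _ := isCumulative.Build R _ R limit_cdf limit_cdf_nd limit_cdf_rc.
HB.instance Definition _ := isCumulativeBounded.Build R 0 1 limit_cdf limit_cdfNy limit_cdfy.

(* [R] carries two instances of the Borel structure; the identity transports the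
   Stieltjes measure to the one used by [probability R R]. *)
Let idTR : measurableTypeR R -> R := idfun.

#[local] HB.instance Definition _ :=
  @isMeasurableFun.Build _ _ _ _ idTR (@measurable_id _ _ setT).

Lemma levy_limit : exists nu : probability R R, forall k s, K k s -> forall x,
  scdf s (x - 2 * harm k) - 2 * harm k <= fine (nu `]-oo, x]%classic)
    <= scdf s (x + 2 * harm k) + 2 * harm k.
Proof.
exists (distribution (lebesgue_stieltjes_measure limit_cdf : probability _ _) idTR).
move=> k s Kks x.
set nu := (X in fine X).
have -> : nu = (limit_cdf x)%:E by exact: cdf_lebesgue_stieltjes_id limit_cdf x.
rewrite /fine.
have [_ ->] := limit_cdf_close Kks x; rewrite andbT.
have [+ _] := limit_cdf_close Kks (x - 2 * harm k).
have hk := harm_gt0 k.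
have : limit_cdf (x - 2 * harm k + harm k) <= limit_cdf x by apply: limit_cdf_nd; lra.
by lra.
Qed.

End Limit.
End LevyLimit.

(** * From the Levy distance to weak convergence *)

Section WeakConvergence.
Variable R : realType.
Implicit Types (f g : R -> R) (F : R -> R).

Lemma segment_unif_continuous f (a b e : R) : continuous f -> 0 < e ->
  exists2 d, 0 < d & forall t u, a <= t <= b -> `|u - t| < d -> `|f t - f u| <= e.
Proof.
move=> cf e0.
pose P (d t : R) := forall u, `|u - t| < d -> `|f t - f u| <= e.
have : \forall d \near 0^'+, `[a, b]%classic `<=` P d.
  apply: (compact_near_coveringP _).1; first exact: segment_compact.
  move=> x _; have e2 : 0 < e / 2 by lra.
  have /cvgrPdist_lt /(_ _ e2) /nbhs_ballP[r /= r0 fr] := cf x.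
  have r2 : 0 < r / 2 by lra.
  exists (ball x (r / 2), [set d | d < r / 2]).
    by split; [exact: nbhsx_ballx|exact: nbhs_right_lt].
  move=> [t d] /= [xt dr] u ud.
  have h1 := fr t; have h2 := fr u; rewrite /ball /= in xt h1 h2.
  have xu : `|x - u| < r.
    rewrite (_ : x - u = (x - t) - (u - t)); last by lra.
    by apply: le_lt_trans (ler_normB _ _) _; lra.
  have {}h1 := h1 (lt_trans xt _); have {}h2 := h2 xu.
  rewrite (_ : f t - f u = (f x - f u) - (f x - f t)); last by lra.
  by apply: le_trans (ler_normB _ _) _; have := h1 ltac:(lra); lra.
move=> H; near (0 : R)^'+ => d.
exists d; first by near: d; exact: nbhs_right_gt.
move=> t u tab; apply: (_ : `[a, b]%classic `<=` P d); last by rewrite /= in_itv.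
by near: d.
Unshelve. all: by end_near. Qed.

Definition bounded_measurable f :=
  measurable_fun [set: R] f /\ exists C, forall x, `|f x| <= C.

Definition half_line (x t : R) : R := (t <= x)%R%:R.

Lemma half_line_indic x : half_line x = \1_(`]-oo, x]%classic).
Proof. by apply/funext => t; rewrite indicE /half_line mem_setE in_itv. Qed.

Lemma bounded_measurable_half_line x : bounded_measurable (half_line x).
Proof.
split; first by rewrite half_line_indic; apply: measurable_indic; exact: measurable_itv.
by exists 1 => t; rewrite ger0_norm ?ler0n // lern1 leq_b1.
Qed.

Lemma bounded_measurable_cst c : bounded_measurable (fun=> c).
Proof. by split; [exact: measurable_cst|exists `|c|]. Qed.

Lemma bounded_measurableD f g : bounded_measurable f -> bounded_measurable g ->
  bounded_measurable (fun x => f x + g x).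
Proof.
move=> [mf [C fC]] [mg [D gD]]; split; first exact: measurable_funD.
by exists (C + D) => x; apply: le_trans (ler_normD _ _) _; exact: lerD.
Qed.

Lemma bounded_measurableZ a f : bounded_measurable f ->
  bounded_measurable (fun x => a * f x).
Proof.
move=> [mf [C fC]]; split; first exact: measurable_funM.
by exists (`|a| * C) => x; rewrite normrM ler_wpM2l.
Qed.

(** A common interface for empirical averages and integrals against a probability, so that the
    comparison with step functions is proved once for both. *)
Record mean_with_cdf (m : (R -> R) -> R) F := MeanWithCdf {
  mean_le : forall f g, bounded_measurable f -> bounded_measurable g ->
    (forall x, f x <= g x) -> m f <= m g;
  mean_add : forall f g, bounded_measurable f -> bounded_measurable g ->
    m (fun x => f x + g x) = m f + m g;
  mean_scale : forall a f, bounded_measurable f -> m (fun x => a * f x) = a * m f;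
  mean_cst : forall c, m (fun=> c) = c;
  mean_half_line : forall x, m (half_line x) = F x }.

Lemma avg_mean (s : seq R) : (0 < size s)%N -> mean_with_cdf (avg s) (scdf s).
Proof.
move=> s0; split=> //.
- by move=> f g _ _ fg; apply: avg_le.
- by move=> f g _ _; exact: avgD.
- by move=> a f _; exact: avgZ.
- by move=> c; exact: avg_cst.
Qed.

Lemma bounded_measurable_integrable (nu : probability R R) f :
  bounded_measurable f -> nu.-integrable setT (EFin \o f).
Proof.
move=> [mf [C fC]]; apply: measurable_bounded_integrable => //.
  by rewrite [X in (X < _)%E]probability_setT ltry.
exists C; split; first exact: num_real.
by move=> y Cy x _ /=; apply: le_trans (fC x) (ltW Cy).
Qed.

Lemma probability_mean (nu : probability R R) :
  mean_with_cdf (fun f => Rintegral nu setT f) (fun x => fine (nu `]-oo, x]%classic)).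
Proof.
split.
- move=> f g Bf Bg fg; apply: le_Rintegral => //; exact: bounded_measurable_integrable.
- by move=> f g Bf Bg; apply: RintegralD => //; exact: bounded_measurable_integrable.
- by move=> a f Bf; apply: RintegralZl => //; exact: bounded_measurable_integrable.
- by move=> c; rewrite Rintegral_cst // [X in fine X]probability_setT mulr1.
- by move=> x; rewrite half_line_indic /Rintegral integral_indic // setIT.
Qed.

Section Step.
Variables (f : R -> R) (x_ : nat -> R).

Definition step_fun (k : nat) (t : R) : R :=
  \sum_(i < k) f (x_ i.+1) * (half_line (x_ i.+1) t - half_line (x_ i) t).

Lemma bounded_measurable_step k : bounded_measurable (step_fun k).
Proof.
elim: k => [|k IH].
  by have := bounded_measurable_cst 0; congr bounded_measurable; apply/funext => t; rewrite /step_fun big_ord0.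
have -> : step_fun k.+1 = (fun t => step_fun k t + f (x_ k.+1) * (half_line (x_ k.+1) t + (-1) * half_line (x_ k) t)).
  by apply/funext => t; rewrite /step_fun big_ord_recr /= mulN1r.
apply: bounded_measurableD IH _; apply: bounded_measurableZ.
apply: bounded_measurableD; first exact: bounded_measurable_half_line.
by apply: bounded_measurableZ; exact: bounded_measurable_half_line.
Qed.

Lemma mean_step m F k : mean_with_cdf m F ->
  m (step_fun k) = \sum_(i < k) f (x_ i.+1) * (F (x_ i.+1) - F (x_ i)).
Proof.
move=> mF; have Bh := bounded_measurable_half_line.
elim: k => [|k IH].
  rewrite big_ord0 -[RHS](mean_cst mF); congr m; apply/funext => t.
  by rewrite /step_fun big_ord0.
have -> : step_fun k.+1 = (fun t => step_fun k t + f (x_ k.+1) * (half_line (x_ k.+1) t + (-1) * half_line (x_ k) t)).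
  by apply/funext => t; rewrite /step_fun big_ord_recr /= mulN1r.
have Bd : bounded_measurable (fun t => half_line (x_ k.+1) t + (-1) * half_line (x_ k) t).
  by apply: bounded_measurableD => //; exact: bounded_measurableZ.
rewrite (mean_add mF) ?(mean_scale mF) ?(mean_add mF) ?(mean_scale mF) //.
- by rewrite !(mean_half_line mF) IH big_ord_recr /= mulN1r.
- exact: bounded_measurableZ.
- exact: bounded_measurable_step.
- exact: bounded_measurableZ.
Qed.

Lemma step_fun_approx k (e : R) t : 0 <= e -> (forall i, x_ i <= x_ i.+1) ->
  (forall i, (i < k)%N -> x_ i < t <= x_ i.+1 -> `|f t - f (x_ i.+1)| <= e) ->
  [/\ t <= x_ 0%N -> step_fun k t = 0, x_ k < t -> step_fun k t = 0 &
   x_ 0%N < t <= x_ k -> `|f t - step_fun k t| <= e].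
Proof.
move=> e0 xi H.
have x0 i : x_ 0%N <= x_ i by elim: i => // i IH; apply: le_trans IH _.
elim: k H => [|k IH] H.
  rewrite /step_fun big_ord0; split=> // /andP[? ?]; lra.
have [|Z1 Z2 Z3] := IH; first by move=> i ik; apply: H; apply: ltnW.
rewrite /step_fun big_ord_recr -/(step_fun k t) /= /half_line; have xk := xi k.
split.
- move=> t0; rewrite Z1 //.
  by rewrite (le_trans t0 (x0 _)) (le_trans t0 (x0 _)) subrr mulr0 addr0.
- move=> tk; rewrite Z2; last by lra.
  by rewrite !leNgt tk (le_lt_trans xk tk) subrr mulr0 addr0.
- move=> /andP[t0 tk]; rewrite tk; have [tk'|tk'] := leP t (x_ k).
    by rewrite subrr mulr0 addr0; apply: Z3; rewrite t0.
  by rewrite Z2 // subr0 mulr1 add0r; apply: H => //; rewrite tk'.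
Qed.

(** On ]x_0, x_k] the step function is within e of [f]; elsewhere it vanishes and [f] costs at most
    C, on a set of mass F(x_0) + 1 - F(x_k). This majorant combines a constant and half-lines, so
    its mean is explicit. *)
Lemma mean_step_approx m F k (C e : R) : mean_with_cdf m F ->
  bounded_measurable f -> (forall t, `|f t| <= C) -> 0 <= e ->
  (forall i, x_ i <= x_ i.+1) ->
  (forall i t, (i < k)%N -> x_ i < t <= x_ i.+1 -> `|f t - f (x_ i.+1)| <= e) ->
  `|m f - \sum_(i < k) f (x_ i.+1) * (F (x_ i.+1) - F (x_ i))| <=
    e + C * (F (x_ 0%N) + 1 - F (x_ k)).
Proof.
move=> mF Bf fC e0 xi H.
have C0 : 0 <= C by apply: le_trans (fC 0).
pose r t := (e + C) + (C * half_line (x_ 0%N) t + (- C) * half_line (x_ k) t).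
have Bh := bounded_measurable_half_line.
have Bs := bounded_measurable_step k.
have Bc := bounded_measurable_cst.
have Bt : bounded_measurable (fun t => C * half_line (x_ 0%N) t + (- C) * half_line (x_ k) t).
  by apply: bounded_measurableD; exact: bounded_measurableZ.
have Br : bounded_measurable r by apply: bounded_measurableD.
have mr : m r = e + C * (F (x_ 0%N) + 1 - F (x_ k)).
  rewrite (mean_add mF) // (mean_cst mF) (mean_add mF) ?(mean_scale mF) ?(mean_half_line mF) //.
  - lra.
  - exact: bounded_measurableZ.
  - exact: bounded_measurableZ.
have x0 i : x_ 0%N <= x_ i by elim: i => // i IH; apply: le_trans IH _.
have key t : `|f t - step_fun k t| <= r t.
  have [Z1 Z2 Z3] := step_fun_approx e0 xi (H^~ t).
  have fCt := fC t; rewrite /r /half_line.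
  have [t0|t0] := leP t (x_ 0%N).
    by rewrite Z1 // (le_trans t0 (x0 k)) subr0 /= mulr1n; lra.
  rewrite /= mulr0n; have [tk|tk] := leP t (x_ k); rewrite /= ?mulr0n ?mulr1n.
    have : `|f t - step_fun k t| <= e by apply: Z3; rewrite t0.
    by lra.
  by rewrite Z2 // subr0; lra.
rewrite -(mean_step k mF) -mr ler_norml; apply/andP; split.
  rewrite lerBrDr -[X in X + _]mulN1r -(mean_scale mF) // -(mean_add mF) //; last exact: bounded_measurableZ.
  apply: (mean_le mF) => // [|t].
    by apply: bounded_measurableD => //; exact: bounded_measurableZ.
  by have := key t; rewrite ler_norml => /andP[? ?]; lra.
rewrite lerBlDr -(mean_add mF) //; apply: (mean_le mF) => // [|t].
  exact: bounded_measurableD.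
by have := key t; rewrite ler_norml => /andP[? ?]; lra.
Qed.

End Step.

(** Pigeonhole: N > 1/d cells share a total increase of at most 1, so one of them increases by at
    most d, and its midpoint with half its width will do. This is a quantitative form of the density
    of continuity points, needed because Levy closeness controls the distribution function only
    there. *)
Lemma small_jump F (u v d : R) : {homo F : x y / x <= y} ->
  (forall x, 0 <= F x <= 1) -> u < v -> 0 < d ->
  exists x, u <= x <= v /\ exists2 r, 0 < r & F (x + r) - F (x - r) <= d.
Proof.
move=> ndF F01 uv d0; pose N := (Num.truncn d^-1).+1.
have N0 : 0 < N%:R :> R by rewrite ltr0n.
have Nd : 1 < N%:R * d by rewrite -ltr_pdivrMr // div1r truncnS_gt.
pose y (j : nat) := u + j%:R * ((v - u) / N%:R).
have st0 : 0 < (v - u) / N%:R by rewrite divr_gt0 // subr_gt0.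
have [[j Hj]|H] := pselect (exists j : 'I_N, F (y j.+1) - F (y j) <= d).
  exists ((y j + y j.+1) / 2); have yj : y j.+1 = y j + (v - u) / N%:R.
    by rewrite /y -addn1 natrD; lra.
  have jN : j.+1%:R * ((v - u) / N%:R) <= v - u.
    rewrite mulrCA; apply: ler_piMr; first by lra.
    by rewrite ler_pdivrMr // mul1r ler_nat; exact: ltn_ord.
  have j0 : 0 <= j%:R * ((v - u) / N%:R) by rewrite mulr_ge0 // ltW.
  split.
    have : y j.+1 <= v by rewrite /y; lra.
    have : u <= y j by rewrite /y; lra.
    by rewrite yj => ? ?; apply/andP; split; lra.
  exists ((y j.+1 - y j) / 2); first by rewrite yj; lra.
  have -> : (y j + y j.+1) / 2 + (y j.+1 - y j) / 2 = y j.+1 by lra.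
  by have -> : (y j + y j.+1) / 2 - (y j.+1 - y j) / 2 = y j by lra.
have : \sum_(0 <= j < N) (F (y j.+1) - F (y j)) <= 1.
  rewrite (telescope_sumr (fun j => F (y j))) //.
  by have /andP[_ ?] := F01 (y N); have /andP[? _] := F01 (y 0%N); lra.
have : \sum_(0 <= j < N) d <= \sum_(0 <= j < N) (F (y j.+1) - F (y j)).
  rewrite !big_mkord; apply: ler_sum => j _; rewrite leNgt; apply/negP => Hj.
  by apply: H; exists j; exact: ltW.
by rewrite sumr_const_nat subn0 -[d *+ N]mulr_natl => ? ?; lra.
Qed.

Definition levy_close (s : seq R) (nu : probability R R) (h : R) := forall x,
  scdf s (x - h) - h <= fine (nu `]-oo, x]%classic) <= scdf s (x + h) + h.


Lemma fine_cdf_nd (nu : probability R R) :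
  {homo (fun x => fine (nu `]-oo, x]%classic)) : x y / x <= y}.
Proof.
move=> x y xy; apply: fine_le; rewrite ?fin_num_measure //.
by apply: le_measure; rewrite ?inE //; apply: subset_itvl; rewrite bnd_simp.
Qed.

Lemma fine_cdf01 (nu : probability R R) x : 0 <= fine (nu `]-oo, x]%classic) <= 1.
Proof.
rewrite fine_ge0 ?measure_ge0 //=.
by rewrite -lee_fin fineK ?fin_num_measure // probability_le1.
Qed.

Lemma levy_close_avg_cvg (s_ : nat -> seq R) (nu : probability R R) f :
  (forall h : R, 0 < h -> \forall n \near \oo, (0 < size (s_ n))%N /\ levy_close (s_ n) nu h) ->
  continuous f -> (exists C : R, forall x, `|f x| <= C) ->
  (avg (s_ n) f)%:E @[n --> \oo] --> (\int[nu]_x (f x)%:E)%E.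
Proof.
move=> sn cf [C0 fC0]; pose C := C0 + 1.
have fC x : `|f x| <= C by have := fC0 x; rewrite /C; lra.
have C_gt0 : 0 < C by have := fC0 0; have := normr_ge0 (f 0); rewrite /C; lra.
have Bf : bounded_measurable f.
  by split; [exact: continuous_measurable_fun|exists C].
pose F x := fine (nu `]-oo, x]%classic).
have ndF : {homo F : x y / x <= y} := @fine_cdf_nd nu.
have F01 : forall x, 0 <= F x <= 1 := @fine_cdf01 nu.
have -> : (\int[nu]_x (f x)%:E)%E = (Rintegral nu setT f)%:E.
  by rewrite /Rintegral fineK //; apply: integrable_fin_num => //; exact: bounded_measurable_integrable.
apply: cvg_EFin; first by near=> n.
apply/cvgrPdist_le => eps eps0.
(* The final errors are (1 + 6C)e for the average over [s_ n], (1 + 2C)e for the integral and 4Ce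
   between the two sums; together they stay below 20(C + 1)e. *)
pose e := eps / (20 * (C + 1)).
have e0 : 0 < e by rewrite divr_gt0 // mulr_gt0; lra.
have eE : eps = e * (20 * (C + 1)) by rewrite /e divfK // gt_eqF // mulr_gt0; lra.
have [N [N0 closeN]] : exists N, (0 < size (s_ N))%N /\ levy_close (s_ N) nu e.
  by have /filter_ex[N ?] := sn _ e0; exists N.
have [a Fa] : exists a, F a <= e.
  have [D H] := scdf_tails N0; exists (- D - e - 1).
  have /andP[_] := closeN (- D - e - 1); rewrite -/(F _) (H _).1; last by lra.
  by rewrite add0r.
have [b Fb] : exists b, 1 - e <= F b.
  have [D H] := scdf_tails N0; exists (D + e).
  by have /andP[+ _] := closeN (D + e); rewrite addrK (H _).2.
have [d d0 ucf] := segment_unif_continuous (a - 1) (Num.max a b + 4) cf e0.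
(* One node is picked in each cell of length [g], so consecutive nodes are at most 2g < d apart; g
   <= 1 and the start at a - 1 keep node 0 below a. *)
pose g := Num.min 1 (d / 3).
have g0 : 0 < g by rewrite /g lt_min; apply/andP; split; lra.
have g1 : g <= 1 by rewrite /g ge_min lexx.
have gd : 2 * g < d.
  have : g <= d / 3 by rewrite /g ge_min lexx orbT.
  by lra.
pose M := Num.max a b; pose k := (Num.truncn ((M - (a - 1)) / g)).+1.
have aM : a <= M by rewrite /M le_max lexx.
have bM : b <= M by rewrite /M le_max lexx orbT.
have k0 : 0 < k%:R :> R by rewrite ltr0n.
have kb : M <= a - 1 + k%:R * g.
  have : (M - (a - 1)) / g < k%:R by exact: truncnS_gt.
  by rewrite ltr_pdivrMr //; lra.
have kb' : a - 1 + k.+1%:R * g <= M + 2.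
  have : (Num.truncn ((M - (a - 1)) / g))%:R <= (M - (a - 1)) / g.
    by rewrite truncn_le divr_ge0 // ?(ltW g0) //; lra.
  by rewrite ler_pdivlMr // /k -addn2 natrD; lra.
(* The [k] terms of the sum each suffer an error proportional to [dl], so the total is of order
   e. *)
pose dl := e / k%:R; have dl0 : 0 < dl by rewrite divr_gt0.
have dlE : k%:R * dl = e by rewrite /dl mulrC divfK // gt_eqF.
have nodes i : exists xr : R * R,
    [/\ a - 1 + i%:R * g <= xr.1 <= a - 1 + i.+1%:R * g, 0 < xr.2 &
     F (xr.1 + xr.2) - F (xr.1 - xr.2) <= dl].
  have [|x [xi [r r0 H]]] := @small_jump F (a - 1 + i%:R * g) (a - 1 + i.+1%:R * g) dl ndF F01 _ dl0.
    by rewrite ltrD2l ltr_pM2r // ltr_nat.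
  by exists (x, r).
have {nodes}[xr nodes] := choice nodes; pose x_ i := (xr i).1; pose r_ i := (xr i).2.
have xlo i : a - 1 + i%:R * g <= x_ i by have [/andP[]] := nodes i.
have xhi i : x_ i <= a - 1 + i.+1%:R * g by have [/andP[]] := nodes i.
have xnd i : x_ i <= x_ i.+1 by apply: le_trans (xhi i) (xlo i.+1).
(* A Levy scale below every node radius and below [dl]: a shift by [r] and a jump of at most [dl]
   then give an error of at most 2 [dl] at each node. *)
pose r := \big[Num.min/dl]_(i < k.+1) r_ i.
have r0 : 0 < r.
  rewrite /r; elim/big_ind: _ => // [y z ? ?|i _]; first by rewrite lt_min; apply/andP.
  by have [] := nodes i.
have rdl : r <= dl by exact: bigmin_le_id.
have rr i : (i <= k)%N -> r <= r_ i.
  by rewrite -ltnS => ik; have -> : r_ i = r_ (Ordinal ik) by []; exact: bigmin_le_cond.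
have osc i t : (i < k)%N -> x_ i < t <= x_ i.+1 -> `|f t - f (x_ i.+1)| <= e.
  move=> ik /andP[it ti].
  have i0 : 0 <= i%:R * g by rewrite mulr_ge0 // ltW.
  have ik' : i.+2%:R * g <= k.+1%:R * g by rewrite ler_wpM2r ?(ltW g0) // ler_nat.
  have := xlo i; have := xhi i.+1; have := xlo i.+1 => h1 h2 h3.
  apply: ucf; first by apply/andP; split; [lra|rewrite -/M; lra].
  rewrite ger0_norm; last by lra.
  have : i.+2%:R * g = i%:R * g + 2 * g by rewrite -addn2 natrD; lra.
  by lra.
have dle : dl <= e.
  rewrite -dlE; apply: ler_peMl; first exact: ltW.
  by rewrite ler1n.
have Fx0 : F (x_ 0%N) <= e by apply: le_trans Fa; apply: ndF; have := xhi 0%N; lra.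
have Fxk : 1 - e <= F (x_ k).
  by apply: le_trans Fb _; apply: ndF; have := xlo k; lra.
near=> n.
have [n0 cn] : (0 < size (s_ n))%N /\ levy_close (s_ n) nu r by near: n; exact: sn.
have Fn i : (i <= k)%N -> `|scdf (s_ n) (x_ i) - F (x_ i)| <= 2 * dl.
  move=> /rr ri; have [_ ri0 jump] := nodes i; rewrite -/(x_ i) -/(r_ i) in ri0 jump.
  have /andP[+ _] := cn (x_ i + r); rewrite addrK -/(F _) => h1.
  have /andP[_] := cn (x_ i - r); rewrite subrK -/(F _) => h2.
  have : F (x_ i + r) <= F (x_ i + r_ i) by apply: ndF; lra.
  have : F (x_ i - r_ i) <= F (x_ i - r) by apply: ndF; lra.
  have : F (x_ i - r_ i) <= F (x_ i) by apply: ndF; lra.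
  have : F (x_ i) <= F (x_ i + r_ i) by apply: ndF; lra.
  by move=> *; rewrite ler_norml; apply/andP; split; lra.
have h1 := mean_step_approx (avg_mean n0) Bf fC (ltW e0) xnd osc.
have h2 := @mean_step_approx f x_ _ F k C e (probability_mean nu) Bf fC (ltW e0) xnd osc.
set G1 := \sum_(i < k) _ in h1; set G2 := \sum_(i < k) _ in h2.
have h3 : `|G1 - G2| <= 4 * C * e.
  rewrite /G1 /G2 -sumrB; apply: le_trans (ler_norm_sum _ _ _) _.
  rewrite -dlE (_ : 4 * C * _ = \sum_(i < k) C * (4 * dl)); last first.
    by rewrite sumr_const card_ord -mulr_natl; lra.
  apply: ler_sum => i _; rewrite -mulrBr normrM; apply: ler_pM => //.
  have := Fn i (ltnW (ltn_ord i)); have := Fn i.+1 (ltn_ord i).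
  rewrite -/(F _) -/(F _) !ler_norml => /andP[? ?] /andP[? ?].
  by apply/andP; split; lra.
have := Fn 0%N (leq0n k); have := Fn k (leqnn k); rewrite !ler_norml => /andP[? ?] /andP[? ?].
have h4 : C * (scdf (s_ n) (x_ 0%N) + 1 - scdf (s_ n) (x_ k)) <= C * (6 * e).
  by rewrite ler_pM2l //; lra.
have h5 : C * (F (x_ 0%N) + 1 - F (x_ k)) <= C * (2 * e).
  by rewrite ler_pM2l //; lra.
have Ce : 0 < C * e by rewrite mulr_gt0.
move: h1 h2 h3; rewrite eE !ler_norml => /andP[? ?] /andP[? ?] /andP[? ?] /=.
by apply/andP; split; lra.
Unshelve. all: by end_near. Qed.

End WeakConvergence.

(** * Concentration on finite product spaces *)

Section FiniteProduct.
Variable R : realType.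
Variables (V : finType) (pr : V -> R).
Hypothesis pr_ge0 : forall v, 0 <= pr v.
Hypothesis pr_sum : \sum_v pr v = 1.

Definition pweight (I : finType) (c : {ffun I -> V}) : R := \prod_i pr (c i).

Definition Ex (I : finType) (Phi : {ffun I -> V} -> R) : R :=
  \sum_c pweight c * Phi c.

Section Basic.
Variable I : finType.
Implicit Types (c : {ffun I -> V}) (Phi Psi : {ffun I -> V} -> R).

Lemma pweight_ge0 c : 0 <= pweight c.
Proof. by apply: prodr_ge0 => i _. Qed.

Lemma pweight_sum : \sum_c @pweight I c = 1.
Proof.
rewrite /pweight -(bigA_distr_bigA (fun (i : I) v => pr v)) /=.
by rewrite big1 // => i _; rewrite pr_sum.
Qed.

Lemma Ex_cst a : Ex (fun _ : {ffun I -> V} => a) = a.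
Proof. by rewrite /Ex -mulr_suml pweight_sum mul1r. Qed.

Lemma ExZ a Phi : Ex (fun c => a * Phi c) = a * Ex Phi.
Proof. by rewrite /Ex mulr_sumr; apply: eq_bigr => c _; rewrite mulrCA. Qed.

Lemma Ex_sum J (r : seq J) (Phi : J -> {ffun I -> V} -> R) :
  Ex (fun c => \sum_(j <- r) Phi j c) = \sum_(j <- r) Ex (Phi j).
Proof.
by rewrite /Ex [RHS]exchange_big /=; apply: eq_bigr => c _; rewrite mulr_sumr.
Qed.

Lemma Ex_le Phi Psi : (forall c, Phi c <= Psi c) -> Ex Phi <= Ex Psi.
Proof. by move=> h; apply: ler_sum => c _; rewrite ler_wpM2l // pweight_ge0. Qed.

Lemma eq_Ex Phi Psi : Phi =1 Psi -> Ex Phi = Ex Psi.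
Proof. by move=> h; apply: eq_bigr => c _; rewrite h. Qed.

Definition upd c i v : {ffun I -> V} := [ffun j => if j == i then v else c j].

(** Conditional expectation given the coordinates other than [i], kept as a function of the full
    configuration so that these operators compose. *)
Definition Av i Phi c : R := \sum_v pr v * Phi (upd c i v).

Lemma Ex_Av i Phi : Ex (Av i Phi) = Ex Phi.
Proof.
(* Exchanging [c i] with the fresh value is a weight-preserving involution. *)
pose h (cv : {ffun I -> V} * V) := (upd cv.1 i cv.2, cv.1 i).
have hK : involutive h.
  move=> [c v]; rewrite /h /=; congr pair; last by rewrite ffunE eqxx.
  by apply/ffunP => j; rewrite !ffunE; case: eqP => // ->.
have wE c v : pweight c * pr v = pweight (upd c i v) * pr (c i).
  rewrite /pweight (bigD1 i) //= [in RHS](bigD1 i) //= ffunE eqxx.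
  rewrite [in RHS](eq_bigr (fun j => pr (c j))) => [|j ji].
    by set a := \prod_(j | _) _; lra.
  by rewrite ffunE (negbTE ji).
rewrite /Ex /Av; under eq_bigr do rewrite mulr_sumr.
rewrite pair_bigA /= (reindex_inj (inv_inj hK)) /=.
under eq_bigr => cv _.
  rewrite mulrA -wE; have -> : upd (upd cv.1 i cv.2) i (cv.1 i) = cv.1.
    by have := congr1 fst (hK cv).
over.
rewrite -(pair_bigA _ (fun c v => pweight c * pr v * Phi c)) /=.
by apply: eq_bigr => c _; rewrite -mulr_suml -mulr_sumr pr_sum mulr1.
Qed.

Definition osc_le (i : I) (a : R) Phi :=
  forall c c', (forall j, j != i -> c j = c' j) -> `|Phi c - Phi c'| <= a.

Lemma Av_le i Phi Psi c : (forall c, Phi c <= Psi c) -> Av i Phi c <= Av i Psi c.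
Proof. by move=> h; apply: ler_sum => v _; rewrite ler_wpM2l. Qed.

Lemma AvZ i a Phi c : Av i (fun c => a * Phi c) c = a * Av i Phi c.
Proof. by rewrite /Av mulr_sumr; apply: eq_bigr => v _; rewrite mulrCA. Qed.

Lemma osc_Av i j a Phi : osc_le i a Phi -> osc_le i a (Av j Phi).
Proof.
move=> h c c' cc'; rewrite /Av -sumrB; apply: le_trans (ler_norm_sum _ _ _) _.
rewrite -[leRHS]mul1r -pr_sum mulr_suml; apply: ler_sum => v _.
rewrite -mulrBr normrM ger0_norm // ler_wpM2l //; apply: h => k ki.
by rewrite !ffunE cc'.
Qed.

(** Invert 1 - y <= exp(-y) and use (1 - y)(1 + y + 2y^2) = 1 + y^2(1 - 2y) >= 1. *)
Lemma expR_quad (y : R) : `|y| <= 2^-1 -> expR y <= 1 + y + 2 * y ^+ 2.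
Proof.
rewrite ler_norml => /andP[y1 y2].
have h1 : 1 - y <= expR (- y) := expR_ge1Dx (- y).
have y0 : 0 < 1 - y by lra.
rewrite -[expR y]invrK -expRN; apply: (@le_trans _ _ (1 - y)^-1).
  by rewrite lef_pV2 ?posrE ?expR_gt0.
rewrite -[leRHS]mulr1 -ler_pdivrMl; last by nra.
rewrite -invfM -[leRHS]invr1 lef_pV2 ?posrE //; last by nra.
have : 0 <= y ^+ 2 * (1 - 2 * y) by rewrite mulr_ge0 ?sqr_ge0 //; lra.
by lra.
Qed.

(** Hoeffding's lemma with a cruder constant: centring at the conditional mean kills the linear term
    of [expR_quad], and 1 + 2a^2 <= exp(2a^2) remains. *)
Lemma Av_exp i a Phi c : osc_le i a Phi -> a <= 2^-1 ->
  Av i (fun c => expR (Phi c)) c <= expR (Av i Phi c + 2 * a ^+ 2).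
Proof.
move=> h a2; set m := Av i Phi c.
have y_le v : `|Phi (upd c i v) - m| <= a.
  rewrite -[Phi _]mul1r -pr_sum mulr_suml /m /Av -sumrB.
  apply: le_trans (ler_norm_sum _ _ _) _.
  rewrite -[leRHS]mul1r -pr_sum mulr_suml; apply: ler_sum => u _.
  rewrite -mulrBr normrM ger0_norm // ler_wpM2l //; apply: h => j ji.
  by rewrite !ffunE (negbTE ji).
have [v0 _] : exists v0 : V, True.
  have [v _|v0] := pickP V; first by exists v.
  by have := pr_sum; rewrite big_pred0 // => /eqP; rewrite eq_sym oner_eq0.
have a0 : 0 <= a by apply: le_trans (y_le v0).
apply: (@le_trans _ _ (\sum_v pr v * (expR m * (1 + (Phi (upd c i v) - m) + 2 * a ^+ 2)))).
  apply: ler_sum => v _; rewrite ler_wpM2l // -[X in expR X <= _](subrK m) addrC expRD.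
  rewrite ler_pM2l ?expR_gt0 //; apply: le_trans (expR_quad _) _.
    exact: le_trans (y_le v) a2.
  rewrite lerD2l ler_pM2l ?ltr0n // -real_normK ?num_real // ler_pXn2r ?nnegrE //.
have -> : \sum_v pr v * (expR m * (1 + (Phi (upd c i v) - m) + 2 * a ^+ 2)) =
    expR m * (1 + 2 * a ^+ 2).
  transitivity (expR m * ((1 - m + 2 * a ^+ 2) * \sum_v pr v + \sum_v pr v * Phi (upd c i v))).
    rewrite mulr_sumr -big_split mulr_sumr; apply: eq_bigr => v _ /=; lra.
  by rewrite pr_sum -/(Av i Phi c) -/m; congr (_ * _); lra.
by rewrite expRD ler_pM2l ?expR_gt0 // expR_ge1Dx.
Qed.

Definition AvL (l : seq I) Phi : {ffun I -> V} -> R := foldr Av Phi l.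

Lemma Ex_AvL l Phi : Ex (AvL l Phi) = Ex Phi.
Proof. by elim: l => //= i l IH; rewrite Ex_Av. Qed.

Lemma AvL_indep l Phi c c' : (forall j, j \notin l -> c j = c' j) ->
  AvL l Phi c = AvL l Phi c'.
Proof.
elim: l c c' => [|i l IH] c c' cc' /=; first by congr Phi; apply/ffunP => j; exact: cc'.
apply: eq_bigr => v _; congr (_ * _); apply: IH => j jl; rewrite !ffunE.
by case: (eqVneq j i) => // ji; apply: cc'; rewrite inE negb_or ji.
Qed.

(** After all coordinates are averaged out the function is constant, hence equal to its own
    expectation, which averaging preserves. *)
Lemma AvL_all Phi c : AvL (enum I) Phi c = Ex Phi.
Proof.
rewrite -(Ex_AvL (enum I)) -[LHS]Ex_cst; apply: eq_Ex => c'.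
by apply: AvL_indep => j; rewrite mem_enum.
Qed.

Lemma AvL_exp (a : I -> R) Phi l c : (forall i, osc_le i (a i) Phi) ->
  (forall i, a i <= 2^-1) ->
  AvL l (fun c => expR (Phi c)) c <= expR (AvL l Phi c + 2 * \sum_(i <- l) a i ^+ 2).
Proof.
move=> h a2; elim: l c => [|i l IH] c /=; first by rewrite big_nil mulr0 addr0.
have hl : osc_le i (a i) (AvL l Phi).
  by elim: l {IH} => [|j l IH] /=; [exact: h|exact: osc_Av].
set K := 2 * \sum_(j <- l) a j ^+ 2 in IH.
apply: (@le_trans _ _ (Av i (fun c => expR K * expR (AvL l Phi c)) c)).
  by apply: Av_le => c'; rewrite -expRD addrC; exact: IH.
rewrite AvZ big_cons mulrDr -/K addrA expRD mulrC ler_pM2r ?expR_gt0 //.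
exact: Av_exp.
Qed.

(* McDiarmid's bound, by averaging out one coordinate at a time. *)
Lemma Ex_exp (a : I -> R) Phi : (forall i, osc_le i (a i) Phi) ->
  (forall i, a i <= 2^-1) ->
  Ex (fun c => expR (Phi c)) <= expR (Ex Phi + 2 * \sum_i a i ^+ 2).
Proof.
move=> h a2; rewrite -(Ex_AvL (enum I)) -[leRHS]Ex_cst; apply: Ex_le => c.
by have := AvL_exp (enum I) c h a2; rewrite (AvL_all Phi) big_enum.
Qed.

Definition Pr (A : pred {ffun I -> V}) : R := Ex (fun c => (A c)%:R).

Lemma Pr_markov_exp Phi (x : R) :
  Pr (fun c => x < Phi c) <= Ex (fun c => expR (Phi c)) * expR (- x).
Proof.
rewrite mulrC -ExZ; apply: Ex_le => c; rewrite -expRD.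
case: ltP => [xc|_]; last by rewrite expR_ge0.
by rewrite /= mulr1n; apply: le_trans (expR_ge1Dx _); lra.
Qed.

End Basic.

(** Summing the product weight over a fibre leaves one factor for each index in the image of [iota];
    the free coordinates each sum to 1. *)
Lemma marginal (S I : finType) (iota : S -> I) (Psi : {ffun S -> V} -> R) :
  injective iota -> Ex (fun c : {ffun I -> V} => Psi [ffun s => c (iota s)]) = Ex Psi.
Proof.
move=> inj; rewrite /Ex (partition_big (fun c : {ffun I -> V} => [ffun s => c (iota s)]) xpredT) //=.
apply: eq_bigr => s _.
under eq_bigr => c /eqP cs do rewrite cs.
rewrite -mulr_suml; congr (_ * _).
pose Q i v := [forall s', (iota s' == i) ==> (v == s s')].
transitivity (\sum_(c in family Q) pweight c).
  apply: eq_bigl => c; apply/eqP/familyP => [cs i|cQ].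
    by apply/forallP => s'; apply/implyP => /eqP <-; rewrite -cs ffunE.
  apply/ffunP => s'; rewrite ffunE; have /forallP /(_ s') := cQ (iota s').
  by rewrite eqxx /= => /eqP.
rewrite /pweight -(bigA_distr_big_dep (fun i => Q i) (fun i v => pr v)).
rewrite (bigID (mem [set iota s' | s' in S]%SET)) /= mulrC big1 => [|i ni]; last first.
  rewrite -[RHS]pr_sum; apply: eq_bigl => v; apply/forallP => s'.
  by apply/implyP => /eqP ei; case/negP: ni; apply/imsetP; exists s'.
rewrite mul1r big_imset /=; last by move=> ? ? _ _; exact: inj.
apply: eq_bigr => s' _; rewrite (big_pred1 (s s')) // => v.
apply/forallP/eqP => [/(_ s')|-> s'']; first by rewrite eqxx /= => /eqP.
by apply/implyP => /eqP/inj ->.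
Qed.

(** Transfers expectations between configuration spaces of different sizes: functionals that read
    only matched coordinates both reduce to one functional on [S], the other coordinates being
    filled with an arbitrary [v0]. *)
Lemma coupling (S I I' : finType) (iota : S -> I) (iota' : S -> I')
    (Phi : {ffun I -> V} -> R) (Phi' : {ffun I' -> V} -> R) :
  injective iota -> injective iota' ->
  (forall (c : {ffun I -> V}) (c' : {ffun I' -> V}), (forall s, c (iota s) = c' (iota' s)) -> Phi c = Phi' c') ->
  Ex Phi = Ex Phi'.
Proof.
move=> inj inj' H.
have [v0 _] : exists v0 : V, True.
  have [v _|v0] := pickP V; first by exists v.
  by have := pr_sum; rewrite big_pred0 // => /eqP; rewrite eq_sym oner_eq0.
pose ext' (b : {ffun S -> V}) : {ffun I' -> V} :=
  [ffun i => if [pick s | iota' s == i] is Some s then b s else v0].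
have extE b s : ext' b (iota' s) = b s.
  rewrite ffunE; case: pickP => [s' /eqP/inj' -> //|/(_ s)]; by rewrite eqxx.
pose Psi b := Phi' (ext' b).
have -> : Ex Phi = Ex Psi.
  rewrite -(marginal Psi inj); apply: eq_Ex => c.
  by apply: H => s; rewrite extE ffunE.
rewrite -(marginal Psi inj'); apply: eq_Ex => c'.
pose c0 : {ffun I -> V} :=
  [ffun i => if [pick s | iota s == i] is Some s then c' (iota' s) else v0].
have c0E s : c0 (iota s) = c' (iota' s).
  by rewrite ffunE; case: pickP => [s' /eqP/inj -> //|/(_ s)]; rewrite eqxx.
rewrite /Psi -(H c0 (ext' _)) => [|s]; last by rewrite extE ffunE c0E.
exact: H.
Qed.

End FiniteProduct.

Section Concentration.
Variables (R : realType) (V : finType) (pr : V -> R).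
Hypothesis pr_ge0 : forall v, 0 <= pr v.
Hypothesis pr_sum : \sum_v pr v = 1.

(** With at most Dn influential coordinates the quadratic cost in the exponential moment is linear
    in n, like the gain; hence a rate [q] independent of the index set and of n. The factor 2 counts
    the two tails. *)
Lemma bounded_influence_tail (L D eta : R) : 0 < L -> 0 < D -> 0 < eta ->
  exists2 q : R, 0 <= q < 1 & forall (I : finType) (S : {set I}) (n : nat)
    (Phi : {ffun I -> V} -> R),
    (forall i, osc_le i (if i \in S then L else 0) Phi) ->
    #|S|%:R <= D * n%:R ->
    Pr pr (fun c => eta * n%:R < `|Phi c - Ex pr Phi|) <= 2 * q ^+ n.
Proof.
move=> L0 D0 eta0.
(* The first term gives tL <= 1/2, as the quadratic exponential bound requires; the second makes the
   cost 2 t^2 L^2 D n at most half of the gain t eta n, and the other half is the rate. *)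
pose t := Num.min (2 * L)^-1 (eta / (4 * L ^+ 2 * D)).
have L2 : 0 < L ^+ 2 by rewrite exprn_gt0.
have t0 : 0 < t by rewrite lt_min invr_gt0 divr_gt0 ?mulr_gt0 // ltr0n.
have tL : t * L <= 2^-1.
  have h : t <= (2 * L)^-1 by rewrite ge_min lexx.
  by have := ler_wpM2r (ltW L0) h; rewrite invfM mulfVK // gt_eqF.
have tD : 2 * t * L ^+ 2 * D <= eta / 2.
  have : t <= eta / (4 * L ^+ 2 * D) by rewrite ge_min lexx orbT.
  by rewrite ler_pdivlMr ?mulr_gt0 ?ltr0n //; lra.
exists (expR (- (t * eta / 2))).
  by rewrite expR_ge0 expR_lt1 oppr_lt0 !mulr_gt0 // invr_gt0 ltr0n.
move=> I S n Phi osc Sn.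
have tail (Psi : {ffun I -> V} -> R) : (forall i, osc_le i (if i \in S then L else 0) Psi) ->
    Pr pr (fun c => eta * n%:R < Psi c - Ex pr Psi) <= expR (- (t * eta / 2)) ^+ n.
  move=> oscP.
  have h (i : I) : osc_le i (t * (if i \in S then L else 0)) (fun c => t * Psi c).
    move=> c c' cc'; rewrite -mulrBr normrM gtr0_norm // ler_pM2l //; exact: oscP.
  have a2 (i : I) : t * (if i \in S then L else 0) <= 2^-1.
    by case: ifP => _ //; rewrite mulr0 invr_ge0 ler0n.
  have := Ex_exp pr_ge0 pr_sum h a2; rewrite (ExZ pr) => h1.
  apply: (@le_trans _ _ (Pr pr (fun c => t * (eta * n%:R + Ex pr Psi) < t * Psi c))).
    apply: Ex_le => // c; rewrite ler_nat ltr_pM2l //.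
    by rewrite -ltrBrDr; case: (_ < _).
  apply: le_trans (Pr_markov_exp pr_ge0 _ _) _.
  apply: le_trans (ler_wpM2r (expR_ge0 _) h1) _.
  rewrite -expRM_natl -expRD ler_expR.
  have -> : \sum_i (t * (if i \in S then L else 0)) ^+ 2 = t ^+ 2 * L ^+ 2 * #|S|%:R.
    rewrite (bigID (mem S)) /= [X in _ + X]big1 => [|i /negbTE ->]; last by rewrite mulr0 expr0n.
    rewrite addr0 (eq_bigr (fun=> (t * L) ^+ 2)) => [|i ->] //.
    by rewrite sumr_const exprMn -[LHS]mulr_natr.
  have : t ^+ 2 * L ^+ 2 * #|S|%:R <= t ^+ 2 * L ^+ 2 * (D * n%:R).
    by rewrite ler_wpM2l // mulr_ge0 // ?sqr_ge0.
  have : t * n%:R * (2 * t * L ^+ 2 * D) <= t * n%:R * (eta / 2).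
    by rewrite ler_wpM2l // mulr_ge0 // ltW.
  set k := n%:R; set s := #|S|%:R; rewrite !expr2 => ? ?; lra.
have osc' i : osc_le i (if i \in S then L else 0) (fun c => - Phi c).
  by move=> c c' cc'; rewrite opprK addrC distrC; exact: osc.
have ExN : Ex pr (fun c => - Phi c) = - Ex pr Phi.
  rewrite -mulN1r -(ExZ pr); apply: eq_Ex => c; by rewrite mulN1r.
apply: le_trans (_ : _ <= Pr pr (fun c => eta * n%:R < Phi c - Ex pr Phi) +
   Pr pr (fun c => eta * n%:R < - Phi c - Ex pr (fun c => - Phi c))) _; last first.
  by have := tail _ osc; have := tail _ osc'; lra.
rewrite /Pr /Ex -big_split /=; apply: ler_sum => c _; rewrite -mulrDr ler_wpM2l ?pweight_ge0 //.
rewrite -natrD ler_nat -!/(Ex _ _) ExN.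
rewrite ltr_normr opprB opprK [- Phi c + _]addrC.
by case: (_ < Phi c - _); case: (_ < _ - Phi c).
Qed.

End Concentration.

(** * Truncated matrices *)

Section UpperPairs.
Variable n : nat.

Definition upairs := {p : 'I_n * 'I_n | (p.1 <= p.2)%N}.

Lemma mkup_proof (i j : 'I_n) :
  ((if (i <= j)%N then (i, j) else (j, i)).1 <= (if (i <= j)%N then (i, j) else (j, i)).2)%N.
Proof. by case: (leqP i j) => // /ltnW. Qed.

Definition mkup (i j : 'I_n) : upairs := 
  exist (fun p : 'I_n * 'I_n => (p.1 <= p.2)%N) _ (mkup_proof i j).

Lemma mkupC i j : mkup i j = mkup j i.
Proof.
apply: val_inj => /=; case: (ltngtP (i : nat) j) => // /val_inj ->.
by [].
Qed.

Lemma mkup_val (p : upairs) : mkup (val p).1 (val p).2 = p.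
Proof. by apply: val_inj; case: p => -[i j] /= ij; rewrite ij. Qed.

Lemma mkup_eq i j k l : mkup i j = mkup k l -> (i = k /\ j = l) \/ (i = l /\ j = k).
Proof.
move=> /(congr1 val) /=; case: leqP => _; case: leqP => _ [-> ->]; by [left|right].
Qed.

Lemma mkup_fiber (p : upairs) : (\sum_(i < n) \sum_(j < n) (mkup i j == p) <= 2)%N.
Proof.
rewrite pair_bigA /=; set a := (val p).1; set b := (val p).2.
apply: (@leq_trans (\sum_(q : 'I_n * 'I_n) ((q == (a, b)) + (q == (b, a)))%N)).
  apply: leq_sum => -[i j] _ /=; case: eqP => // ijp.
  move: ijp; rewrite -(mkup_val p) => /mkup_eq[[-> ->]|[-> ->]]; rewrite eqxx //.
  by rewrite addn1.
by rewrite big_split /= -!big_mkcond /= !big_pred1_eq.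
Qed.

End UpperPairs.

(** * Row sums and perturbation of traces *)

Section RowSum.
Variables (R : realType) (n : nat).
Implicit Types (X Y E : 'M[R]_n).

Definition row_sum_le X (b : R) := forall i, \sum_j `|X i j| <= b.

Lemma row_sum_le_mul X Y a b : 0 <= b -> row_sum_le X a -> row_sum_le Y b ->
  row_sum_le (X *m Y) (a * b).
Proof.
move=> b0 Xa Yb i; apply: (@le_trans _ _ (\sum_j \sum_k `|X i k| * `|Y k j|)).
  apply: ler_sum => j _; rewrite mxE; apply: le_trans (ler_norm_sum _ _ _) _.
  by apply: ler_sum => k _; rewrite normrM.
rewrite exchange_big /=; apply: (@le_trans _ _ (\sum_k `|X i k| * b)).
  by apply: ler_sum => k _; rewrite -mulr_sumr ler_wpM2l.
by rewrite -mulr_suml ler_wpM2r.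
Qed.

Lemma row_sum_le_exp X b j : 0 <= b -> row_sum_le X b -> row_sum_le (X ^+ j) (b ^+ j).
Proof.
move=> b0 Xb; elim: j => [|j IH].
  move=> i; rewrite !expr0 (bigD1 i) //= big1 => [|k ki]; rewrite mxE ?eqxx ?normr1 ?addr0 //.
  by rewrite eq_sym (negbTE ki) normr0.
by rewrite !exprSr -mulmxE; apply: row_sum_le_mul.
Qed.

Lemma row_sum_le_entry X b i j : row_sum_le X b -> `|X i j| <= b.
Proof.
by move=> Xb; apply: le_trans (Xb i); rewrite (bigD1 j) //= lerDl sumr_ge0.
Qed.

(** Telescoping of X^j - Y^j, where [Z] absorbs the factors [X] already split off. Only the total
    entrywise difference enters, so altering one weight moves the trace by a constant independent of
    n. *)
Lemma mxtrace_expr_diff X Y Z (b z e : R) j : 0 <= b -> 0 <= z ->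
  row_sum_le X b -> row_sum_le Y b -> row_sum_le Z z ->
  \sum_i \sum_k `|X i k - Y i k| <= e ->
  `|\tr (Z *m X ^+ j) - \tr (Z *m Y ^+ j)| <= j%:R * b ^+ j.-1 * e * z.
Proof.
move=> b0 z0 Xb Yb + XYe.
have e0 : 0 <= e by apply: le_trans XYe; apply: sumr_ge0 => i _; apply: sumr_ge0.
elim: j Z z z0 => [|j IH] Z z z0 Zz; first by rewrite !expr0 subrr normr0 !mul0r.
rewrite !exprS -!mulmxE.
have -> : \tr (Z *m (X *m X ^+ j)) - \tr (Z *m (Y *m Y ^+ j)) =
   (\tr ((Z *m X) *m X ^+ j) - \tr ((Z *m X) *m Y ^+ j)) + \tr ((X - Y) *m (Y ^+ j *m Z)).
  rewrite [(X - Y) *m _]mulmxA [\tr ((X - Y) *m _ *m _)]mxtrace_mulC.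
  rewrite [Z *m ((X - Y) *m _)]mulmxA mulmxBr mulmxBl linearB /= !mulmxA.
  by rewrite addrA subrK.
have ZXb : row_sum_le (Z *m X) (z * b) by apply: row_sum_le_mul.
have h1 := IH _ _ (mulr_ge0 z0 b0) ZXb.
have YZ : row_sum_le (Y ^+ j *m Z) (b ^+ j * z).
  by apply: row_sum_le_mul => //; exact: row_sum_le_exp.
have h2 : `|\tr ((X - Y) *m (Y ^+ j *m Z))| <= e * (b ^+ j * z).
  apply: (@le_trans _ _ (\sum_i \sum_k `|X i k - Y i k| * (b ^+ j * z))).
    apply: le_trans (ler_norm_sum _ _ _) _; apply: ler_sum => i _; rewrite mxE.
    apply: le_trans (ler_norm_sum _ _ _) _; apply: ler_sum => k _.
    have -> : (X - Y) i k = X i k - Y i k by rewrite !mxE.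
    by rewrite normrM ler_wpM2l //; exact: row_sum_le_entry.
  under eq_bigr do rewrite -mulr_suml.
  by rewrite -mulr_suml ler_wpM2r // mulr_ge0 // exprn_ge0.
apply: le_trans (ler_normD _ _) _; apply: le_trans (lerD h1 h2) _.
have -> : j%:R * b ^+ j.-1 * e * (z * b) = j%:R * b ^+ j * e * z.
  case: j {IH h1 h2 YZ} => [|j]; first by rewrite !mul0r.
  by rewrite exprSr /=; set B := b ^+ j; lra.
by rewrite -addn1 natrD /= addn1 /=; set B := b ^+ j; lra.
Qed.

End RowSum.

Section TruncatedMatrix.
Variables (R : realType) (V : finType) (vl : V -> R) (K : R) (D : nat) (alpha : bool).
Hypothesis vlK : forall v, `|vl v| <= K.

Definition deg n (g : rel 'I_n) (i : 'I_n) : nat := #|[set j | g i j]%SET|.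

Definition trunc_graph n (g : rel 'I_n) : rel 'I_n :=
  fun i j => [&& g i j, (deg g i <= D)%N & (deg g j <= D)%N].

Definition trunc_mx n (g : rel 'I_n) (c : {ffun upairs n -> V}) : 'M[R]_n :=
  \matrix_(i, j) (vl (c (mkup i j)) * (trunc_graph g i j)%:R
    - (i == j)%:R * alpha%:R * \sum_(k < n) vl (c (mkup i k)) * (trunc_graph g i k)%:R).

Lemma K_ge0 (v : V) : 0 <= K. Proof. by apply: le_trans (vlK v). Qed.

Section OneGraph.
Variables (n : nat) (g : rel 'I_n).
Hypothesis gs : simple_graph g.

Lemma trunc_graph_sym i j : trunc_graph g i j = trunc_graph g j i.
Proof. by rewrite /trunc_graph gs.1 [(deg g j <= D)%N && _]andbC. Qed.

Lemma trunc_graph_row i : (\sum_(j < n) trunc_graph g i j <= D)%N.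
Proof.
have [iD|iD] := leqP (deg g i) D; last first.
  by rewrite big1 // => j _; rewrite /trunc_graph [(deg g i <= D)%N]leqNgt iD andbF.
apply: leq_trans iD; rewrite /deg -sum1_card [leqRHS]big_mkcond /=; apply: leq_sum => j _.
by rewrite inE /trunc_graph; case: (g i j) => //=; rewrite leq_b1.
Qed.

Lemma trunc_mx_sym c : (trunc_mx g c)^T = trunc_mx g c.
Proof.
apply/matrixP => i j; rewrite !mxE mkupC trunc_graph_sym [j == i]eq_sym.
by case: eqP => [->|] //; rewrite !mul0r.
Qed.

Lemma sum_trunc_le i (a : 'I_n -> R) (b : R) : (forall k, trunc_graph g i k -> a k <= b) -> 0 <= b ->
  \sum_(k < n) a k * (trunc_graph g i k)%:R <= D%:R * b.
Proof.
move=> ab b0; apply: (@le_trans _ _ (\sum_(k < n) b * (trunc_graph g i k)%:R)).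
  by apply: ler_sum => k _; case: (boolP (trunc_graph g i k)) => [/ab|]; rewrite ?mulr1 ?mulr0.
by rewrite -mulr_sumr -natr_sum mulrC ler_wpM2r // ler_nat trunc_graph_row.
Qed.

Lemma sum_diag_le (E : 'M[R]_n) (x : 'I_n -> 'I_n -> R) (i : 'I_n) :
  (forall j, E i j = x i j - (i == j)%:R * alpha%:R * \sum_k x i k) ->
  \sum_j `|E i j| <= 2 * \sum_j `|x i j|.
Proof.
move=> EE; apply: (@le_trans _ _ (\sum_j (`|x i j| + (i == j)%:R * \sum_k `|x i k|))).
  apply: ler_sum => j _; rewrite EE; apply: le_trans (ler_normB _ _) _; rewrite lerD2l.
  rewrite !normrM !normr_nat ler_pM // ?mulr_ge0 //; last exact: ler_norm_sum.
  by rewrite ler_piMr // lern1 leq_b1.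
rewrite big_split /= -mulr_suml [X in _ + X * _ <= _](bigD1 i) //= eqxx.
rewrite [X in _ + (_ + X) * _ <= _]big1 => [|j ji]; last by rewrite eq_sym (negbTE ji).
by rewrite addr0 mul1r; lra.
Qed.

Lemma trunc_mx_row_sum c : row_sum_le (trunc_mx g c) (2 * (D%:R * K)).
Proof.
move=> i; have K0 : 0 <= K by apply: (K_ge0 (c (mkup i i))).
apply: le_trans (sum_diag_le (x := fun i j => vl (c (mkup i j)) * (trunc_graph g i j)%:R) _) _.
  by move=> j; rewrite mxE.
rewrite ler_pM2l ?ltr0n //; under eq_bigr do rewrite normrM normr_nat.
by apply: sum_trunc_le.
Qed.

(** The constant 8K: the weight moves by at most 2K, occupies at most two entries, and the diagonal
    correction at most doubles the row sums. *)
Lemma trunc_mx_influence (c c' : {ffun upairs n -> V}) (p : upairs n) : (forall q, q != p -> c q = c' q) ->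
  \sum_i \sum_k `|trunc_mx g c i k - trunc_mx g c' i k| <=
  if trunc_graph g (val p).1 (val p).2 then 8 * K else 0.
Proof.
move=> cc'.
pose x i j := (vl (c (mkup i j)) - vl (c' (mkup i j))) * (trunc_graph g i j)%:R.
have E1 i : \sum_k `|trunc_mx g c i k - trunc_mx g c' i k| <= 2 * \sum_k `|x i k|.
  have dE j : (trunc_mx g c - trunc_mx g c') i j = trunc_mx g c i j - trunc_mx g c' i j.
    by rewrite [LHS]mxE [X in _ + X]mxE.
  rewrite (eq_bigr (fun j => `|(trunc_mx g c - trunc_mx g c') i j|)) => [|j _]; last by rewrite dE.
  apply: sum_diag_le => j; rewrite dE !mxE /x; under [in RHS]eq_bigr do rewrite mulrBl.
  by rewrite sumrB mulrBr mulrBl; lra.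
have xp i j : `|x i j| <= (if trunc_graph g (val p).1 (val p).2 then 2 * K else 0) * (mkup i j == p)%:R.
  rewrite /x; case: (eqVneq (mkup i j) p) => [ijp|/cc' ->]; last by rewrite subrr mul0r normr0 mulr0.
  have -> : trunc_graph g i j = trunc_graph g (val p).1 (val p).2.
    move: ijp; rewrite -(mkup_val p) => /mkup_eq[[-> ->]|[-> ->]] //; rewrite mkup_val //.
    by rewrite trunc_graph_sym.
  rewrite mulr1; case: ifP => _; rewrite ?mulr0 ?normr0 // mulr1.
  by apply: le_trans (ler_normB _ _) _; have := vlK (c (mkup i j)); have := vlK (c' (mkup i j)); lra.
apply: (@le_trans _ _ (2 * ((if trunc_graph g (val p).1 (val p).2 then 2 * K else 0) *
   (\sum_(i < n) \sum_(j < n) (mkup i j == p))%:R))).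
  apply: (@le_trans _ _ (2 * \sum_i \sum_k `|x i k|)).
    by rewrite mulr_sumr; apply: ler_sum => i _.
  rewrite ler_pM2l ?ltr0n // natr_sum mulr_sumr; apply: ler_sum => i _.
  by rewrite natr_sum mulr_sumr; apply: ler_sum => j _.
have K0 : 0 <= K := K_ge0 (c p).
have f2 : (\sum_(i < n) \sum_(j < n) (mkup i j == p))%:R <= 2 :> R by rewrite ler_nat mkup_fiber.
case: ifP => _; last by rewrite mul0r mulr0.
have : 2 * K * (\sum_(i < n) \sum_(j < n) (mkup i j == p))%:R <= 2 * K * 2.
  by rewrite ler_wpM2l // mulr_ge0.
by lra.
Qed.

Definition kept_pairs : {set upairs n} :=
  [set p | trunc_graph g (val p).1 (val p).2]%SET.

(** Linear rather than quadratic in n: this supplies the sparsity hypothesis of the tail bound. *)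
Lemma card_kept_pairs : (#|kept_pairs| <= D * n)%N.
Proof.
rewrite -sum1_card big_mkcond /=.
apply: (@leq_trans (\sum_(q : 'I_n * 'I_n) trunc_graph g q.1 q.2)%N).
  pose h (q : 'I_n * 'I_n) := (trunc_graph g q.1 q.2 : nat).
  have -> : (\sum_(p : upairs n) (if p \in kept_pairs then 1 else 0) =
     \sum_(p : upairs n) h (val p))%N.
    by apply: eq_bigr => p _; rewrite inE /h; case: trunc_graph.
  have -> : (\sum_(p : upairs n) h (val p) = \sum_(q in [set val p | p : upairs n]%SET) h q)%N.
    by rewrite big_imset //= => ? ? _ _; exact: val_inj.
  by rewrite big_mkcond /=; apply: leq_sum => q _; case: ifP.
rewrite -(pair_bigA _ (fun i j => (trunc_graph g i j : nat))) /=.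
apply: (@leq_trans (\sum_(i < n) D)%N); first by apply: leq_sum => i _; exact: trunc_graph_row.
by rewrite sum_nat_const card_ord mulnC.
Qed.

Lemma trace_influence j (p : upairs n) :
  osc_le p (if p \in kept_pairs then j%:R * (2 * (D%:R * K)) ^+ j.-1 * (8 * K) else 0)
    (fun c => \tr (trunc_mx g c ^+ j)).
Proof.
move=> c c' cc'; have K0 : 0 <= K := K_ge0 (c p).
have B0 : 0 <= 2 * (D%:R * K) by rewrite !mulr_ge0.
have h1 : row_sum_le (1%:M : 'M[R]_n) 1.
  by have := @row_sum_le_exp R n 0 0 0; rewrite !expr0; apply => // i; rewrite big1 // => k _; rewrite mxE normr0.
have := mxtrace_expr_diff j B0 ler01 (trunc_mx_row_sum c) (trunc_mx_row_sum c') h1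
  (trunc_mx_influence cc').
by rewrite !mul1mx mulr1 inE; case: ifP => _ //; rewrite mulr0.
Qed.

Variable big : pred V.

(** Dominates the number of vertices that meet a discarded weight along a kept edge. Unlike that
    number it is a plain sum, with expectation and influences as easy as those of a trace. *)
Definition big_count (c : {ffun upairs n -> V}) : R :=
  \sum_(i < n) \sum_(j < n) (trunc_graph g i j)%:R * (big (c (mkup i j)))%:R.

Lemma big_count_influence (p : upairs n) :
  osc_le p (if p \in kept_pairs then 2 else 0) big_count.
Proof.
move=> c c' cc'; rewrite /big_count -sumrB; apply: le_trans (ler_norm_sum _ _ _) _.
apply: (@le_trans _ _ ((if p \in kept_pairs then 1 else 0) * (\sum_(i < n) \sum_(j < n) (mkup i j == p))%:R)).
  rewrite natr_sum mulr_sumr; apply: ler_sum => i _; rewrite -sumrB.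
  apply: le_trans (ler_norm_sum _ _ _) _; rewrite natr_sum mulr_sumr; apply: ler_sum => j _.
  case: (eqVneq (mkup i j) p) => [ijp|/cc' ->]; last by rewrite subrr normr0 mulr0.
  have -> : p \in kept_pairs = trunc_graph g i j.
    rewrite inE; move: ijp; rewrite -(mkup_val p) => /mkup_eq[[-> ->]|[-> ->]]; rewrite mkup_val //.
    by rewrite trunc_graph_sym.
  rewrite -mulrBr normrM normr_nat mulr1; case: trunc_graph; rewrite ?mul0r // mul1r.
  by rewrite ler_norml; do 2 case: big => /=; rewrite ?mulr1n ?mulr0n; apply/andP; split; lra.
case: ifP => _; last by rewrite mul0r.
by rewrite mul1r ler_nat mkup_fiber.
Qed.

Lemma Ex_big_count (pr : V -> R) : (forall v, 0 <= pr v) -> \sum_v pr v = 1 ->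
  Ex pr big_count <= n%:R * (D%:R * \sum_(v | big v) pr v).
Proof.
move=> pr0 pr1; rewrite /big_count (Ex_sum pr).
set b := \sum_(v | big v) pr v; have b0 : 0 <= b by exact: sumr_ge0.
have Eb (p : upairs n) : Ex pr (fun c => (big (c p))%:R) = b.
  rewrite -(Ex_Av pr1 p) -[RHS](Ex_cst pr1 (upairs n)); apply: eq_Ex => c.
  rewrite /Av /b [RHS]big_mkcond; apply: eq_bigr => v _; rewrite ffunE eqxx.
  by case: big; rewrite ?mulr1 ?mulr0.
have -> : n%:R * (D%:R * b) = \sum_(i < n) D%:R * b.
  by rewrite sumr_const card_ord -[RHS]mulr_natl.
apply: ler_sum => i _; rewrite (Ex_sum pr).
rewrite (eq_bigr (fun j => b * (trunc_graph g i j)%:R)) => [|j _]; last first.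
  by rewrite (ExZ pr) Eb mulrC.
exact: sum_trunc_le.
Qed.

End OneGraph.
End TruncatedMatrix.

(** * Locality of the expected moments *)

Section BallIso.

Lemma ball_iso_refl G r : ball_iso G G r.
Proof. by exists id, id; split. Qed.

Lemma ball_iso_sym G H r : ball_iso G H r -> ball_iso H G r.
Proof.
move=> [f [g [f0 fB gB adj]]]; exists g, f; split=> //.
  have r0 : inball G r 0%N by elim: r {f0 fB gB adj} => //= r IH; left.
  by rewrite -{1}f0; have [_ ->] := fB _ r0.
move=> u v /gB[Bu fu] /gB[Bv fv]; by rewrite adj // fu fv.
Qed.

Lemma ball_iso_trans G H L r : ball_iso G H r -> ball_iso H L r -> ball_iso G L r.
Proof.
move=> [f [g [f0 fB gB adj]]] [f' [g' [f0' fB' gB' adj']]].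
exists (f' \o f), (g \o g'); split.
- by rewrite /= f0.
- move=> v /fB[Bf gf]; have [Bf' gf'] := fB' _ Bf; split=> //=; by rewrite gf'.
- move=> v /gB'[Bg fg]; have [Bg' fg'] := gB _ Bg; split=> //=; by rewrite fg'.
- move=> u v Bu Bv; rewrite adj // adj' //; by [case: (fB _ Bu)|case: (fB _ Bv)].
Qed.

Lemma inball_le G r s v : (r <= s)%N -> inball G r v -> inball G s v.
Proof.
move=> /subnK <-; elim: (s - r)%N => //= k IH Gv; left; exact: IH.
Qed.

Lemma ball_iso_inball G H f r s v : f 0%N = 0%N ->
  (forall u v, inball G r u -> inball G r v -> radj G u v = radj H (f u) (f v)) ->
  (s <= r)%N -> inball G s v -> inball H s (f v).
Proof.
move=> f0 adj; elim: s v => [|s IH] v sr /=; first by move=> ->.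
case=> [Gv|[u [Gu uv]]]; first by left; apply: IH => //; exact: ltnW.
right; exists (f u); split; first by apply: IH => //; exact: ltnW.
rewrite -adj //; first by apply: inball_le Gu; exact: ltnW.
by apply: (@inball_le G s.+1) => //=; right; exists u.
Qed.

Lemma ball_iso_le G H r s : (s <= r)%N -> ball_iso G H r -> ball_iso G H s.
Proof.
move=> sr [f [g [f0 fB gB adj]]]; exists f, g.
have G0 : inball G r 0%N by elim: (r) => //= k IH; left.
have g0 : g 0%N = 0%N by rewrite -{1}f0; have [_ ->] := fB _ G0.
have adj' u v : inball H r u -> inball H r v -> radj H u v = radj G (g u) (g v).
  by move=> /gB[Bu fu] /gB[Bv fv]; rewrite adj // fu fv.
split=> //.
- move=> v Gv; split; first exact: (ball_iso_inball f0 adj sr Gv).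
  by have [] := fB v (inball_le sr Gv).
- move=> v Hv; split; first exact: (ball_iso_inball g0 adj' sr Hv).
  by have [] := gB v (inball_le sr Hv).
- by move=> u v Gu Gv; apply: adj; exact: inball_le sr _.
Qed.

End BallIso.

Section LocalFunctions.
Variable R : realType.

Definition local_fun (r : nat) (T : Type) (f : rooted_graph -> T) :=
  forall G H, ball_iso G H r -> f G = f H.

Lemma local_dist_ball_iso G H r : local_dist G H < r.+1%:R^-1 :> R -> ball_iso G H r.
Proof.
have S0 : [set (k.+1%:R^-1 : R) | k in ball_iso G H] !=set0.
  exists 1, 0%N; last by rewrite invr1.
  by exists id, id; split=> // u v /= -> ->; rewrite !radj_irr.
move=> /(inf_lt S0)[_ [k Gk <-]]; rewrite ltf_pV2 ?posrE // ltr_nat ltnS => rk.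
exact: ball_iso_le (ltnW rk) Gk.
Qed.

Lemma local_fun_bcont r (f : rooted_graph -> R) : local_fun r f ->
  (exists C : R, forall G, `|f G| <= C) -> rg_bcont f.
Proof.
move=> lf fC; split=> // G e e0; exists r.+1%:R^-1; first by rewrite invr_gt0.
by move=> H /local_dist_ball_iso /lf ->; rewrite subrr normr0.
Qed.

Lemma local_fun_measurable r (f : rooted_graph -> R) : local_fun r f ->
  measurable_fun [set: Gstar R] (f : Gstar R -> R).
Proof.
move=> lf _ B mB; rewrite setTI; apply: sub_gen_smallest => G BG.
exists r.+1%:R^-1; first by rewrite invr_gt0.
by move=> H /local_dist_ball_iso /lf; rewrite /= => <-.
Qed.

(** The whole unit ball is inspected, since an edge at the root is also deleted when its other
    endpoint has large degree. The ball of radius 2 decides this. *)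
Definition high_degree (D : nat) (G : rooted_graph) : Prop :=
  exists u, inball G 1 u /\ exists s : seq nat,
    [/\ uniq s, (D < size s)%N & all (radj G u) s].

Lemma high_degree_local D G H : ball_iso G H 2 -> high_degree D G -> high_degree D H.
Proof.
move=> [f [g [f0 fB gB adj]]] [u [Bu [s [us sz /allP sr]]]].
exists (f u); split; first by apply: (ball_iso_inball (r := 2)) Bu.
have Bs v : v \in s -> inball G 2 v by move=> /sr uv; right; exists u.
exists (map f s); rewrite size_map; split=> //.
  rewrite map_inj_in_uniq // => v v' /Bs/fB[_ gv] /Bs/fB[_ gv'] fv.
  by rewrite -gv -gv' fv.
apply/allP => _ /mapP[v vs ->]; rewrite -adj; [exact: sr|by left|exact: Bs].
Qed.

Lemma high_degree_eventually_false G : exists D0, forall D, (D0 <= D)%N -> ~ high_degree D G.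
Proof.
have [N NP] := choice (radj_lf G).
pose M := (\max_(u < (N 0%N).+1) N u)%N; exists M => D MD [u [Bu [s [us sz /allP sr]]]].
have uN : (u < (N 0%N).+1)%N.
  by case: Bu => [->//|[v [-> /NP]]]; exact: ltnW.
have sN : {subset s <= iota 0 (N u)} by move=> v /sr /NP; rewrite mem_iota add0n.
have := uniq_leq_size us sN; rewrite size_iota leqNgt => /negP; apply.
apply: leq_ltn_trans sz; apply: leq_trans MD.
exact: (leq_bigmax (F := fun u : 'I_(N 0%N).+1 => N u) (Ordinal uN)).
Qed.

Definition hd_ind (D : nat) (G : rooted_graph) : R := (`[< high_degree D G >])%:R.

Lemma hd_ind_local D : local_fun 2 (hd_ind D).
Proof.
move=> G H GH; rewrite /hd_ind; congr (_%:R); congr nat_of_bool; apply/asbool_equiv_eq.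
by split; apply: high_degree_local => //; exact: ball_iso_sym.
Qed.

End LocalFunctions.

(** * Balls in finite graphs and their transport *)

Section FiniteBalls.
Variables (n : nat) (g : rel 'I_n).
Hypothesis gs : simple_graph g.

Fixpoint fball (o : 'I_n) (r : nat) : {set 'I_n} :=
  if r is r'.+1 then fball o r' :|: [set v | [exists u in fball o r', g u v]]%SET
  else [set o]%SET.

Lemma fball_le o r s : (r <= s)%N -> {subset fball o r <= fball o s}.
Proof.
move=> /subnK <- v; elim: (s - r)%N => //= k IH /IH; rewrite inE => ->. by [].
Qed.

Lemma fball_step o r u v : u \in fball o r -> g u v -> v \in fball o r.+1.
Proof. by move=> ur uv; rewrite /= !inE; apply/orP; right; apply/existsP; exists u; rewrite ur. Qed.

Lemma swap0K (o : 'I_n) : involutive (swap0 o).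
Proof.
move=> a; rewrite /swap0; case: (eqVneq a o) => [->|ao].
  by case: eqP => [<-|_]; rewrite ?eqxx.
case: (eqVneq a 0%N) => [->|a0]; first by rewrite eqxx.
by rewrite (negbTE ao) (negbTE a0).
Qed.

Lemma swap0_root (o : 'I_n) : swap0 o o = 0%N.
Proof. by rewrite /swap0 eqxx. Qed.

Lemma rooted_adj_swap o (i j : 'I_n) : rooted_adj g o (swap0 o i) (swap0 o j) = g i j.
Proof.
rewrite /rooted_adj !swap0K !valK (inj_eq (inv_inj (swap0K o))).
case: (eqVneq (i : nat) j) => [/val_inj ->|_] /=; first by rewrite gs.2.
by rewrite -[g j i]gs.1 orbb.
Qed.

Lemma rooted_adj_vertex o a b : rooted_adj g o a b -> exists j : 'I_n, b = swap0 o j.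
Proof.
rewrite /rooted_adj; case: insubP => // i _ _; case: insubP => // j _ jb _.
by exists j; rewrite jb swap0K.
Qed.

Lemma inball_fball o r a : inball (rooted_of g o) r a <->
  exists2 v, v \in fball o r & a = swap0 o v.
Proof.
elim: r a => [|r IH] a /=.
  split=> [->|[v]]; first by exists o; rewrite ?inE ?eqxx ?swap0_root.
  by rewrite inE => /eqP -> ->; rewrite swap0_root.
split=> [[/IH[v vr ->]|[u [/IH[v vr ->] uv]]]|[v]].
- by exists v; rewrite // inE vr.
- have [j aj] := rooted_adj_vertex uv; exists j => //.
  by apply: fball_step vr _; rewrite -(rooted_adj_swap o) -aj.
- rewrite !inE => /orP[vr ->|/existsP[u /andP[ur uv]] ->].
    by left; apply/IH; exists v.
  right; exists (swap0 o u); split; first by apply/IH; exists u.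
  by rewrite rooted_adj_swap.
Qed.

Lemma not_high_degree D o : ~ high_degree D (rooted_of g o) ->
  (deg g o <= D)%N /\ forall u, g o u -> (deg g u <= D)%N.
Proof.
move=> nh; have key u : u \in fball o 1 -> (deg g u <= D)%N.
  move=> u1; rewrite leqNgt; apply/negP => uD; apply: nh.
  exists (swap0 o u); split; first by apply/inball_fball; exists u.
  exists [seq swap0 o (val v) | v <- enum [set v | g u v]%SET]; rewrite size_map -cardE; split=> //.
    rewrite map_inj_uniq ?enum_uniq // => v v' /(inv_inj (swap0K o)); exact: val_inj.
  by apply/allP => _ /mapP[v + ->]; rewrite mem_enum inE /= rooted_adj_swap.
have o0 : o \in fball o 0 by rewrite inE.
split; first by apply: key; apply: fball_le o0.
by move=> u ou; apply: key; apply: fball_step o0 ou.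
Qed.

End FiniteBalls.

Section BallTransport.
Variables (n n' : nat) (g : rel 'I_n) (g' : rel 'I_n') (o : 'I_n) (o' : 'I_n') (r : nat).
Hypotheses (gs : simple_graph g) (gs' : simple_graph g').

(** The form of [ball_iso] on actual vertices instead of relabelled naturals. All smaller balls must
    correspond as well, because they carry the supports of matrix powers. *)
Definition ball_transport (phi : 'I_n -> 'I_n') :=
  [/\ phi o = o',
      {in fball g o r &, injective phi},
      (forall s, (s <= r)%N -> [set phi v | v in fball g o s]%SET = fball g' o' s)
    & {in fball g o r &, forall u v, g u v = g' (phi u) (phi v)}].

Lemma ball_iso_transport : ball_iso (rooted_of g o) (rooted_of g' o') r ->
  exists phi, ball_transport phi.
Proof.
move=> [f [h [f0 fB hB adj]]].
have h0 : h 0%N = 0%N.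
  have G0 : inball (rooted_of g o) r 0%N by elim: (r) => //= k IH; left.
  by rewrite -{1}f0; have [_ ->] := fB _ G0.
have adj' u v : inball (rooted_of g' o') r u -> inball (rooted_of g' o') r v ->
    radj (rooted_of g' o') u v = radj (rooted_of g o) (h u) (h v).
  by move=> /hB[Bu fu] /hB[Bv fv]; rewrite adj // fu fv.
pose phi (v : 'I_n) := insubd o' (swap0 o' (f (swap0 o v))).
pose psi (v : 'I_n') := insubd o (swap0 o (h (swap0 o' v))).
have phiE s v : (s <= r)%N -> v \in fball g o s ->
    phi v \in fball g' o' s /\ f (swap0 o v) = swap0 o' (phi v).
  move=> sr vs.
  have /(ball_iso_inball f0 adj sr)/(inball_fball gs')[v' v's fv] : inball (rooted_of g o) s (swap0 o v).
    by apply/inball_fball => //; exists v.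
  by rewrite /phi fv swap0K valKd.
have psiE s v : (s <= r)%N -> v \in fball g' o' s ->
    psi v \in fball g o s /\ h (swap0 o' v) = swap0 o (psi v).
  move=> sr vs.
  have /(ball_iso_inball h0 adj' sr)/(inball_fball gs)[v' v's fv] : inball (rooted_of g' o') s (swap0 o' v).
    by apply/inball_fball => //; exists v.
  by rewrite /psi fv swap0K valKd.
have phiK v : v \in fball g o r -> psi (phi v) = v.
  move=> vr; have [pr fE] := phiE _ _ (leqnn r) vr.
  have [_ hf] := fB (swap0 o v) ltac:(by apply/inball_fball => //; exists v).
  by rewrite /psi -fE hf swap0K valKd.
have psiK v : v \in fball g' o' r -> phi (psi v) = v.
  move=> vr; have [pr hE] := psiE _ _ (leqnn r) vr.
  have [_ fh] := hB (swap0 o' v) ltac:(by apply/inball_fball => //; exists v).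
  by rewrite /phi -hE fh swap0K valKd.
exists phi; split.
- by rewrite /phi swap0_root f0 -(swap0_root o') swap0K valKd.
- by move=> u v ur vr /(congr1 psi); rewrite !phiK.
- move=> s sr; apply/setP => v; apply/imsetP/idP => [[u us ->]|vs].
    by have [] := phiE _ _ sr us.
  exists (psi v); first by have [] := psiE _ _ sr vs.
  by rewrite psiK //; apply: fball_le vs.
- move=> u v ur vr; have [pu fu] := phiE _ _ (leqnn r) ur; have [pv fv] := phiE _ _ (leqnn r) vr.
  rewrite -(rooted_adj_swap gs o) -(rooted_adj_swap gs' o') -fu -fv.
  by apply: adj; apply/inball_fball => //; [exists u|exists v].
Qed.

Variable phi : 'I_n -> 'I_n'.
Hypothesis tr : ball_transport phi.

Lemma transport_mem s v : (s <= r)%N -> v \in fball g o s -> phi v \in fball g' o' s.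
Proof. by move=> sr vs; case: tr => _ _ /(_ s sr) <- _; exact: imset_f. Qed.

Lemma transport_sum (R : realType) s (h : 'I_n -> R) (h' : 'I_n' -> R) : (s <= r)%N ->
  (forall v, v \notin fball g o s -> h v = 0) ->
  (forall v, v \notin fball g' o' s -> h' v = 0) ->
  (forall v, v \in fball g o s -> h v = h' (phi v)) ->
  \sum_v h v = \sum_v h' v.
Proof.
move=> sr hz hz' hh'; case: tr => _ inj im _.
rewrite (bigID (mem (fball g o s))) /= [X in _ + X]big1 // addr0.
rewrite [RHS](bigID (mem (fball g' o' s))) /= [X in _ = _ + X]big1 // addr0.
rewrite -(im s sr) big_imset /=; first exact: eq_bigr.
by move=> u v us vs; apply: inj; exact: fball_le sr _ _.
Qed.

(** As s < r, all neighbours of [v] lie in the transported ball, and [phi] carries them bijectively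
    to the neighbours of [phi v]. *)
Lemma transport_deg s v : (s < r)%N -> v \in fball g o s -> deg g' (phi v) = deg g v.
Proof.
move=> sr vs; case: tr => _ inj im adj; rewrite /deg.
have <- : [set phi u | u in [set u | g v u]%SET]%SET = [set u | g' (phi v) u]%SET.
  apply/setP => u; rewrite inE; apply/imsetP/idP => [[w]|vu].
    rewrite inE => vw ->; rewrite -adj //; first by apply: fball_le vs; exact: ltnW.
    by apply: (fball_le (r := s.+1)) => //; apply: fball_step vs vw.
  have : u \in fball g' o' s.+1 by apply: fball_step vu; apply: transport_mem => //; exact: ltnW.
  rewrite -im // => /imsetP[w ws uw]; exists w => //; rewrite inE adj -?uw //.
    by apply: fball_le vs; exact: ltnW.
  exact: fball_le ws.
rewrite card_in_imset // => u w; rewrite !inE => vu vw.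
by apply: inj; apply: (fball_le (r := s.+1)) => //; apply: fball_step vs _.
Qed.

Lemma transport_trunc D s u v : (s < r)%N -> u \in fball g o s -> v \in fball g o s ->
  trunc_graph D g u v = trunc_graph D g' (phi u) (phi v).
Proof.
move=> sr us vs; rewrite /trunc_graph !(transport_deg sr) //.
by case: tr => _ _ _ ->//; exact: (fball_le (ltnW sr)).
Qed.

Section Matrix.
Variables (R : realType) (V : finType) (vl : V -> R) (D : nat) (alpha : bool).
Variables (c : {ffun upairs n -> V}) (c' : {ffun upairs n' -> V}).
Hypothesis cc' : forall x y, x \in fball g o r -> y \in fball g o r ->
  c (mkup x y) = c' (mkup (phi x) (phi y)).

Let N := trunc_mx vl D alpha g c.
Let N' := trunc_mx vl D alpha g' c'.

Lemma trunc_mx_local m (q : rel 'I_m) p (b : {ffun upairs m -> V}) s u v :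
  u \in fball q p s -> v \notin fball q p s.+1 -> trunc_mx vl D alpha q b u v = 0.
Proof.
move=> us vs; rewrite mxE.
have uv : u == v = false.
  by apply/negbTE; apply: contraNneq vs => <-; apply: fball_le us.
have -> : trunc_graph D q u v = false.
  by apply/negbTE; apply: contraNN vs => /and3P[uv' _ _]; apply: fball_step us uv'.
by rewrite uv mulr0 !mul0r subr0.
Qed.

Lemma trunc_mx_transport s u v : (s.+1 < r)%N -> u \in fball g o s -> v \in fball g o s.+1 ->
  N u v = N' (phi u) (phi v).
Proof.
move=> sr us vs.
have us1 : u \in fball g o s.+1 by apply: fball_le us.
have in_r w : w \in fball g o s.+1 -> w \in fball g o r by apply: fball_le; exact: ltnW.
rewrite !mxE -(transport_trunc D sr) // cc' ?in_r //; congr (_ - _).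
have -> : (phi u == phi v) = (u == v).
  by case: tr => _ inj _ _; rewrite (inj_in_eq inj) ?in_r.
congr (_ * _); apply: (transport_sum (s := s.+1)) => [|w ws|w ws|w ws].
- exact: ltnW.
- rewrite (_ : trunc_graph _ _ _ _ = false) ?mulr0 //.
  by apply/negbTE; apply: contraNN ws => /and3P[uw _ _]; apply: fball_step us uw.
- rewrite (_ : trunc_graph _ _ _ _ = false) ?mulr0 //.
  apply/negbTE; apply: contraNN ws => /and3P[uw _ _]; apply: fball_step uw.
  by apply: transport_mem us; apply: leq_trans (ltnW sr); rewrite leqnSn.
- by rewrite cc' ?in_r // -(transport_trunc D sr).
Qed.

Lemma trunc_mx_pow_support m (q : rel 'I_m) p (b : {ffun upairs m -> V}) k v :
  v \notin fball q p k -> (trunc_mx vl D alpha q b ^+ k) p v = 0.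
Proof.
elim: k v => [|k IH] v vk; first by rewrite expr0 mxE; move: vk; rewrite inE eq_sym => /negbTE ->.
rewrite exprSr -mulmxE mxE big1 // => u _.
have [uk|/IH ->] := boolP (u \in fball q p k); last by rewrite mul0r.
by rewrite (trunc_mx_local b uk vk) mulr0.
Qed.

(** A walk of length k from the root stays in the k-ball, and the truncation reads the degrees of
    vertices of that ball, hence neighbours just outside; the radius leaves room for them. *)
Lemma trunc_mx_pow_transport k v : (k.+1 < r)%N \/ k = 0%N -> v \in fball g o k ->
  (N ^+ k) o v = (N' ^+ k) o' (phi v).
Proof.
have [phio inj _ _] := tr.
elim: k v => [|k IH] v kr vk.
  by move: vk; rewrite inE => /eqP ->; rewrite phio !expr0 !mxE !eqxx.
have {kr}kr : (k.+2 < r)%N by case: kr.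
rewrite !exprSr -!mulmxE !mxE; apply: (transport_sum (s := k)) => [|u uk|u uk|u uk].
- by apply: leq_trans (ltnW (ltnW kr)); rewrite leqnSn.
- by rewrite trunc_mx_pow_support // mul0r.
- by rewrite trunc_mx_pow_support // mul0r.
- rewrite IH //; last by left; exact: ltnW.
  congr (_ * _); apply: (@trunc_mx_transport k) => //; exact: ltnW.
Qed.

End Matrix.
End BallTransport.

(** * Expected moments as local functions *)

Section LocalMoments.
Variables (R : realType) (V : finType) (vl pr : V -> R) (D : nat) (alpha : bool).
Hypothesis pr_sum : \sum_v pr v = 1.

Definition root_moment j n (g : rel 'I_n) (o : 'I_n) : R :=
  Ex pr (fun c => (trunc_mx vl D alpha g c ^+ j) o o).

(** Only weights on pairs inside the ball enter the root entry, and the transport matches these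
    pairs, so [coupling] equates the expectations. *)
Lemma root_moment_local j n n' (g : rel 'I_n) (g' : rel 'I_n') o o' :
  simple_graph g -> simple_graph g' ->
  ball_iso (rooted_of g o) (rooted_of g' o') j.+2 ->
  root_moment j g o = root_moment j g' o'.
Proof.
move=> gs gs' /(ball_iso_transport gs gs')[phi tr].
have [phio inj _ _] := tr.
pose S := {p : upairs n | ((val p).1 \in fball g o j.+2) && ((val p).2 \in fball g o j.+2)}.
pose iota (p : S) : upairs n := val p.
pose iota' (p : S) : upairs n' := mkup (phi (val (val p)).1) (phi (val (val p)).2).
apply: (@coupling _ _ _ pr_sum S _ _ iota iota').
- exact: val_inj.
- move=> [[[a b] /= ab] /= P1] [[[x y] /= xy] /= P2].
  have /andP[ar br] := P1; have /andP[xr yr] := P2.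
  move=> e0; have e3 : mkup (phi a) (phi b) = mkup (phi x) (phi y) := e0.
  have [[e1 e2]|[e1 e2]] := mkup_eq e3; do 2 apply: val_inj => /=.
    by rewrite (inj _ _ ar xr e1) (inj _ _ br yr e2).
  (* The crossed case: a = y and b = x, while a <= b and x <= y, so all four vertices coincide. *)
  have ay := inj _ _ ar yr e1; have bx := inj _ _ br xr e2.
  have E : y = x by apply/val_inj/anti_leq; rewrite -{1}ay -{1}bx ab xy.
  by rewrite ay bx E.
move=> c c' cc'.
have cc x y : x \in fball g o j.+2 -> y \in fball g o j.+2 ->
    c (mkup x y) = c' (mkup (phi x) (phi y)).
  move=> xr yr; wlog xy : x y xr yr / (x <= y)%N.
    move=> W; have [|/ltnW] := leqP x y; first exact: W.
    by move=> /W; rewrite mkupC [mkup (phi x) _]mkupC; apply.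
  have pP : ((val (mkup x y)).1 \in fball g o j.+2) && ((val (mkup x y)).2 \in fball g o j.+2).
    by rewrite /= xy /= xr yr.
  by have := cc' (exist _ (mkup x y) pP); rewrite /iota /iota' /= xy.
have oj : o \in fball g o j by apply: (@fball_le _ _ o 0%N); rewrite ?inE.
by have := trunc_mx_pow_transport tr vl D alpha cc (or_introl _) oj; rewrite phio; apply.
Qed.

(* The value at [H] is read off any finite graph with the same ball, and is [0] if
   there is none; this makes locality automatic once [root_moment_local] is known. *)
Definition moment_fun (j : nat) (H : rooted_graph) : R :=
  if pselect (exists x : {n & (rel 'I_n * 'I_n)%type},
      simple_graph (projT2 x).1 /\ ball_iso (rooted_of (projT2 x).1 (projT2 x).2) H j.+2)
  is left ex then let x := projT1 (cid ex) in root_moment j (projT2 x).1 (projT2 x).2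
  else 0.

Lemma moment_funE j n (g : rel 'I_n) o H : simple_graph g ->
  ball_iso (rooted_of g o) H j.+2 -> moment_fun j H = root_moment j g o.
Proof.
move=> gs gH; rewrite /moment_fun; case: pselect => [ex|]; last first.
  by case; exists (existT _ n (g, o)).
case: cid => [[m [q p]]] /= [qs qH]; apply: root_moment_local => //.
exact: ball_iso_trans qH (ball_iso_sym gH).
Qed.

Lemma moment_fun_local j : local_fun j.+2 (moment_fun j).
Proof.
move=> G H GH.
have [[[n [g o]] /= [gs gG]]|nex] := pselect (exists x : {n & (rel 'I_n * 'I_n)%type},
   simple_graph (projT2 x).1 /\ ball_iso (rooted_of (projT2 x).1 (projT2 x).2) G j.+2).
  by rewrite (moment_funE gs gG) (moment_funE gs (ball_iso_trans gG GH)).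
rewrite /moment_fun; case: pselect => // _; case: pselect => // -[x [xs xH]].
case: nex; exists x; split=> //; exact: ball_iso_trans xH (ball_iso_sym GH).
Qed.

Variable K : R.
Hypothesis vlK : forall v, `|vl v| <= K.
Hypothesis pr_ge0 : forall v, 0 <= pr v.

Lemma root_moment_bounded j n (g : rel 'I_n) o : simple_graph g ->
  `|root_moment j g o| <= (2 * (D%:R * K)) ^+ j.
Proof.
move=> gs; rewrite /root_moment /Ex; apply: le_trans (ler_norm_sum _ _ _) _.
rewrite -[leRHS](Ex_cst pr_sum (upairs n)); apply: ler_sum => c _.
rewrite normrM ger0_norm ?pweight_ge0 // ler_wpM2l ?pweight_ge0 //.
apply: row_sum_le_entry; apply: row_sum_le_exp; last exact: trunc_mx_row_sum.
by rewrite !mulr_ge0 //; apply: le_trans (vlK (c (mkup o o))).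
Qed.

Lemma moment_fun_bounded j H : `|moment_fun j H| <= `|2 * (D%:R * K)| ^+ j.
Proof.
rewrite /moment_fun; case: pselect => [ex|_]; last by rewrite normr0 exprn_ge0.
case: cid => [[m [q p]]] /= [qs qH]; apply: le_trans (root_moment_bounded _ _ qs) _.
by rewrite -normrX ler_norm.
Qed.

Lemma U_int_moment_fun j n (g : rel 'I_n) : simple_graph g ->
  U_int g (moment_fun j) = n%:R^-1 * Ex pr (fun c => \tr (trunc_mx vl D alpha g c ^+ j)).
Proof.
move=> gs; rewrite /U_int /mxtrace (Ex_sum pr); congr (_ * _); apply: eq_bigr => o _.
by rewrite (@moment_funE j n g o) //; exact: ball_iso_refl.
Qed.

End LocalMoments.

(** * Rounded weights *)

Section FiniteValued.
Context (d : measure_display) (T : measurableType d) (R : realType) (P : probability T R).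
Variables (F : finType) (X : T -> F).
Hypothesis mX : forall x, measurable [set om | X om = x].

Lemma finite_valued_bigcup (A : pred F) :
  [set om | A (X om)] = \bigcup_(x in [set` [seq x <- enum F | A x]]) [set om | X om = x].
Proof.
apply/seteqP; split=> om /=.
  by move=> AX; exists (X om) => //=; rewrite mem_filter AX mem_enum.
by move=> [x /=]; rewrite mem_filter => /andP[Ax _] ->.
Qed.

Lemma finite_valued_measurable (A : pred F) : measurable [set om | A (X om)].
Proof. by rewrite finite_valued_bigcup; apply: fin_bigcup_measurable. Qed.

Lemma finite_valued_measure (E : set T) (A : pred F) : measurable E ->
  P ([set om | A (X om)] `&` E) = (\sum_(x | A x) P ([set om | X om = x] `&` E))%E.
Proof.
move=> mE; rewrite finite_valued_bigcup setI_bigcupl measure_fin_bigcup //.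
- rewrite -fsbig_seq; last by rewrite filter_uniq // enum_uniq.
  by rewrite big_filter big_enum_cond.
- by move=> x y _ _ [om [[/= <- _] [<- _]]].
- by move=> x _; apply: measurableI.
Qed.

End FiniteValued.

Section Quantizer.
Variable R : realType.

(** [Some k] is a cell of mesh [eta] in [-K, K], represented by its left end; [None] marks a
    discarded value and is represented by 0. *)
Lemma quantizer (K eta : R) : 0 < K -> 0 < eta ->
  exists (V : finType) (q : R -> V) (vl : V -> R) (big : pred V),
    [/\ forall v, measurable [set x | q x = v], forall v, `|vl v| <= K,
      forall x, big (q x) = (K < `|x|) &
      forall x, `|x| <= K -> `|vl (q x) - x| <= eta].
Proof.
move=> K0 eta0; pose m := Num.truncn (2 * K / eta).
pose idx (x : R) := Num.truncn ((x + K) / eta).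
pose q x : option 'I_m.+1 := if `|x| <= K then Some (inord (idx x)) else None.
pose vl (v : option 'I_m.+1) : R := if v is Some k then - K + k%:R * eta else 0.
have idxE x : `|x| <= K -> (inord (idx x) : 'I_m.+1) = idx x :> nat.
  rewrite ler_norml => /andP[? ?]; rewrite inordK // ltnS; apply: le_truncn.
  by rewrite ler_pM2r ?invr_gt0 //; lra.
exists (option 'I_m.+1), q, vl, (fun v => ~~ isSome v); split.
- move=> [k|]; last first.
    have -> : [set x | q x = None] = ~` `[- K, K]%classic.
      apply/seteqP; split=> x /=; rewrite in_itv /= -ler_norml /q; first by case: ifP.
      by move/negP/negbTE ->.
    by apply: measurableC.
  have -> : [set x | q x = Some k] =
      `[- K, K]%classic `&` `[- K + k%:R * eta, - K + k.+1%:R * eta[%classic.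
    apply/seteqP; split=> x /=; rewrite !in_itv /= -ler_norml /q.
      case: ifP => // xK [/(congr1 val) /=]; rewrite idxE // => ik; split=> //.
      have := @truncn_itv _ ((x + K) / eta); rewrite -/(idx x) ik.
      move: (xK); rewrite ler_norml => /andP[xK1 xK2].
      rewrite divr_ge0 ?(ltW eta0) //; last by lra.
      rewrite ler_pdivlMr // ltr_pdivrMr // => /(_ isT)/andP[? ?]; apply/andP; split; lra.
    move=> [xK /andP[h1 h2]]; rewrite xK; congr Some; apply/val_inj; rewrite /= idxE //.
    by apply: truncn_def; rewrite ler_pdivlMr // ltr_pdivrMr //; apply/andP; split; lra.
  by apply: measurableI.
- move=> [k|] /=; last by rewrite normr0 ltW.
  have k0 : 0 <= k%:R * eta by rewrite mulr_ge0 // ltW.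
  have km : k%:R * eta <= 2 * K.
    rewrite -ler_pdivlMr //; apply: (@le_trans _ _ m%:R); first by rewrite ler_nat -ltnS.
    by rewrite truncn_le divr_ge0 ?(ltW eta0) //; lra.
  by rewrite ler_norml; apply/andP; split; lra.
- by move=> x; rewrite /q ltNge; case: ifP.
- move=> x xK; rewrite /q xK /vl idxE //.
  have := @truncn_itv _ ((x + K) / eta); rewrite -/(idx x).
  move: (xK); rewrite ler_norml => /andP[xK1 xK2].
  rewrite divr_ge0 ?(ltW eta0) //; last by lra.
  rewrite ler_pdivlMr // ltr_pdivrMr // -addn1 natrD mulrDl mul1r => /(_ isT)/andP[? ?].
  by rewrite ler_norml; apply/andP; split; lra.
Qed.

End Quantizer.

(** * Law of the rounded configuration *)

Section Configurations.
Context (d : measure_display) (T : measurableType d) (R : realType) (P : probability T R).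
Variable (w : nat -> nat -> T -> R).
Hypothesis iid : iid_weights P w.
Variables (V : finType) (q : R -> V).
Hypothesis mq : forall v, measurable [set x | q x = v].

Definition law (v : V) : R := fine (P (w 0 0 @^-1` [set x | q x = v])).

Lemma measurable_w_fiber i j v : measurable (w i j @^-1` [set x | q x = v]).
Proof. by have [mw _] := iid; rewrite -[X in measurable X]setTI; apply: mw. Qed.

Lemma law_ge0 v : 0 <= law v.
Proof. by rewrite fine_ge0. Qed.

Lemma law_fin v : (law v)%:E = P (w 0 0 @^-1` [set x | q x = v]).
Proof. by rewrite fineK // fin_num_measure //; exact: measurable_w_fiber. Qed.

Lemma law_pred (A : pred V) : (\sum_(v | A v) law v)%:E = P [set om | A (q (w 0 0 om))].
Proof.
rewrite -sumEFin -[X in _ = P X]setIT.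
rewrite (@finite_valued_measure _ _ _ _ _ (fun om => q (w 0 0 om)) _ setT) //.
  by apply: eq_bigr => v _; rewrite setIT law_fin.
by move=> v; exact: measurable_w_fiber.
Qed.

Lemma law_sum : \sum_v law v = 1.
Proof.
apply: EFin_inj; rewrite law_pred -(@probability_setT _ _ _ P); congr (P _).
by apply/seteqP; split.
Qed.

Definition config n (om : T) : {ffun upairs n -> V} :=
  [ffun p : upairs n => q (w (sval p).1 (sval p).2 om)].

Definition natpair n (p : upairs n) : nat * nat := ((sval p).1 : nat, (sval p).2 : nat).

Lemma natpair_inj n : injective (@natpair n).
Proof.
move=> [[a b] ab] [[x y] xy] [/= /val_inj ax /val_inj by']; subst.
exact: val_inj.
Qed.

(** The independence hypotheses take a set for every pair of naturals, so the prescribed value is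
    extended by the full line off the pairs in use. *)
Definition cyl n (c : {ffun upairs n -> V}) (x : nat * nat) : set R :=
  if [pick p | natpair p == x] is Some p then [set y | q y = c p] else setT.

Lemma cyl_measurable n (c : {ffun upairs n -> V}) x : measurable (cyl c x).
Proof. by rewrite /cyl; case: pickP. Qed.

Lemma cylE n (c : {ffun upairs n -> V}) p : cyl c (natpair p) = [set y | q y = c p].
Proof.
by rewrite /cyl; case: pickP => [p' /eqP/natpair_inj -> //|/(_ p)]; rewrite eqxx.
Qed.

Definition npairs n : seq (nat * nat) := [seq natpair p | p <- enum {: upairs n}].

Lemma npairs_uniq n : uniq (npairs n).
Proof. by rewrite map_inj_uniq ?enum_uniq //; exact: natpair_inj. Qed.

Lemma npairs_upper n : all upper (npairs n).
Proof. by apply/allP => _ /mapP[[[a b] ab] _ ->]. Qed.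

Lemma config_cyl n (c : {ffun upairs n -> V}) :
  [set om | config n om = c] =
  \bigcap_(p in [set p | p \in npairs n]) (w p.1 p.2 @^-1` cyl c p).
Proof.
apply/seteqP; split=> om /=.
  move=> cE _ /= /mapP[p _ ->]; rewrite cylE /= -cE ffunE //.
move=> H; apply/ffunP => p; rewrite ffunE.
have := H (natpair p); rewrite /= cylE; apply.
by apply/mapP; exists p; rewrite ?mem_enum.
Qed.

Lemma config_measurable n (c : {ffun upairs n -> V}) : measurable [set om | config n om = c].
Proof.
have -> : [set om | config n om = c] =
    \bigcap_(p in [set` enum {: upairs n}]) (w (sval p).1 (sval p).2 @^-1` [set x | q x = c p]).
  apply/seteqP; split=> om /=.
    by move=> <- p _; rewrite ffunE.
  by move=> H; apply/ffunP => p; rewrite ffunE; apply: H; rewrite /= mem_enum.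
by apply: fin_bigcap_measurable => // p _; exact: measurable_w_fiber.
Qed.

Lemma config_law n (c : {ffun upairs n -> V}) :
  P [set om | config n om = c] = (pweight law c)%:E.
Proof.
have [_ [indep same]] := iid.
rewrite config_cyl indep; [|exact: npairs_uniq|exact: npairs_upper|exact: cyl_measurable].
rewrite big_map big_enum /pweight -prodEFin; apply: eq_bigr => p _.
rewrite law_fin cylE; apply: same => //; first exact: (valP p).
Qed.

Lemma config_pred n (A : pred {ffun upairs n -> V}) :
  P [set om | A (config n om)] = (Pr law A)%:E.
Proof.
rewrite -[X in P X]setIT (finite_valued_measure _ (@config_measurable n)) //.
rewrite /Pr /Ex -sumEFin [LHS]big_mkcond; apply: eq_bigr => c _.
by rewrite setIT config_law; case: (A c); rewrite ?mulr1 ?mulr0.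
Qed.

Lemma config_indep n (G : T -> rel 'I_n) (A : pred {ffun upairs n -> V}) (S : set (rel 'I_n)) :
  measurable [set om | S (G om)] -> indep_of_graph P w G ->
  P ([set om | S (G om)] `&` [set om | A (config n om)]) =
  (P [set om | S (G om)] * P [set om | A (config n om)])%E.
Proof.
move=> mS ind; rewrite setIC (finite_valued_measure _ (@config_measurable n)) //.
rewrite -[X in (_ * P X)%E]setIT (finite_valued_measure _ (@config_measurable n)) //.
rewrite ge0_sume_distrr //; apply: eq_bigr => c _; rewrite setIT setIC.
rewrite config_cyl.
exact: (ind S (npairs n) (cyl c) (npairs_uniq n) (npairs_upper n) (cyl_measurable c)).
Qed.

End Configurations.

(** * Closeness at a fixed scale *)

(** Continuity from above; it fixes both truncation levels, that of degrees under [rho] and that of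
    weights under [P]. *)
Lemma decreasing_small (d : measure_display) (T : measurableType d) (R : realType)
    (P : probability T R) (F : nat -> set T) (e : R) :
  (forall k, measurable (F k)) -> (forall k, F k.+1 `<=` F k) ->
  (forall x, exists k, ~ F k x) -> 0 < e -> exists k, fine (P (F k)) < e.
Proof.
move=> mF dF F0 e0.
have F_le k l : (k <= l)%N -> F l `<=` F k.
  by move=> /subnK <-; elim: (l - k)%N => [|i IH] //= x /dF/IH.
have cap0 : \bigcap_k F k = set0.
  by apply/seteqP; split=> x // Fx; have [k []] := F0 x; exact: Fx.
have : P \o F @ \oo --> P (\bigcap_k F k).
  apply: nonincreasing_cvg_mu => //.
  - by rewrite [X in (X < _)%E](_ : _ = P (F 0%N)) //; apply: le_lt_trans (probability_le1 _ _) (ltry _).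
  - by rewrite cap0.
  - by move=> k l kl; apply/subsetPset/F_le.
rewrite cap0 measure0 => /fine_cvgP[_] /cvgrPdist_lt /(_ e e0) /filter_ex[k /=].
by rewrite sub0r normrN ger0_norm ?fine_ge0 // => ?; exists k.
Qed.

Section Approximation.
Context (d : measure_display) (T : measurableType d) (R : realType) (w : nat -> nat -> T -> R) (alpha : bool).
Variables (V : finType) (q : R -> V) (vl : V -> R) (big : pred V) (K eta : R) (D : nat).
Hypothesis vlK : forall v, `|vl v| <= K.
Hypothesis bigE : forall x, big (q x) = (K < `|x|).
Hypothesis vlq : forall x, `|x| <= K -> `|vl (q x) - x| <= eta.
Variables (n : nat) (g : rel 'I_n) (om : T).
Hypothesis gs : simple_graph g.

Let c := config w q n om.
Let N := trunc_mx vl D alpha g c.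
Let M := Delta alpha w om g.

Lemma Delta_sym : M^T = M.
Proof.
apply/matrixP => i j; rewrite !mxE /Wsym minnC maxnC gs.1 [j == i]eq_sym.
by case: eqP => [->|] //; rewrite !mul0r.
Qed.

Lemma config_mkup i j : c (mkup i j) = q (Wsym w om i j).
Proof. by rewrite ffunE /Wsym /=; case: leqP. Qed.

(** The rows given up to the rank inequality. In the other rows no edge is deleted and no weight
    discarded, so only the rounding error remains. *)
Definition bad_vertices : {set 'I_n} :=
  [set o | `[< high_degree D (rooted_of g o) >] ||
     [exists j, trunc_graph D g o j && big (c (mkup o j))]]%SET.

Lemma bad_vertices_le : (0 < n)%N ->
  #|bad_vertices|%:R <= n%:R * U_int g (hd_ind R D) + big_count R D g big c.
Proof.
move=> n0; rewrite /U_int mulVKf; last by rewrite pnatr_eq0 -lt0n.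
rewrite /big_count -big_split /= -sum1_card natr_sum big_mkcond /=.
apply: ler_sum => o _; set s := \sum_(j < n) _; have s0 : 0 <= s.
  by apply: sumr_ge0 => j _; rewrite mulr_ge0.
rewrite inE /hd_ind; case: asboolP => _ /=; first by rewrite lerDl.
case: ifP => [/existsP[j oj]|_]; last by rewrite add0r.
rewrite add0r /s (bigD1 j) //=; have /andP[-> ->] := oj; rewrite mulr1 lerDl.
by apply: sumr_ge0 => k _; rewrite mulr_ge0.
Qed.

Lemma good_vertex_row i : 0 <= eta -> i \notin bad_vertices ->
  \sum_j `|N i j - M i j| <= 2 * (D%:R * eta).
Proof.
move=> eta0; rewrite inE negb_or => /andP[/asboolPn/(not_high_degree gs)[iD jD] /existsPn nb].
pose x i j := (vl (c (mkup i j)) - Wsym w om i j) * (trunc_graph D g i j)%:R.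
have trE j : trunc_graph D g i j = g i j.
  by rewrite /trunc_graph iD; case: (boolP (g i j)) => // /jD ->.
have dE j : (N - M) i j = N i j - M i j by rewrite [LHS]mxE [X in _ + X]mxE.
rewrite (eq_bigr (fun j => `|(N - M) i j|)) => [|j _]; last by rewrite dE.
apply: (@le_trans _ _ (2 * \sum_j `|x i j|)).
  apply: (@sum_diag_le R alpha) => j; rewrite dE !mxE /x; under [in RHS]eq_bigr do rewrite mulrBl.
  by rewrite sumrB mulrBr mulrBl !trE; under [X in _ = _ - (_ - _ * X)]eq_bigr do rewrite trE; lra.
rewrite ler_pM2l ?ltr0n //; under eq_bigr do rewrite normrM normr_nat.
apply: sum_trunc_le => // j ij; rewrite config_mkup; apply: vlq.
by have := nb j; rewrite ij /= config_mkup bigE -leNgt.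
Qed.


Lemma scdf_perturb (A B : 'M[R]_n) (Z : {set 'I_n}) (e x z : R) : (0 < n)%N ->
  A^T = A -> B^T = B ->
  (forall i, i \notin Z -> \sum_j `|B i j - A i j| <= e) -> #|Z|%:R <= n%:R * z ->
  scdf (eigvals A) x <= scdf (eigvals B) (x + e) + z.
Proof.
move=> n0 AT BT H Zz; have n0' : 0 < n%:R :> R by rewrite ltr0n.
rewrite !scdf_count !size_eigvals // -(ler_pM2l n0') mulrDr !mulVKf ?gt_eqF //.
apply: (@le_trans _ _ ((count (fun l => l <= x + e) (eigvals B))%:R + #|Z|%:R)).
  by rewrite -natrD ler_nat; exact: eigvals_count_perturb.
by rewrite lerD2l.
Qed.

(** The shift h/8 pays for rounding; the defect h/4 is h/8 for vertices near a high degree plus h/8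
    for vertices meeting a large weight. *)
Lemma Delta_trunc_close (h x : R) : (0 < n)%N -> 0 <= eta -> 2 * (D%:R * eta) <= h / 8 ->
  U_int g (hd_ind R D) <= h / 8 -> big_count R D g big c <= n%:R * (h / 8) ->
  scdf (eigvals M) x <= scdf (eigvals N) (x + h / 8) + h / 4 /\
  scdf (eigvals N) x <= scdf (eigvals M) (x + h / 8) + h / 4.
Proof.
move=> n0 eta0 eh Uh bh.
have n0' : 0 < n%:R :> R by rewrite ltr0n.
have Zh : #|bad_vertices|%:R <= n%:R * (h / 4) :> R.
  apply: le_trans (bad_vertices_le n0) _.
  have : n%:R * U_int g (hd_ind R D) <= n%:R * (h / 8) by rewrite ler_pM2l.
  by lra.
have NT : N^T = N by exact: trunc_mx_sym.
have MT := Delta_sym.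
have eM i : i \notin bad_vertices -> \sum_j `|N i j - M i j| <= h / 8.
  by move=> iZ; apply: le_trans eh; exact: good_vertex_row.
split; first exact: (scdf_perturb x n0 MT NT eM Zh).
apply: (scdf_perturb x n0 NT MT _ Zh) => i /eM.
by under eq_bigr do rewrite distrC.
Qed.

End Approximation.

Section Levels.
Context (d : measure_display) (T : measurableType d) (R : realType) (P : probability T R).
Variables (w : nat -> nat -> T -> R) (alpha : bool).
Hypothesis iid : iid_weights P w.
Variable rho : probability (Gstar R) R.

Definition graph_good (fs : nat -> rooted_graph -> R) (m : nat) (tau : R) n (g : rel 'I_n) :=
  forall i, (i < m)%N -> `|U_int g (fs i) - Rintegral rho setT (fs i)| <= tau.

(* Data certifying closeness at scale [h]: finitely many local statistics of the
   graph, and exceptional events of exponentially small probability for the weights. *)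
Record spectral_level (h : R) := SpectralLevel {
  lv_fun : nat -> rooted_graph -> R;
  lv_size : nat;
  lv_tol : R;
  lv_bad : forall n, rel 'I_n -> set T;
  lv_cst : R;
  lv_rate : R;
  lv_local : forall i, exists r, local_fun r (lv_fun i);
  lv_bounded : forall i, exists C : R, forall G, `|lv_fun i G| <= C;
  lv_tol_gt0 : 0 < lv_tol;
  lv_rate01 : 0 <= lv_rate < 1;
  lv_cst_ge0 : 0 <= lv_cst;
  lv_measurable : forall n (g : rel 'I_n), measurable (lv_bad g);
  lv_prob : forall n (g : rel 'I_n), simple_graph g ->
    (P (lv_bad g) <= (lv_cst * lv_rate ^+ n)%:E)%E;
  lv_indep : forall n (g : rel 'I_n) (G : T -> rel 'I_n) (S : set (rel 'I_n)),
    measurable [set om | S (G om)] -> indep_of_graph P w G ->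
    P ([set om | S (G om)] `&` lv_bad g) = (P [set om | S (G om)] * P (lv_bad g))%E;
  lv_close : forall n (g : rel 'I_n) om n' (g' : rel 'I_n') om',
    (0 < n)%N -> (0 < n')%N -> simple_graph g -> simple_graph g' ->
    graph_good lv_fun lv_size lv_tol g -> graph_good lv_fun lv_size lv_tol g' ->
    ~ lv_bad g om -> ~ lv_bad g' om' ->
    forall x, scdf (eigvals (Delta alpha w om g)) x <=
              scdf (eigvals (Delta alpha w om' g')) (x + h) + h }.

Lemma high_degree_small (e : R) : 0 < e -> exists D, Rintegral rho setT (hd_ind R D) < e.
Proof.
move=> e0; pose F D : set (Gstar R) := [set G | high_degree D G].
have mF D : measurable (F D).
  apply: sub_gen_smallest => G FG; exists 3%:R^-1; first by rewrite invr_gt0.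
  by move=> H /local_dist_ball_iso GH; apply: high_degree_local FG.
have [|G|D PD] := @decreasing_small _ _ _ rho F e mF _ _ e0.
- move=> k G [u [Bu [s [us sz sr]]]]; exists u; split=> //; exists s; split=> //; exact: ltnW.
- by have [D0 H] := high_degree_eventually_false G; exists D0; exact: H.
exists D; apply: le_lt_trans PD; rewrite /Rintegral le_eqVlt; apply/orP; left; apply/eqP.
congr fine; transitivity (\int[rho]_x (\1_(F D) x)%:E)%E.
  by apply: eq_integral => G _; rewrite indicE /hd_ind.
by rewrite integral_indic // setIT.
Qed.

Lemma large_weight_small (e : R) : 0 < e ->
  exists2 K : R, 0 < K & fine (P [set om | K < `|w 0%N 0%N om|]) < e.
Proof.
move=> e0; pose F k := [set om | k.+1%:R < `|w 0%N 0%N om|].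
have [mw _] := iid.
have mF k : measurable (F k).
  rewrite (_ : F k = (fun om => `|w 0%N 0%N om|) @^-1` `]k.+1%:R, +oo[%classic); last first.
    by apply/seteqP; split=> om; rewrite /F /= in_itv /= andbT.
  rewrite -[X in measurable X]setTI.
  by apply: (measurableT_comp (@normr_measurable R setT) (mw 0%N 0%N)) => //; exact: measurable_itv.
have [|om|k Pk] := @decreasing_small _ _ _ P F e mF _ _ e0.
- by move=> k om; rewrite /F /=; apply: le_lt_trans; rewrite ler_nat.
- exists (Num.truncn `|w 0%N 0%N om|); rewrite /F /=; apply/negP; rewrite -leNgt ltW //.
  exact: truncnS_gt.
by exists k.+1%:R.
Qed.

(** The constants are chosen in the order [D], then [K] and [eta], then [J] and [et], then [tau],
    each depending on the earlier ones and none on the graph or its size. *)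
Lemma spectral_level_exists (h : R) : 0 < h -> inhabited (spectral_level h).
Proof.
move=> h0; have h16 : 0 < h / 16 by lra.
have [D hD] := high_degree_small h16.
have D0 : 0 < D%:R + 1 :> R by rewrite ltr_wpDl.
(* A vertex has up to [D] kept edges, so the probability of a large weight must be small relative to
   1/D; [+ 1] covers D = 0. *)
have [|K K0 hK] := @large_weight_small (h / 16 / (D%:R + 1)); first by rewrite divr_gt0.
pose eta := h / 16 / (D%:R + 1); have eta0 : 0 < eta by rewrite divr_gt0.
have [V [q [vl [big [mq vlK bigE vlq]]]]] := quantizer K0 eta0.
pose pr := law P w q.
have pr0 : forall v, 0 <= pr v := law_ge0 P w q.
have pr1 : \sum_v pr v = 1 := law_sum iid mq.
pose B := 2 * (D%:R * K); have B0 : 0 <= B by rewrite !mulr_ge0 // ltW.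
have C0 : 0 < B + 1 by lra.
have h4 : 0 < h / 4 by lra.
have [J [et et0 close]] := moments_scdf_close C0 h4.
(* A moment is [tau] from its expectation over the weights, which is [tau] from its value under
   [rho]; for two realisations this adds up to 4 [tau] <= [et]. The other term serves the count of
   bad vertices. *)
pose tau := Num.min (et / 4) (h / 16).
have tau0 : 0 < tau by rewrite lt_min; apply/andP; split; lra.
have tau1 : tau <= et / 4 by rewrite ge_min lexx.
have tau2 : tau <= h / 16 by rewrite ge_min lexx orbT.
(* Index 0 holds the count of large weights and index j + 1 the j-th trace; [fs] below uses the same
   shift, with the high-degree indicator at 0. *)
pose Phi n (g : rel 'I_n) (i : nat) (c : {ffun upairs n -> V}) : R :=
  if i is j.+1 then \tr (trunc_mx vl D alpha g c ^+ j) else big_count R D g big c.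
pose infl (j : nat) : R := j%:R * B ^+ j.-1 * (8 * K).
have infl0 j : 0 <= infl j by rewrite !mulr_ge0 ?exprn_ge0 // ltW.
(* One constant above all influences, the 2 being that of [big_count], so that a single rate serves
   every statistic. *)
pose L := 2 + \sum_(j < J) infl j.
have L0 : 0 < L by rewrite ltr_wpDr // sumr_ge0.
have [r r01 tail] := bounded_influence_tail pr0 pr1 L0 D0 tau0.
pose CB n (g : rel 'I_n) (c : {ffun upairs n -> V}) :=
  [exists i : 'I_J.+1, tau * n%:R < `|Phi n g i c - Ex pr (Phi n g i)|].
pose fs (i : nat) := if i is j.+1 then moment_fun vl pr D alpha j else hd_ind R D.
constructor.
apply: (@SpectralLevel h fs J.+1 tau (fun n g => [set om | CB n g (config w q n om)])
  (J.+1%:R * 2) r) => //.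
- case=> [|j]; first by exists 2%N; exact: hd_ind_local.
  by exists j.+2; exact: moment_fun_local.
- case=> [|j]; first by exists 1 => G; rewrite normr_nat lern1 leq_b1.
  by exists (`|2 * (D%:R * K)| ^+ j) => G; exact: moment_fun_bounded.
- move=> n g; apply: (finite_valued_measurable (X := config w q n)) => c.
  exact: (config_measurable iid mq).
- move=> n g gs; rewrite (config_pred iid mq) lee_fin.
  apply: (@le_trans _ _ (\sum_(i < J.+1) Pr pr (fun c => tau * n%:R < `|Phi n g i c - Ex pr (Phi n g i)|))).
    rewrite /Pr -(Ex_sum pr) -/pr; apply: Ex_le => // c; rewrite /CB.
    case: existsP => [[i Hi]|_] /=; last by apply: sumr_ge0.
    by rewrite (bigD1 i) //= Hi lerDl sumr_ge0.
  apply: (@le_trans _ _ (\sum_(i < J.+1) 2 * r ^+ n)); last first.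
    by rewrite sumr_const card_ord -[leLHS]mulr_natl; lra.
  apply: ler_sum => -[i iJ] _ /=; apply: (tail _ (kept_pairs D g)) => [p c c' cc'|].
    case: i iJ => [|j] jJ /=.
      apply: le_trans (@big_count_influence R V D n g gs big p c c' cc') _; case: ifP => // _.
      by rewrite lerDl sumr_ge0.
    apply: le_trans (@trace_influence R V vl K D alpha vlK n g gs j p c c' cc') _; case: ifP => // _.
    rewrite -/B -/(infl j) /L (bigD1 (Ordinal (jJ : (j < J)%N))) //=.
    have : 0 <= \sum_(i < J | i != Ordinal (jJ : (j < J)%N)) infl i by apply: sumr_ge0.
    by lra.
  apply: (@le_trans _ _ (D * n)%:R); first by rewrite ler_nat card_kept_pairs.
  by rewrite natrM ler_wpM2r // lerDl.
- by move=> n g G S mS ind; exact: (config_indep iid mq).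
move=> n g om n' g' om' n0 n0' gs gs' gg gg' bad bad' x.
have key m (f : rel 'I_m) o : (0 < m)%N -> simple_graph f -> graph_good fs J.+1 tau f ->
   ~ CB m f (config w q m o) ->
   let N := trunc_mx vl D alpha f (config w q m o) in
   [/\ forall y, scdf (eigvals (Delta alpha w o f)) y <= scdf (eigvals N) (y + h / 8) + h / 4 /\
          scdf (eigvals N) y <= scdf (eigvals (Delta alpha w o f)) (y + h / 8) + h / 4,
       size (eigvals N) = m,
       forall l, l \in eigvals N -> `|l| <= B + 1 &
       forall j, (j < J)%N -> `|avg (eigvals N) (fun l => l ^+ j) -
          Rintegral rho setT (moment_fun vl pr D alpha j)| <= et / 2].
  move=> m0 fsim fg /negP; rewrite negb_exists => /forallP nb N.
  have m0' : 0 < m%:R :> R by rewrite ltr0n.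
  have NT : N^T = N by exact: trunc_mx_sym.
  have dev i : (i < J.+1)%N -> `|Phi m f i (config w q m o) - Ex pr (Phi m f i)| <= tau * m%:R.
    by move=> iJ; have := nb (Ordinal iJ); rewrite -leNgt.
  split.
  - move=> y; apply: (@Delta_trunc_close _ _ _ w alpha V q vl big K eta D) => //.
    + exact: ltW.
    + rewrite /eta; have : D%:R * (h / 16 / (D%:R + 1)) <= h / 16.
        have -> : D%:R * (h / 16 / (D%:R + 1)) = h / 16 * (D%:R / (D%:R + 1)) by lra.
        by apply: ler_piMr; [exact: ltW|rewrite ler_pdivrMr // mul1r lerDl].
      by lra.
    + have := fg 0%N isT; rewrite /= ler_norml => /andP[_ ?]; lra.
    + have := dev 0%N isT; rewrite /= ler_norml => /andP[_ h1].
      have h2 := @Ex_big_count R V D m f big pr pr0 pr1.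
      have h3 : D%:R * \sum_(v | big v) pr v <= h / 16.
        have -> : \sum_(v | big v) pr v = fine (P [set om | K < `|w 0%N 0%N om|]).
          rewrite -[LHS]/(fine (\sum_(v | big v) pr v)%:E) (law_pred iid mq); congr (fine (P _)).
          by apply/seteqP; split=> o' /=; rewrite bigE.
        have := ltW hK; rewrite ler_pdivlMr //; set p := fine _.
        have p0 : 0 <= p by rewrite fine_ge0.
        by lra.
      have : m%:R * (D%:R * \sum_(v | big v) pr v) <= m%:R * (h / 16) by rewrite ler_pM2l.
      have : tau * m%:R <= h / 16 * m%:R by rewrite ler_pM2r.
      by lra.
  - exact: size_eigvals.
  - move=> l lN; have : `|l| <= B by apply: (eigvals_bounded NT _ lN); exact: trunc_mx_row_sum.
    by lra.
  - move=> j jJ; have := dev j.+1 jJ; have := fg j.+1 jJ; rewrite /= U_int_moment_fun //.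
    rewrite (mxtrace_expr_eigvals j NT) /avg (size_eigvals NT).
    set E := Ex pr _; set S := \sum_(l <- _) _; set I := Rintegral _ _ _ => h1 h2.
    have h3 : `|m%:R^-1 * S - m%:R^-1 * E| <= tau.
      rewrite -mulrBr normrM gtr0_norm ?invr_gt0 // mulrC ler_pdivrMr //.
    move: h1 h3; rewrite !ler_norml => /andP[? ?] /andP[? ?]; apply/andP; split; lra.
(* Chaining [Delta] to its truncation, truncation to truncation, and back gives shift h/8 + h/4 +
   h/8 and defect 3h/4, both within h. *)
have [c1 sz1 b1 m1] := key _ _ _ n0 gs gg bad.
have [c2 sz2 b2 m2] := key _ _ _ n0' gs' gg' bad'.
have [c1x _] := c1 x.
have := close _ _ _ _ b1 b2; rewrite sz1 sz2 => /(_ n0 n0') cl.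
have {}cl := cl _ (x + h / 8).
have [_ c2x] := c2 (x + h / 8 + h / 4).
have mono : scdf (eigvals (Delta alpha w om' g')) (x + h / 8 + h / 4 + h / 8) <=
   scdf (eigvals (Delta alpha w om' g')) (x + h) by apply: scdf_le; lra.
suff : scdf (eigvals (trunc_mx vl D alpha g (config w q n om))) (x + h / 8) <=
   scdf (eigvals (trunc_mx vl D alpha g' (config w q n' om'))) (x + h / 8 + h / 4) + h / 4 by lra.
apply: cl => j jJ; have := m1 j jJ; have := m2 j jJ.
by rewrite !ler_norml => /andP[? ?] /andP[? ?]; apply/andP; split; lra.
Qed.

End Levels.

(** * The limit measure and deterministic graphs *)

Section Assembly.
Context (d : measure_display) (T : measurableType d) (R : realType) (P : probability T R).
Variables (w : nat -> nat -> T -> R) (alpha : bool) (rho : probability (Gstar R) R).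
Hypothesis iid : iid_weights P w.

Section LimitMeasure.
Variable lv : forall k, spectral_level P w alpha rho (harm R k).

Definition lv_good k n (g : rel 'I_n) (om : T) : Prop :=
  graph_good rho (lv_fun (lv k)) (lv_size (lv k)) (lv_tol (lv k)) g /\ ~ lv_bad (lv k) g om.

(** [K k] is taken to be the spectra of all realisations good at level k, on graphs of every size.
    One realisation good at all levels up to k, for each k, suffices to build [nu], which then
    serves all good realisations. *)
Lemma limit_measure :
  (forall k, exists n (g : rel 'I_n) om, [/\ (0 < n)%N, simple_graph g &
     forall j, (j <= k)%N -> lv_good j g om]) ->
  exists nu : probability R R, forall k n (g : rel 'I_n) om,
    (0 < n)%N -> simple_graph g -> lv_good k g om ->
    levy_close (eigvals (Delta alpha w om g)) nu (2 * harm R k).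
Proof.
move=> H.
pose K k (s : seq R) := exists n (g : rel 'I_n) om,
  [/\ (0 < n)%N, simple_graph g, lv_good k g om & s = eigvals (Delta alpha w om g)].
have Hs k : exists s : seq R, (0 < size s)%N /\ forall j, (j <= k)%N -> K j s.
  have [n [g [om [n0 gs gd]]]] := H k; exists (eigvals (Delta alpha w om g)).
  split; first by rewrite size_eigvals //; exact: Delta_sym.
  by move=> j jk; exists n, g, om; split=> //; exact: gd.
have [s_ s_P] := choice Hs.
have Kclose k s t : K k s -> K k t -> forall x, scdf s x <= scdf t (x + harm R k) + harm R k.
  move=> [n [g [om [n0 gs [gg nb] ->]]]] [n' [g' [om' [n0' gs' [gg' nb'] ->]]]] x.
  exact: (@lv_close _ _ _ _ _ _ _ _ (lv k) n g om n' g' om' n0 n0' gs gs' gg gg' nb nb' x).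
have Ks j k : (j <= k)%N -> K j (s_ k) by move=> jk; have [_] := s_P k; apply.
have [nu nuP] := levy_limit Kclose Ks (fun k => (s_P k).1).
exists nu => k n g om n0 gs gd x; apply: nuP.
by exists n, g, om; split.
Qed.

End LimitMeasure.

Lemma Delta_levy_le n (g : rel 'I_n) om (nu : probability R R) (h : R) : simple_graph g ->
  0 <= h -> levy_close (eigvals (Delta alpha w om g)) nu h -> levy (Delta alpha w om g) nu <= h.
Proof.
move=> gs h0 cl; apply: ge_inf; first by exists 0 => e [].
split=> // x; have := cl x.
by rewrite !scdf_count size_eigvals //; exact: Delta_sym.
Qed.

Lemma Delta_levy_bounds n (g : rel 'I_n) om (nu : probability R R) : simple_graph g ->
  0 <= levy (Delta alpha w om g) nu <= 1.
Proof.
move=> gs.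
have l1 : levy_close (eigvals (Delta alpha w om g)) nu 1.
  move=> x; have /andP[F0 F1] := fine_cdf01 nu x.
  have := scdf_le1 (eigvals (Delta alpha w om g)) (x - 1).
  have := scdf_ge0 (eigvals (Delta alpha w om g)) (x + 1).
  by move=> *; apply/andP; split; lra.
rewrite (Delta_levy_le gs _ l1) // andbT; apply: lb_le_inf.
  exists 1; split=> // x; have := l1 x.
  by rewrite !scdf_count size_eigvals //; exact: Delta_sym.
by move=> e [].
Qed.

Lemma local_integrable r (f : rooted_graph -> R) : local_fun r f ->
  (exists C : R, forall G, `|f G| <= C) -> rho.-integrable setT (EFin \o (f : Gstar R -> R)).
Proof.
move=> lf [C fC]; apply: measurable_bounded_integrable => //.
- by rewrite [X in (X < _)%E]probability_setT ltry.
- exact: local_fun_measurable lf.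
- exists C; split; first exact: num_real.
  by move=> y Cy x _ /=; apply: le_trans (fC x) (ltW Cy).
Qed.

Lemma local_integral r (f : rooted_graph -> R) : local_fun r f ->
  (exists C : R, forall G, `|f G| <= C) ->
  (\int[rho]_x (f x)%:E)%E = (Rintegral rho setT f)%:E.
Proof.
by move=> lf fC; rewrite /Rintegral fineK //; apply: integrable_fin_num => //; exact: local_integrable lf fC.
Qed.

Lemma near_forall_lt (Q : nat -> nat -> Prop) m :
  (forall i, (i < m)%N -> \forall n \near \oo, Q i n) ->
  \forall n \near \oo, forall i, (i < m)%N -> Q i n.
Proof.
elim: m => [|m IH] H; first by near=> n.
have h1 := H m (leqnn _); have h2 := IH (fun i im => H i (ltnW im)).
apply: filterS2 h1 h2 => n Qm Qlt i; rewrite ltnS leq_eqVlt => /predU1P[->//|].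
exact: Qlt.
Unshelve. all: by end_near. Qed.

Section Deterministic.
Variable G : forall n, rel 'I_n.
Hypothesis Gs : forall n, simple_graph (@G n).
Hypothesis GU : forall f : rooted_graph -> R, rg_bcont f ->
  (U_int (@G n) f)%:E @[n --> \oo] --> (\int[rho]_x (f x)%:E)%E.

Lemma graph_good_near h (lv : spectral_level P w alpha rho h) :
  \forall n \near \oo, graph_good rho (lv_fun lv) (lv_size lv) (lv_tol lv) (@G n).
Proof.
apply: near_forall_lt => i _.
have [r lf] := lv_local lv i; have fC := lv_bounded lv i.
have := GU (local_fun_bcont lf fC); rewrite (local_integral lf fC) => /fine_cvg.
move=> /cvgrPdist_le /(_ _ (lv_tol_gt0 lv)); apply: filterS => n /=.
by rewrite distrC.
Qed.

Lemma eventually_not_bad h (lv : spectral_level P w alpha rho h) :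
  P.-negligible (lim_sup_set (fun n => lv_bad lv (@G n))).
Proof.
have mF n : measurable (lv_bad lv (@G n)) := lv_measurable lv (@G n).
apply/negligibleP.
  by apply: bigcap_measurable => // n _; apply: bigcup_measurable => k _; exact: mF.
apply: lim_sup_set_cvg0 => //.
have /andP[r0 r1] := lv_rate01 lv; set C := lv_cst lv; set r := lv_rate lv in r0 r1.
apply: (@le_lt_trans _ _ (\sum_(n <oo) (C * r ^+ n)%:E)%E).
  by apply: lee_nneseries => // n _; exact: lv_prob.
have /cvg_geometric_series : `|r| < 1 by rewrite ger0_norm.
move=> /(_ C) H.
have -> : (\sum_(n <oo) (C * r ^+ n)%:E)%E = (C * (1 - r)^-1)%:E.
  apply/cvg_lim => //; apply: cvg_EFin; first by near=> n; rewrite sumEFin.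
  apply: cvg_trans H; apply: near_eq_cvg; near=> n.
  by rewrite /= sumEFin.
by rewrite ltry.
Unshelve. all: by end_near. Qed.

Lemma deterministic_limit : exists nu : probability R R,
  {ae P, forall om, esm_weak_cvg (fun n => Delta alpha w om (@G n)) nu}.
Proof.
have lvE k : exists lv : spectral_level P w alpha rho (harm R k), True.
  by have [lv] := spectral_level_exists alpha iid rho (harm_gt0 R k); exists lv.
pose lv k := projT1 (cid (lvE k)).
pose bad := \bigcup_k lim_sup_set (fun n => lv_bad (lv k) (@G n)).
have nbad : P.-negligible bad.
  by apply: negligible_bigcup => k; exact: eventually_not_bad.
have good om k : ~ bad om -> \forall n \near \oo, (0 < n)%N /\ lv_good lv k (@G n) om.
  move=> nb.
  have [N HN] : exists N, forall n, (N <= n)%N -> ~ lv_bad (lv k) (@G n) om.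
    apply: contrapT => nex; apply: nb; exists k => // N _.
    apply: contrapT => nU; apply: nex; exists N => n Nn bn; apply: nU.
    by exists n.
  near=> n; split; first by near: n; exact: nbhs_infty_gt.
  split; first by near: n; exact: graph_good_near.
  by apply: HN; near: n; exact: nbhs_infty_ge.
(* A single good outcome supplies the approximating spectra; [nu] is thus fixed before the almost
   sure statement is examined. *)
have [om0 om0P] : exists om, ~ bad om.
  apply: contrapT => nex; have [B [mB B0 sub]] := nbad.
  have BT : B = setT.
    by apply/seteqP; split=> // om _; apply: sub; apply: contrapT => nb; apply: nex; exists om.
  by have := probability_setT P; rewrite -BT B0 => /eqP; rewrite eq_sym onee_eq0.
have [k|nu nuP] := limit_measure (lv := lv).
  have : \forall n \near \oo, forall j, (j < k.+1)%N -> (0 < n)%N /\ lv_good lv j (@G n) om0.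
    by apply: near_forall_lt => j _; exact: good.
  move=> /filter_ex[n Hn]; exists n, (@G n), om0; split=> //.
  - by have [] := Hn 0%N isT.
  - by move=> j jk; have [] := Hn j jk.
exists nu; apply: negligibleS nbad => om /= nom; apply: contrapT => nb; apply: nom.
move=> f cf fC.
rewrite (_ : (fun n => (esm_int _ f)%:E) = (fun n => (avg (eigvals (Delta alpha w om (@G n))) f)%:E)).
  apply: levy_close_avg_cvg cf fC => h h0.
  have h2 : 0 < h / 2 by lra.
  have [k kh] := harm_small h2; have := good om k nb.
  apply: filterS => n [n0 gd]; split.
    by rewrite size_eigvals //; exact: Delta_sym.
  have cl := nuP k n (@G n) om n0 (Gs n) gd.
  move=> x; have /andP[c1 c2] := cl x; have hk := harm_gt0 R k.
  have m1 : scdf (eigvals (Delta alpha w om (@G n))) (x - h) <=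
    scdf (eigvals (Delta alpha w om (@G n))) (x - 2 * harm R k) by apply: scdf_le; lra.
  have m2 : scdf (eigvals (Delta alpha w om (@G n))) (x + 2 * harm R k) <=
    scdf (eigvals (Delta alpha w om (@G n))) (x + h) by apply: scdf_le; lra.
  by apply/andP; split; lra.
apply/funext => n; congr EFin; rewrite /esm_int /avg size_eigvals //.
exact: Delta_sym.
Unshelve. all: by end_near. Qed.

End Deterministic.
End Assembly.

(** * Random graphs *)

(* Unlike [ge0_le_integral], this does not ask [f] to be measurable. *)
Lemma ge0_le_integral_any (d : measure_display) (T : measurableType d) (R : realType)
    (mu : {measure set T -> \bar R}) (f g : T -> \bar R) :
  (forall x, 0 <= f x)%E -> (forall x, f x <= g x)%E ->
  (\int[mu]_x f x <= \int[mu]_x g x)%E.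
Proof.
move=> f0 fg; have g0 x : (0 <= g x)%E by apply: le_trans (f0 x) (fg x).
rewrite !ge0_integralTE //; apply: ereal_sup_le => _ [h /= hf <-].
by exists h => // x; apply: le_trans (hf x) (fg x).
Qed.

Section FiniteValuedIntegral.
Context (d : measure_display) (T : measurableType d) (R : realType) (P : probability T R).
Variables (F : finType) (X : T -> F).
Hypothesis mX : forall x, measurable [set om | X om = x].

Definition mass (x : F) : R := fine (P [set om | X om = x]).

Lemma mass_ge0 x : 0 <= mass x. Proof. by rewrite fine_ge0. Qed.

Lemma massE x : (mass x)%:E = P [set om | X om = x].
Proof. by rewrite fineK // fin_num_measure. Qed.

Lemma mass_pred (A : pred F) : P [set om | A (X om)] = (\sum_(x | A x) mass x)%:E.
Proof.
rewrite -[X in P X]setIT (finite_valued_measure _ mX) // -sumEFin.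
by apply: eq_bigr => x _; rewrite setIT massE.
Qed.

Lemma mass_sum : \sum_x mass x = 1.
Proof.
by apply: EFin_inj; rewrite -(mass_pred xpredT) -[RHS](probability_setT P); congr (P _); apply/seteqP; split.
Qed.

Lemma finite_valued_integral (phi : F -> R) :
  (\int[P]_om (phi (X om))%:E = (\sum_x mass x * phi x)%:E)%E.
Proof.
transitivity (\int[P]_om \sum_(x : F) ((phi x)%:E * (\1_[set om | X om = x] om)%:E))%E.
  apply: eq_integral => om _; rewrite (bigD1 (X om)) //= big1 => [|x xX].
    by rewrite indicE mem_set // mule1 adde0.
  by rewrite indicE memNset ?mule0 // => /= /eqP; rewrite eq_sym (negbTE xX).
rewrite integral_sum // => [|x]; last by apply: integrableZl => //; exact: integrable_indic.
rewrite -sumEFin; apply: eq_bigr => x _; rewrite integralZl //; last exact: integrable_indic.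
by rewrite integral_indic // setIT EFinM [RHS]muleC; congr (_ * _)%E; rewrite massE.
Qed.

End FiniteValuedIntegral.

Section ProductIntegrals.
Variables (R : realType) (rho : probability (Gstar R) R).
Variables (r : nat) (f : rooted_graph -> R).
Hypotheses (lf : local_fun r f) (fC : exists C : R, forall G, `|f G| <= C).

Lemma integral_prod_local (h : rooted_graph -> R) : local_fun r h ->
  (exists C : R, forall G, `|h G| <= C) ->
  (\int[(rho \x rho)%E]_x (f x.1 * h x.2)%:E)%E =
  (Rintegral rho setT f * Rintegral rho setT h)%:E.
Proof.
move=> lh hC; have [C HC] := fC; have [C' HC'] := hC.
pose F (x : Gstar R * Gstar R) : R := f x.1 * h x.2.
have mF : measurable_fun setT F.
  apply: measurable_funM.
    by apply: (measurableT_comp (local_fun_measurable lf)) => //; exact: measurable_fst.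
  by apply: (measurableT_comp (local_fun_measurable lh)) => //; exact: measurable_snd.
have E : ((rho \x rho)%E [set: Gstar R * Gstar R] = 1)%E.
  by rewrite -setXTT product_measure1E // [X in (X * _)%E](probability_setT rho)
    [X in (_ * X)%E](probability_setT rho) mule1.
have iF : (rho \x rho)%E.-integrable setT (EFin \o F).
  apply: measurable_bounded_integrable => //.
    by rewrite [X in (X < _)%E]E ltry.
  exists (C * C'); split; first exact: num_real.
  move=> y Cy x _ /=; apply: le_trans (ltW Cy); rewrite /F normrM.
  by apply: ler_pM.
rewrite -[LHS]/(\int[(rho \x rho)%E]_x (EFin \o F) x)%E -(integral12_prod_meas1 iF).
rewrite /fubini_F /=.
transitivity (\int[rho]_x ((Rintegral rho setT h)%:E * (f x)%:E))%E.
  apply: eq_integral => x _; rewrite muleC /F /=.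
  under eq_integral do rewrite EFinM.
  by rewrite integralZl //; [rewrite (local_integral rho lh hC)|exact: local_integrable lh hC].
rewrite integralZl //; last exact: local_integrable lf fC.
by rewrite (local_integral rho lf fC) -EFinM mulrC.
Qed.

Lemma rg2_bcont_local (h : rooted_graph -> R) : local_fun r h ->
  (exists C : R, forall G, `|h G| <= C) -> rg2_bcont (fun x => f x.1 * h x.2).
Proof.
move=> lh [C' HC']; have [C HC] := fC; split.
  by exists (C * C') => x; rewrite normrM; apply: ler_pM.
move=> G1 G2 e e0; exists r.+1%:R^-1; first by rewrite invr_gt0.
by move=> H1 H2 /local_dist_ball_iso/lf <- /local_dist_ball_iso/lh <-; rewrite subrr normr0.
Qed.

End ProductIntegrals.

Lemma U2_int_prod (R : realType) n (g : rel 'I_n) (f h : rooted_graph -> R) :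
  U2_int g (fun x => f x.1 * h x.2) = U_int g f * U_int g h.
Proof.
rewrite /U2_int /U_int /= mulrACA -invfM -expr2; congr (_ * _).
by rewrite mulr_suml; apply: eq_bigr => o _; rewrite mulr_sumr.
Qed.

Lemma U_int_cst (R : realType) n (g : rel 'I_n) (a : R) : (0 < n)%N -> U_int g (fun=> a) = a.
Proof.
move=> n0; rewrite /U_int sumr_const card_ord -[a *+ n]mulr_natl mulKf //.
by rewrite pnatr_eq0 -lt0n.
Qed.

Section RandomGraphs.
Context (d : measure_display) (T : measurableType d) (R : realType) (P : probability T R).
Variables (w : nat -> nat -> T -> R) (alpha : bool) (rho : probability (Gstar R) R).
Hypothesis iid : iid_weights P w.
Variable G : forall n, T -> rel 'I_n.
Hypothesis Gs : forall n om, simple_graph (@G n om).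
Hypothesis mG : forall n i j, measurable [set om | @G n om i j].
Hypothesis Gind : forall n, indep_of_graph P w (@G n).
Hypothesis GU : forall f : rooted_graph * rooted_graph -> R, rg2_bcont f ->
  (\int[P]_om (U2_int (@G n om) f)%:E)%E @[n --> \oo]
    --> (\int[(rho \x rho)%E]_x (f x)%:E)%E.

(** A code in a finite type turns the random graph into a finite-valued variable, so that integrals
    over it are finite sums. *)
Definition gcode n (om : T) : {ffun 'I_n * 'I_n -> bool} := [ffun p => @G n om p.1 p.2].
Definition gdec n (x : {ffun 'I_n * 'I_n -> bool}) : rel 'I_n := fun i j => x (i, j).

Lemma gcodeK n om : gdec (gcode n om) = @G n om.
Proof. by apply/funext => i; apply/funext => j; rewrite /gdec ffunE. Qed.

Lemma measurable_gcode n x : measurable [set om | gcode n om = x].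
Proof.
have -> : [set om | gcode n om = x] =
    \bigcap_(p in [set` enum {: 'I_n * 'I_n}]) [set om | @G n om p.1 p.2 = x p].
  apply/seteqP; split=> om /=; first by move=> <- p _ /=; rewrite ffunE.
  by move=> H; apply/ffunP => p; rewrite ffunE; apply: H; rewrite /= mem_enum.
apply: fin_bigcap_measurable => // -[i j] _ /=.
case: (x (i, j)); first exact: mG.
rewrite [X in measurable X](_ : _ = ~` [set om | @G n om i j]); first exact/measurableC/mG.
by apply/seteqP; split=> om /=; [move=> ->|move/negP/negbTE].
Qed.

Lemma graph_integral n (phi : rel 'I_n -> R) :
  (\int[P]_om (phi (@G n om))%:E = (\sum_x mass P (@gcode n) x * phi (gdec x))%:E)%E.
Proof.
rewrite -(finite_valued_integral P (@measurable_gcode n) (fun x => phi (gdec x))).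
by apply: eq_integral => om _; rewrite gcodeK.
Qed.

Lemma graph_pred_measurable n (S : set (rel 'I_n)) : measurable [set om | S (@G n om)].
Proof.
have := @finite_valued_measurable _ T _ (@gcode n) (@measurable_gcode n) (fun x => `[< S (gdec x) >]).
by congr measurable; apply/seteqP; split=> om /=; rewrite gcodeK => /asboolP.
Qed.

(** The variance about a is expanded. The test function f(x)f(y) sends the second moment of the
    [U]-mean to a^2, and f(x)1 sends its mean to a. *)
Lemma second_moment_cvg r (f : rooted_graph -> R) : local_fun r f ->
  (exists C : R, forall H, `|f H| <= C) ->
  (\sum_x mass P (@gcode n) x * (U_int (gdec x) f - Rintegral rho setT f) ^+ 2)
    @[n --> \oo] --> (0 : R).
Proof.
move=> lf fC; set a := Rintegral rho setT f.
have l1 : local_fun r (fun _ : rooted_graph => 1 : R) by [].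
have C1 : exists C : R, forall H : rooted_graph, `|1 : R| <= C by exists 1; rewrite normr1.
have i1 : Rintegral rho setT (fun=> 1 : R) = 1.
  by rewrite Rintegral_cst // [X in fine X]probability_setT mul1r.
have E2 : (\sum_x mass P (@gcode n) x * U_int (gdec x) f ^+ 2) @[n --> \oo] --> a ^+ 2.
  have := GU (rg2_bcont_local lf fC lf fC).
  rewrite (integral_prod_local rho lf fC lf fC) -/a -expr2.
  rewrite (_ : (fun n => _) = (fun n => (\sum_x mass P (@gcode n) x * U_int (gdec x) f ^+ 2)%:E)).
    by move/fine_cvg.
  apply/funext => n; rewrite (graph_integral (fun g => U2_int g (fun x => f x.1 * f x.2))).
  by congr EFin; apply: eq_bigr => x _; rewrite U2_int_prod expr2.
have E1 : (\sum_x mass P (@gcode n) x * U_int (gdec x) f) @[n --> \oo] --> a.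
  have := GU (rg2_bcont_local lf fC l1 C1).
  rewrite (integral_prod_local rho lf fC l1 C1) i1 mulr1 -/a.
  rewrite (_ : (fun n => _) = (fun n => (\sum_x mass P (@gcode n) x * U_int (gdec x) f)%:E)).
    by move/fine_cvg.
  apply/funext => n; rewrite (graph_integral (fun g => U2_int g (fun x => f x.1 * 1))).
  congr EFin; apply: eq_bigr => x _; rewrite (U2_int_prod _ f (fun=> 1)); congr (_ * _).
  (* For n = 0 the [U]-mean of the constant 1 is 0 rather than 1, but both sides then vanish. *)
  case: n x => [|n] x; last by rewrite U_int_cst // mulr1.
  by rewrite /U_int !big_ord0 !mulr0.
have -> : (fun n => \sum_x mass P (@gcode n) x * (U_int (gdec x) f - a) ^+ 2) =
   (fun n => \sum_x mass P (@gcode n) x * U_int (gdec x) f ^+ 2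
      + (- (2 * a)) * (\sum_x mass P (@gcode n) x * U_int (gdec x) f) + a ^+ 2).
  apply/funext => n.
  have -> : a ^+ 2 = \sum_x mass P (@gcode n) x * a ^+ 2.
    by rewrite -mulr_suml (mass_sum P (@measurable_gcode n)) mul1r.
  rewrite mulr_sumr -!big_split /=; apply: eq_bigr => x _.
  by set u := U_int _ _; set m := mass _ _ _; lra.
have z : a ^+ 2 + (- (2 * a)) * a + a ^+ 2 = 0 by rewrite expr2; lra.
have := cvgD (cvgD E2 (cvgM (cvg_cst (- (2 * a))) E1)) (cvg_cst (a ^+ 2)).
rewrite z; exact.
Qed.

Section OneLevel.
Variables (h : R) (lv : spectral_level P w alpha rho h).

Definition bad_graph n : set (rel 'I_n) :=
  [set g | ~ graph_good rho (lv_fun lv) (lv_size lv) (lv_tol lv) g].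

Definition bad_weights n : set T := [set om | lv_bad lv (@G n om) om].

Lemma bad_weightsE n x :
  [set om | gcode n om = x] `&` bad_weights n = [set om | @G n om = gdec x] `&` lv_bad lv (gdec x).
Proof.
apply/seteqP; split=> om [/= Gx bw]; split=> //=.
- by rewrite -Gx gcodeK.
- by rewrite -Gx gcodeK.
- by apply/ffunP => -[i j]; rewrite ffunE /= Gx.
- by rewrite /bad_weights /= Gx.
Qed.

Lemma bad_weights_measurable n : measurable (bad_weights n).
Proof.
have -> : bad_weights n = \bigcup_(x in [set` enum {: {ffun 'I_n * 'I_n -> bool}}])
    ([set om | @G n om = gdec x] `&` lv_bad lv (gdec x)).
  apply/seteqP; split=> om.
    move=> bw; exists (gcode n om); first by rewrite /= mem_enum.
    by rewrite -bad_weightsE.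
  by move=> [x _]; rewrite -bad_weightsE => -[].
apply: fin_bigcup_measurable => // x _; apply: measurableI; last exact: lv_measurable.
exact: (graph_pred_measurable (fun g => g = gdec x)).
Qed.

(** Conditioning on the graph: on each of its values the exceptional event is that of a fixed graph,
    and independence lets the uniform bound factor out. *)
Lemma bad_weights_small n :
  (P (bad_weights n) <= (lv_cst lv * lv_rate lv ^+ n)%:E)%E.
Proof.
have q0 : 0 <= lv_cst lv * lv_rate lv ^+ n.
  by have /andP[r0 _] := lv_rate01 lv; rewrite mulr_ge0 ?exprn_ge0 // lv_cst_ge0.
have -> : P (bad_weights n) =
    (\sum_x P ([set om | gcode n om = x] `&` bad_weights n))%E.
  rewrite -(finite_valued_measure P (@measurable_gcode n) xpredT (bad_weights_measurable n)).
  by congr (P _); apply/seteqP; split=> om; [split|case].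
apply: (@le_trans _ _ (\sum_x (mass P (@gcode n) x * (lv_cst lv * lv_rate lv ^+ n))%:E)%E); last first.
  by rewrite sumEFin -mulr_suml (mass_sum P (@measurable_gcode n)) mul1r.
apply: lee_sum => x _; rewrite bad_weightsE.
rewrite (lv_indep lv (gdec x) (graph_pred_measurable (fun g => g = gdec x)) (@Gind n)).
have -> : [set om | @G n om = gdec x] = [set om | gcode n om = x].
  apply/seteqP; split=> om /= E; last by rewrite -E gcodeK.
  by apply/ffunP => -[i j]; rewrite ffunE /= E.
rewrite -(massE P (@measurable_gcode n)) EFinM.
(* The bound is available for simple graphs; any other code has mass 0. *)
have [gx|ngx] := pselect (simple_graph (gdec x)).
  by apply: lee_wpmul2l; [rewrite lee_fin mass_ge0|exact: lv_prob].
have -> : mass P (@gcode n) x = 0.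
  rewrite /mass (_ : [set om | _] = set0) ?measure0 //; apply/seteqP; split=> om //= E.
  by apply: ngx; rewrite -E gcodeK.
by rewrite !mul0e.
Qed.

(** Chebyshev's inequality with a union bound over the finitely many statistics. *)
Lemma bad_graph_small : fine (P [set om | bad_graph (@G n om)]) @[n --> \oo] --> (0 : R).
Proof.
pose Y i n := \sum_x mass P (@gcode n) x *
  (U_int (gdec x) (lv_fun lv i) - Rintegral rho setT (lv_fun lv i)) ^+ 2.
have tol0 := lv_tol_gt0 lv.
have cY : ((lv_tol lv ^+ 2)^-1 * \sum_(i < lv_size lv) Y i n) @[n --> \oo] --> (0 : R).
  have cs : (\sum_(i < lv_size lv) Y i n) @[n --> \oo] --> \sum_(i < lv_size lv) (0 : R).
    apply: (@cvg_big R^o _ +%R 0 xpredT (@add_continuous R^o) _ _ (index_enum _)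
      (fun (i : 'I_(lv_size lv)) n => Y i n) (fun=> 0)) => i _.
    by have [r lf] := lv_local lv i; exact: (second_moment_cvg lf (lv_bounded lv i)).
  have := cvgM (cvg_cst (lv_tol lv ^+ 2)^-1) cs.
  have -> : \sum_(i < lv_size lv) (0 : R) = 0 by rewrite big1.
  rewrite mulr0; exact.
apply: (squeeze_cvgr _ (cvg_cst 0) cY); near=> n; rewrite fine_ge0 //=.
have -> : [set om | bad_graph (@G n om)] = [set om | `[< bad_graph (gdec (gcode n om)) >]].
  by apply/seteqP; split=> om /=; rewrite gcodeK => /asboolP.
rewrite (mass_pred P (@measurable_gcode n) (fun x => `[< bad_graph (gdec x) >])) /=.
rewrite ler_pdivlMl ?exprn_gt0 // mulr_sumr /Y exchange_big /= big_mkcond /=.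
apply: ler_sum => x _; rewrite -mulr_sumr.
have s0 : 0 <= \sum_(i < lv_size lv) (U_int (gdec x) (lv_fun lv i) -
   Rintegral rho setT (lv_fun lv i)) ^+ 2 by apply: sumr_ge0 => i _; rewrite sqr_ge0.
case: asboolP => [bx|_]; last by rewrite mulr_ge0 // mass_ge0.
rewrite mulrC ler_wpM2l ?mass_ge0 //.
have [i iS lti] : exists2 i, (i < lv_size lv)%N &
    lv_tol lv < `|U_int (gdec x) (lv_fun lv i) - Rintegral rho setT (lv_fun lv i)|.
  apply: contrapT => nex; apply: bx => i iS; rewrite leNgt; apply/negP => lti.
  by apply: nex; exists i.
rewrite (bigD1 (Ordinal iS)) //= -[leLHS]addr0; apply: lerD.
  by rewrite -[leRHS]real_normK ?num_real // ler_pXn2r ?nnegrE ?(ltW tol0) ?(ltW lti).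
by apply: sumr_ge0 => k _; rewrite sqr_ge0.
Unshelve. all: by end_near. Qed.

Definition bad_event n : set T := [set om | bad_graph (@G n om)] `|` bad_weights n.

Lemma bad_event_measurable n : measurable (bad_event n).
Proof.
by apply: measurableU; [exact: graph_pred_measurable|exact: bad_weights_measurable].
Qed.

Lemma bad_event_small : fine (P (bad_event n)) @[n --> \oo] --> (0 : R).
Proof.
have /andP[r0 r1] := lv_rate01 lv.
have c2 : (lv_cst lv * lv_rate lv ^+ n) @[n --> \oo] --> (0 : R).
  by apply: cvg_geometric; rewrite ger0_norm.
have cs : (fine (P [set om | bad_graph (@G n om)]) + lv_cst lv * lv_rate lv ^+ n) @[n --> \oo] --> (0 : R).
  by rewrite -[0 in X in _ --> X](addr0 0); apply: cvgD => //; exact: bad_graph_small.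
apply: (squeeze_cvgr _ (cvg_cst 0) cs); near=> n; rewrite fine_ge0 //=.
have mg := graph_pred_measurable (@bad_graph n); have mw := bad_weights_measurable n.
rewrite -lee_fin EFinD !fineK ?fin_num_measure //; last exact: bad_event_measurable.
apply: le_trans (measureU2 _ mg mw) _; apply: leeD2l; exact: bad_weights_small.
Unshelve. all: by end_near. Qed.

End OneLevel.

(** The Levy distance is at most 1 everywhere and at most 2 [harm k] off the bad event of level k,
    whose probability tends to 0; convergence in probability therefore gives convergence of the
    mean. *)
Lemma random_limit : exists nu : probability R R,
  (\int[P]_om (levy (Delta alpha w om (@G n om)) nu)%:E)%E @[n --> \oo] --> 0%E.
Proof.
have lvE k : exists lv : spectral_level P w alpha rho (harm R k), True.
  by have [lv] := spectral_level_exists alpha iid rho (harm_gt0 R k); exists lv.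
pose lv k := projT1 (cid (lvE k)).
have goodE k n om : ~ bad_event (lv k) n om -> lv_good lv k (@G n om) om.
  by move=> /not_orP[/contrapT gg nb]; split.
have [k|nu nuP] := limit_measure (lv := lv).
  (* With this bound the k + 1 bad events together have probability at most 1/2, so some outcome
     avoids them all. *)
  have k0 : 0 < (k.+1)%:R^-1 / 2 :> R by rewrite divr_gt0.
  have : \forall n \near \oo, forall j, (j < k.+1)%N ->
      (0 < n)%N /\ fine (P (bad_event (lv j) n)) < (k.+1)%:R^-1 / 2.
    apply: near_forall_lt => j _; near=> n; split; first by near: n; exact: nbhs_infty_gt.
    have : `|0 - fine (P (bad_event (lv j) n))| < (k.+1)%:R^-1 / 2.
      by near: n; move: (bad_event_small (lv j)) => /cvgrPdist_lt; apply.
    by rewrite sub0r normrN ger0_norm ?fine_ge0.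
  move=> /filter_ex[n Hn].
  have [om omP] : exists om, forall j, (j < k.+1)%N -> ~ bad_event (lv j) n om.
    apply: contrapT => nex.
    have : (P setT <= P (\big[setU/set0]_(j < k.+1) bad_event (lv j) n))%E.
      apply: le_measure; rewrite ?inE //.
        by apply: bigsetU_measurable => j _; exact: bad_event_measurable.
      move=> om _; apply: contrapT => nb; apply: nex; exists om => j jk bj; apply: nb.
      by rewrite -(bigcup_mkord k.+1 (fun j => bad_event (lv j) n)); exists j.
    rewrite probability_setT leNgt => /negP; apply.
    apply: (@le_lt_trans _ _ (\sum_(j < k.+1) P (bad_event (lv j) n))%E).
      apply: (@Boole_inequality _ _ _ P (fun j => bad_event (lv j) n)) => j _.
      exact: bad_event_measurable.
    apply: (@le_lt_trans _ _ (\sum_(j < k.+1) ((k.+1)%:R^-1 / 2)%:E)%E).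
      apply: lee_sum => j _; rewrite -[leLHS]fineK ?lee_fin ?ltW //.
        by have [] := Hn j (ltn_ord j).
      by apply: fin_num_measure; exact: bad_event_measurable.
    rewrite sumEFin lte_fin sumr_const card_ord -[X in X < _]mulr_natl mulrA divff ?pnatr_eq0 //.
    lra.
  exists n, (@G n om), om; split=> //.
  - by have [] := Hn 0%N isT.
  - by move=> j jk; apply: goodE; apply: omP.
exists nu.
have lb n om := @Delta_levy_bounds _ _ _ w alpha n (@G n om) om nu (Gs n om).
have int_ge0 n : (0 <= \int[P]_om (levy (Delta alpha w om (@G n om)) nu)%:E)%E.
  by apply: integral_ge0 => om _; rewrite lee_fin; have /andP[] := lb n om.
have int_le n k : (0 < n)%N ->
    (\int[P]_om (levy (Delta alpha w om (@G n om)) nu)%:E <=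
     (2 * harm R k)%:E + P (bad_event (lv k) n))%E.
  move=> n0; have mb := bad_event_measurable (lv k) n; have hk := harm_gt0 R k.
  apply: (@le_trans _ _ (\int[P]_om ((2 * harm R k)%:E + (\1_(bad_event (lv k) n) om)%:E))%E).
    apply: ge0_le_integral_any => om; first by rewrite lee_fin; have /andP[] := lb n om.
    rewrite -EFinD lee_fin indicE; have /andP[l0 l1] := lb n om.
    have [bo|nbo] := pselect (bad_event (lv k) n om).
      by rewrite mem_set //= mulr1n; lra.
    rewrite memNset //= mulr0n addr0; apply: Delta_levy_le => //; first by lra.
    by apply: nuP => //; exact: goodE.
  rewrite ge0_integralD //; last 2 first.
  - by move=> om _; rewrite lee_fin; lra.
  - by apply/measurable_EFinP; exact: measurable_indic.
  by rewrite integral_cst // [X in (_ * X + _)%E](probability_setT P) mule1 integral_indic // setIT.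
have int_fin n : (0 < n)%N -> (\int[P]_om (levy (Delta alpha w om (@G n om)) nu)%:E)%E \is a fin_num.
  move=> n0; rewrite ge0_fin_numE //; apply: le_lt_trans (int_le n 0%N n0) _.
  rewrite lte_add_pinfty ?ltry //; apply: le_lt_trans (probability_le1 _ _) (ltry _).
  exact: bad_event_measurable.
apply: cvg_EFin; first by near=> n; apply: int_fin; near: n; exact: nbhs_infty_gt.
apply/cvgrPdist_lt => e e0; have e4 : 0 < e / 4 by lra.
have [k ke] := harm_small e4; near=> n.
have n0 : (0 < n)%N by near: n; exact: nbhs_infty_gt.
have pb : fine (P (bad_event (lv k) n)) < e / 4.
  have : `|0 - fine (P (bad_event (lv k) n))| < e / 4.
    by near: n; move: (bad_event_small (lv k)) => /cvgrPdist_lt; apply.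
  by rewrite sub0r normrN ger0_norm ?fine_ge0.
rewrite sub0r normrN ger0_norm /= ?fine_ge0 //.
have := int_le n k n0; rewrite -[X in (X <= _)%E]fineK ?int_fin //.
rewrite -[P _]fineK -?EFinD ?lee_fin; last first.
  by apply: fin_num_measure; exact: bad_event_measurable.
by lra.
Unshelve. all: by end_near. Qed.

End RandomGraphs.

Theorem theorem3 (R : realType) (alpha : bool)
    (d : measure_display) (T : measurableType d) (P : probability T R)
    (w : nat -> nat -> T -> R) :
  iid_weights P w ->
  (* (i) deterministic graphs *)
  (forall G : forall n, rel 'I_n,
     (forall n, simple_graph (G n)) ->
     UI_wdeg P w (fun n _ => G n) ->
     (exists rho : probability (Gstar R) R,
        forall f : rooted_graph -> R, rg_bcont f ->
          (U_int (G n) f)%:E @[n --> \oo] --> (\int[rho]_x (f x)%:E)%E) ->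
     exists nu : probability R R,
       {ae P, forall om, esm_weak_cvg (fun n => Delta alpha w om (G n)) nu})
  /\
  (* (ii) random graphs, independent of the weights *)
  (forall G : forall n, T -> rel 'I_n,
     (forall n om, simple_graph (G n om)) ->
     (forall n i j, measurable [set om | G n om i j]) ->
     (forall n, indep_of_graph P w (G n)) ->
     UI_wdeg P w G ->
     (exists rho : probability (Gstar R) R,
        forall f : rooted_graph * rooted_graph -> R, rg2_bcont f ->
          (\int[P]_om (U2_int (G n om) f)%:E)%E @[n --> \oo]
            --> (\int[(rho \x rho)%E]_x (f x)%:E)%E) ->
     exists nu : probability R R,
       (\int[P]_om (levy (Delta alpha w om (G n om)) nu)%:E)%E @[n --> \oo]
         --> 0%E).
Proof.
move=> iid; split.
- by move=> G Gs _ [rho GU]; exact: (@deterministic_limit _ _ _ _ _ _ rho iid G Gs GU).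
- move=> G Gs mG Gind _ [rho GU].
  exact: (@random_limit _ _ _ _ _ _ rho iid G Gs mG Gind GU).
Qed.
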